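(* Let $\beta\in(\frac12,1)$, $T<\infty$ and $p\in\mathbb N$. There are constants $C_{T,p}$ and $N_{T,p}$ independent of $N$ such that for all $N>N_{T,p}$ the actor and critic network outputs satisfy $$\sup_{t\in[0,T]}\mathbb E\Big[\max_{(x,a)\in\mathcal X\times\mathcal A}|P_t^N(x,a)-P_t^{(0)}(x,a)|^p\Big]\le C_{T,p}\Big[N^{p(\beta-1)}+N^{p(\frac12-\beta)}\Big],$$ $$\sup_{t\in[0,T]}\mathbb E\Big[\max_{(x,a)\in\mathcal X\times\mathcal A}|Q_t^N(x,a)-Q_t^{(0)}(x,a)|^p\Big]\le C_{T,p}\Big[N^{p(\beta-1)}+N^{p(\frac12-\beta)}\Big].$$ In particular $P_t^N$ and $Q_t^N$ converge in $L_p$, uniformly over $t\in[0,T]$, to $P_t^{(0)}$ and $Q_t^{(0)}$.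
   Context: MDP. Let $\mathcal X\subset\mathbb R^{d_x}$ and $\mathcal A\subset\mathbb R^{d_a}$ be finite sets, $d'=d_x+d_a$, $r:\mathcal X\times\mathcal A\to[-1,1]$ a reward, $p(x'|x,a)$ transition probabilities, $\rho_0$ a probability distribution on $\mathcal X\times\mathcal A$ (with $x$-marginal also written $\rho_0(x)$), $\gamma\in(0,1)$, and $\tilde p(x'|x,a)=\gamma p(x'|x,a)+(1-\gamma)\rho_0(x')$. A policy is a function $f:\mathcal X\times\mathcal A\to[0,1]$ with $\sum_a f(x,a)=1$ for each $x$. $(\mathcal M,f)$ is the Markov chain on $\mathcal X\times\mathcal A$ with transition probabilities $(x,a)\to(x',a')$ equal to $p(x'|x,a)f(x',a')$; $(\mathcal M,f)_{\rm aux}$ is the same with $\tilde p$ in place of $p$. Standing assumption: for every policy $f$ with all $f(x,a)>0$, both chains are ergodic with unique stationary distributions $\pi^f$ and $\sigma_{\rho_0}^f$ respectively, and there is $L>0$ with $\max\{d_{TV}(\pi^f,\pi^{f'}),d_{TV}(\sigma_{\rho_0}^f,\sigma_{\rho_0}^{f'})\}\le L\,d_{TV}(f,f')$ for all such $f,f'$, where $d_{TV}(p_1,p_2)=\frac12\sum|p_1-p_2|$ (sum over the domain; policies are regarded as functions on $\mathcal X\times\mathcal A$). Networks. $\beta\in(\frac12,1)$ and $\alpha>0$ are fixed. The activation $\sigma:\mathbb R\to\mathbb R$ is in $C_b^3$, with $\sigma$ and its first three derivatives bounded by $1$, and $\sigma(x)/|x|^a\to0$ as $x\to\pm\infty$ for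 all $a>0$. For $\xi=(x,a)$, and $N$ hidden units, $$P_k^N(\xi)=\frac1{N^\beta}\sum_{i=1}^N B_k^i\sigma(U_k^i\cdot\xi),\qquad Q_k^N(\xi)=\frac1{N^\beta}\sum_{i=1}^N C_k^i\sigma(W_k^i\cdot\xi),$$ with $B_k^i,C_k^i\in\mathbb R$, $U_k^i,W_k^i\in\mathbb R^{d'}$; $f_k^N(x,a)=e^{P_k^N(x,a)}/\sum_{a'}e^{P_k^N(x,a')}$. At $k=0$: $(C_0^i,W_0^i)\sim v_0^{(0)}$ i.i.d., $(B_0^i,U_0^i)\sim\mu_0^{(0)}$ i.i.d., all of $C_0^i,W_0^i,B_0^i,U_0^i$ mutually independent, with $\mathbb E[C_0^i]=\mathbb E[B_0^i]=0$ and $v_0^{(0)},\mu_0^{(0)}$ of bounded support. Rates. $\alpha^N=\alpha N^{2\beta-2}$, $\zeta_k^N=\frac{1}{N^{2-2\beta}(1+k/N)}$, $\eta_k^N=\frac1{1+\log^2(1+k/N)}$; $g_k^N=\frac{\eta_k^N}{|\mathcal A|}+(1-\eta_k^N)f_k^N$. Sampling. $(x_0,a_0)\sim\rho_0$, $x_{k+1}\sim p(\cdot|x_k,a_k)$, $a_{k+1}\sim g_k^N(x_{k+1},\cdot)$; $(\tilde x_0,\tilde a_0)\sim\rho_0$, $\tilde x_{k+1}\sim\tilde p(\cdot|\tilde x_k,\tilde a_k)$, $\tilde a_{k+1}\sim g_k^N(\tilde x_{k+1},\cdot)$. Write $\xi_k=(x_k,a_k)$, $\tilde\xi_k=(\tilde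 x_k,\tilde a_k)$. Updates. With $D_k=r(\xi_k)+\gamma Q_k^N(\xi_{k+1})-Q_k^N(\xi_k)$, $C_{k+1}^i=C_k^i+\frac{\alpha^N}{N^\beta}D_k\sigma(W_k^i\cdot\xi_k)$, $W_{k+1}^i=W_k^i+\frac{\alpha^N}{N^\beta}D_kC_k^i\sigma'(W_k^i\cdot\xi_k)\xi_k$, $B_{k+1}^i=B_k^i+\frac{\zeta_k^N}{N^\beta}Q_k^N(\tilde\xi_k)\big(\sigma(U_k^i\cdot\tilde\xi_k)-\sum_{a'}f_k^N(\tilde x_k,a')\sigma(U_k^i\cdot(\tilde x_k,a'))\big)$, $U_{k+1}^i=U_k^i+\frac{\zeta_k^N}{N^\beta}Q_k^N(\tilde\xi_k)B_k^i\big(\sigma'(U_k^i\cdot\tilde\xi_k)\tilde\xi_k-\sum_{a'}f_k^N(\tilde x_k,a')\sigma'(U_k^i\cdot(\tilde x_k,a'))(\tilde x_k,a')\big)$. Time rescaling: $P_t^N=P_{\lfloor Nt\rfloor}^N$, $Q_t^N=Q_{\lfloor Nt\rfloor}^N$. Limits. $\langle h,\nu\rangle=\int h\,d\nu$; $B_{\xi,\xi'}(c,w)=\sigma(w\cdot\xi)\sigma(w\cdot\xi')+c^2\sigma'(w\cdot\xi)\sigma'(w\cdot\xi')\,\xi\cdot\xi'$; $\zeta_t=\frac1{1+t}$, $\eta_t=\frac1{1+\log^2(1+t)}$. $(Q^{(0)},P^{(0)})$ are continuous and solve $$Q_t^{(0)}(\xi)=\alpha\int_0^t\sum_{x',a',x'',a''}\big(r(x',a')+\gamma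 Q_s^{(0)}(x'',a'')-Q_s^{(0)}(x',a')\big)\langle B_{\xi,(x',a')},v_0^{(0)}\rangle\pi^{g_s^{(0)}}(x',a')g_s^{(0)}(x'',a'')p(x''|x',a')ds,$$ $$P_t^{(0)}(\xi)=\int_0^t\sum_{x',a',a''}\zeta_sQ_s^{(0)}(x',a')\big(\langle B_{\xi,(x',a')},\mu_0^{(0)}\rangle-\langle B_{\xi,(x',a'')},\mu_0^{(0)}\rangle\big)f_s^{(0)}(x',a'')\sigma_{\rho_0}^{g_s^{(0)}}(x',a')ds,$$ where $f_t^{(0)}={\rm Softmax}(P_t^{(0)})$ (softmax in $a$ for each fixed $x$) and $g_t^{(0)}=\frac{\eta_t}{|\mathcal A|}+(1-\eta_t)f_t^{(0)}$. *)

(* Defs.v *)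
From HB Require Import structures.
From mathcomp Require Import all_boot all_order all_algebra finmap.
From mathcomp Require Import all_classical all_reals all_analysis.

Set Implicit Arguments.
Unset Strict Implicit.
Unset Printing Implicit Defensive.
Import Order.TTheory GRing.Theory Num.Theory.
Import numFieldNormedType.Exports.

Local Open Scope classical_set_scope.
Local Open Scope ring_scope.

(* MathComp-Analysis has no measurable structure on matrices: equip them with
   the product sigma-algebra, as the library does for tuples. *)
Definition measure_matrix_display : measure_display -> measure_display.
Proof. exact. Qed.

Section measurable_matrix.
Context d (T : measurableType d) (m n : nat).

Definition matrix_cylinders : set (set 'M[T]_(m, n)) :=
  [set E | exists i j, exists2 A : set T, measurable A &
     E = [set B : 'M[T]_(m, n) | A (B i j)]].

HB.instance Definition _ := @isMeasurable.Build (measure_matrix_display d)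
  'M[T]_(m, n) <<s matrix_cylinders >> (@sigma_algebra0 _ setT _)
  (@sigma_algebraC _ _) (@sigma_algebra_bigcup _ setT _).

End measurable_matrix.

Definition dotv (R : realType) (n : nat) (u v : 'rV[R]_n) : R :=
  \sum_j u 0 j * v 0 j.

(* Finite Markov chains, given by their transition function K s s' *)
Section chains.
Context (R : realType) (S : finType).
Implicit Types (K : S -> S -> R) (m : S -> R).

Definition is_distr m := (forall s, 0 <= m s) /\ \sum_s m s = 1.

Fixpoint nstep K (n : nat) (s s' : S) : R :=
  if n is n'.+1 then \sum_u K s u * nstep K n' u s' else (s == s')%:R.

Definition irreducible_chain K := forall s s', exists n, 0 < nstep K n s s'.

(* 1 is the only common divisor of the return times *)
Definition aperiodic_chain K := forall s (e : nat),
  (forall n, (0 < n)%N -> 0 < nstep K n s s -> (e %| n)%N) -> e = 1%N.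

Definition ergodic_chain K := irreducible_chain K /\ aperiodic_chain K.

Definition stationary K m :=
  is_distr m /\ forall s', \sum_s m s * K s s' = m s'.

Definition dTV (m1 m2 : S -> R) : R := 2^-1 * \sum_s `|m1 s - m2 s|.

End chains.

Record mdp (R : realType) (dx da : nat) := Mdp {
  stX : {fset 'rV[R]_dx};
  acA : {fset 'rV[R]_da};
  reward : stX * acA -> R;
  trans : stX * acA -> stX -> R; (* trans (x, a) x' = p(x' | x, a) *)
  rho0 : stX * acA -> R;
  gam : R;
  reward_bound : forall z, -1 <= reward z <= 1;
  trans_distr : forall z, is_distr (trans z);
  rho0_distr : is_distr rho0;
  gam_bound : 0 < gam < 1
}.

Section actor_critic.
Context (R : realType) (dx da : nat) (M : mdp R dx da).
Local Notation X := (stX M).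
Local Notation A := (acA M).
Local Notation Z := (X * A)%type.
Local Notation vec := 'rV[R]_(dx + da).

Definition rho0x (x : X) : R := \sum_(a : A) rho0 (x, a).

Definition trans_aux (z : Z) (x' : X) : R :=
  gam M * trans z x' + (1 - gam M) * rho0x x'.

Definition is_policy (f : Z -> R) :=
  (forall z, 0 <= f z <= 1) /\ forall x, \sum_(a : A) f (x, a) = 1.

Definition pos_policy (f : Z -> R) := is_policy f /\ forall z, 0 < f z.

Definition chain (q : Z -> X -> R) (f : Z -> R) (z z' : Z) : R := q z z'.1 * f z'.

Definition ergodic_with (K : Z -> Z -> R) (m : Z -> R) :=
  [/\ ergodic_chain K, stationary K m &
      forall m', stationary K m' -> m' = m].

(* statd f and statd_aux f are the distributions pi^f and sigma_{rho_0}^f;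
   their values at functions f that are not positive policies are irrelevant. *)
Definition standing_assumption (statd statd_aux : (Z -> R) -> Z -> R) :=
  (forall f, pos_policy f ->
     ergodic_with (chain (@trans _ _ _ M) f) (statd f) /\
     ergodic_with (chain trans_aux f) (statd_aux f)) /\
  exists2 L : R, 0 < L & forall f f', pos_policy f -> pos_policy f' ->
    Num.max (dTV (statd f) (statd f')) (dTV (statd_aux f) (statd_aux f'))
      <= L * dTV f f'.

Definition emb (z : Z) : vec := row_mx (\val z.1) (\val z.2).

Definition softmax (h : Z -> R) (z : Z) : R :=
  expR (h z) / \sum_(a : A) expR (h (z.1, a)).

Definition explore (eta : R) (f : Z -> R) (z : Z) : R :=
  eta / #|{: A}|%:R + (1 - eta) * f z.

Definition activation (sigma : R -> R) :=
  [/\ forall n x, (n < 3)%N -> derivable (derive1n n sigma) x 1,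
      continuous (derive1n 3 sigma),
      forall n x, (n <= 3)%N -> `|derive1n n sigma x| <= 1,
      forall a, 0 < a -> sigma x / `|x| `^ a @[x --> +oo] --> 0 &
      forall a, 0 < a -> sigma x / `|x| `^ a @[x --> -oo] --> 0].

Record params (N : nat) := Params {
  prmC : 'I_N -> R; prmW : 'I_N -> vec;
  prmB : 'I_N -> R; prmU : 'I_N -> vec
}.

Definition zeta (t : R) : R := (1 + t)^-1.
Definition eta (t : R) : R := (1 + ln (1 + t) ^+ 2)^-1.

Section algorithm.
Context (beta alpha : R) (sigma : R -> R) (N : nat).

Definition alphaN : R := alpha * N%:R `^ (2 * beta - 2).
Definition zetaN (k : nat) : R :=
  (N%:R `^ (2 - 2 * beta) * (1 + k%:R / N%:R))^-1.
Definition etaN (k : nat) : R := (1 + ln (1 + k%:R / N%:R) ^+ 2)^-1.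

Definition net (c : 'I_N -> R) (w : 'I_N -> vec) (z : Z) : R :=
  (N%:R `^ beta)^-1 * \sum_i c i * sigma (dotv (w i) (emb z)).

Definition actorP (th : params N) : Z -> R := net (prmB th) (prmU th).
Definition criticQ (th : params N) : Z -> R := net (prmC th) (prmW th).
Definition polf (th : params N) : Z -> R := softmax (actorP th).
Definition polg (k : nat) (th : params N) : Z -> R := explore (etaN k) (polf th).

(* One update; the arguments z, z1, zt are xi_k, xi_{k+1} and tilde xi_k. *)
Definition step (k : nat) (th : params N) (z z1 zt : Z) : params N :=
  let C := prmC th in let W := prmW th in
  let B := prmB th in let U := prmU th in
  let Dk := reward z + gam M * criticQ th z1 - criticQ th z in
  let ca := alphaN / N%:R `^ beta in
  let cz := zetaN k / N%:R `^ beta in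
  let Qt := criticQ th zt in
  Params
    (fun i => C i + ca * Dk * sigma (dotv (W i) (emb z)))
    (fun i => W i + (ca * Dk * C i * derive1 sigma (dotv (W i) (emb z))) *: emb z)
    (fun i => B i + cz * Qt * (sigma (dotv (U i) (emb zt))
       - \sum_(a : A) polf th (zt.1, a) * sigma (dotv (U i) (emb (zt.1, a)))))
    (fun i => U i + (cz * Qt * B i) *:
       (derive1 sigma (dotv (U i) (emb zt)) *: emb zt
        - \sum_(a : A) (polf th (zt.1, a)
            * derive1 sigma (dotv (U i) (emb (zt.1, a)))) *: emb (zt.1, a))).

End algorithm.

Definition Bker (sigma : R -> R) (z z' : Z) (y : R * vec) : R :=
  sigma (dotv y.2 (emb z)) * sigma (dotv y.2 (emb z'))
  + y.1 ^+ 2 * derive1 sigma (dotv y.2 (emb z)) * derive1 sigma (dotv y.2 (emb z'))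
    * dotv (emb z) (emb z').

Definition Bmean (sigma : R -> R) (nu : probability (R * vec)%type R)
  (z z' : Z) : R := \int[nu]_y Bker sigma z z' y.

Definition limit_system (statd statd_aux : (Z -> R) -> Z -> R)
    (alpha : R) (sigma : R -> R) (v0 mu0 : probability (R * vec)%type R)
    (Q P : R -> Z -> R) :=
  let f s := softmax (P s) in
  let g s := explore (eta s) (f s) in
  [/\ forall z, {within `[0, +oo[, continuous (Q ^~ z)},
      forall z, {within `[0, +oo[, continuous (P ^~ z)},
      forall t z, 0 <= t -> Q t z = alpha *
        \int[lebesgue_measure]_(s in `[0, t])
          (\sum_(z' : Z) \sum_(z'' : Z)
             (reward z' + gam M * Q s z'' - Q s z') * Bmean sigma v0 z z'
             * statd (g s) z' * g s z'' * trans z' z''.1) &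
      forall t z, 0 <= t -> P t z =
        \int[lebesgue_measure]_(s in `[0, t])
          (\sum_(z' : Z) \sum_(a'' : A)
             zeta s * Q s z'
             * (Bmean sigma mu0 z z' - Bmean sigma mu0 z (z'.1, a''))
             * f s (z'.1, a'') * statd_aux (g s) z')].

End actor_critic.

Definition bounded_support (R : realType) (n : nat)
    (nu : probability (R * 'rV[R]_n)%type R) :=
  exists K : R, nu [set y : R * 'rV[R]_n | `|y.1| <= K /\ forall j, `|y.2 0 j| <= K] = 1%E.

Section probability.
Context d (T : measurableType d) (R : realType) (P : probability T R).

(* Mutual independence of a family of sigma-algebras on T *)
Definition mutually_independent (I : finType) (F : I -> set (set T)) :=
  forall (J : {set I}) (E : I -> set T), (forall i, i \in J -> F i (E i)) ->
    P (\bigcap_(i in [set i | i \in J]) E i) = (\prod_(i in J) P (E i))%E.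

(* Y is a version of the conditional probability P(E | F) *)
Definition is_cond_prob (F : set (set T)) (E : set T) (Y : T -> R) :=
  (forall B : set R, measurable B -> F (Y @^-1` B)) /\
  forall D, F D -> P (D `&` E) = (\int[P]_(w in D) (Y w)%:E)%E.

End probability.

Section run.
Context (R : realType) (dx da : nat) (M : mdp R dx da).
Context (beta alpha : R) (sigma : R -> R).
Context (v0 mu0 : probability (R * 'rV[R]_(dx + da))%type R).
Context (N : nat) (d : measure_display) (T : measurableType d).
Context (P : probability T R).
Local Notation Z := (stX M * acA M)%type.
Context (th : nat -> T -> params R dx da N) (xi xit : nat -> T -> Z).

Definition C0 (i : 'I_N) (w : T) : R := prmC (th 0 w) i.
Definition W0 (i : 'I_N) (w : T) : 'rV[R]_(dx + da) := prmW (th 0 w) i.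
Definition B0 (i : 'I_N) (w : T) : R := prmB (th 0 w) i.
Definition U0 (i : 'I_N) (w : T) : 'rV[R]_(dx + da) := prmU (th 0 w) i.

(* The sigma-algebras generated by the C_0^i, W_0^i, B_0^i, U_0^i *)
Definition init_sigma (j : ('I_N + 'I_N) + ('I_N + 'I_N)) : set (set T) :=
  match j with
  | inl (inl i) => preimage_set_system setT (C0 i) measurable
  | inl (inr i) => preimage_set_system setT (W0 i) measurable
  | inr (inl i) => preimage_set_system setT (B0 i) measurable
  | inr (inr i) => preimage_set_system setT (U0 i) measurable
  end.

(* past k is generated by the initial parameters and by the xi_j, tilde xi_j
   with j < k. *)
Definition past (k : nat) : set (set T) :=
  <<s [set E | (exists j, init_sigma j E) \/
        exists2 j, (j < k)%N &
          exists z, E = xi j @^-1` [set z] \/ E = xit j @^-1` [set z]] >>.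

(* Each draw is made from the stated law conditionally on everything drawn
   before. No joint law is imposed on the pair (xi_{k+1}, tilde xi_{k+1}). *)
Record actor_critic_run : Prop := ActorCriticRun {
  init_meas : forall i,
    [/\ measurable_fun setT (C0 i), measurable_fun setT (W0 i),
        measurable_fun setT (B0 i) & measurable_fun setT (U0 i)];
  init_indep : mutually_independent P init_sigma;
  init_lawCW : forall i E, measurable E ->
    P [set w | E (C0 i w, W0 i w)] = v0 E;
  init_lawBU : forall i E, measurable E ->
    P [set w | E (B0 i w, U0 i w)] = mu0 E;
  init_meanC : forall i, ('E_P[C0 i] = 0)%E;
  init_meanB : forall i, ('E_P[B0 i] = 0)%E;
  xi_meas : forall k z, measurable (xi k @^-1` [set z]);
  xit_meas : forall k z, measurable (xit k @^-1` [set z]);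
  xi_init : forall z,
    is_cond_prob P (past 0) (xi 0 @^-1` [set z]) (fun=> rho0 z);
  xit_init : forall z,
    is_cond_prob P (past 0) (xit 0 @^-1` [set z]) (fun=> rho0 z);
  xi_step : forall k z,
    is_cond_prob P (past k.+1) (xi k.+1 @^-1` [set z])
      (fun w => trans (xi k w) z.1 * polg beta sigma k (th k w) z);
  xit_step : forall k z,
    is_cond_prob P (past k.+1) (xit k.+1 @^-1` [set z])
      (fun w => trans_aux (xit k w) z.1 * polg beta sigma k (th k w) z);
  th_step : forall k w,
    th k.+1 w = step beta alpha sigma k (th k w) (xi k w) (xi k.+1 w) (xit k w)
}.

Definition actor_at (t : R) (w : T) : Z -> R :=
  actorP beta sigma (th (Num.truncn (N%:R * t)) w).
Definition critic_at (t : R) (w : T) : Z -> R :=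
  criticQ beta sigma (th (Num.truncn (N%:R * t)) w).

End run.

(* Main.v *)
(* The parameters move by O(N^(beta-1)) during the first N T updates, so a
   network output is, up to that error, its initial value plus N^-1 times a sum
   over the updates of terms phi_j(xi_j), in which the kernel of the network is
   frozen at time 0 and hence within O(N^(-1/2)) of its mean. To compare this sum
   with the integrals in the limit equations, solve the Poisson equation
   h_s - K_s h_s = phi_s - <phi_s, pi_s> for the chain K_s driven by the LIMIT
   policy at time s. Its solution is deterministic and Lipschitz in s (Cramer's
   rule for the invertible matrix I - K_s + 1 pi_s^T, with the Lipschitz
   dependence of pi on the policy), so summation by parts leaves martingales with
   deterministic bounded weights, plus a multiple of N^-1 times the sum of the
   earlier errors, since the sampling policy differs from the limit policy by at
   most the error of the actor. A pathwise discrete Gronwall inequality bounds the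
   error at every step by the outputs and the kernel fluctuation at time 0 and by
   these martingales, all of which have p-th moments of the required order by
   exponential-moment bounds. *)

Require Import Defs.
From mathcomp Require Import all_boot all_order all_algebra finmap.
From mathcomp Require Import all_classical all_reals all_analysis.
From mathcomp Require Import measurable_realfun ring lra.

Set Implicit Arguments.
Unset Strict Implicit.
Unset Printing Implicit Defensive.
Import Order.TTheory GRing.Theory Num.Theory.
Import numFieldNormedType.Exports.

Local Open Scope classical_set_scope.
Local Open Scope ring_scope.

(** * Bounded random variables and exponential moments *)

(** Paths are compared deterministically, with constants independent of N; probability enters only
    afterwards, through [momb]. Two obstacles shape this. First, the initial critic is small only in
    its moments: pathwise it may be as large as a multiple of N^(1-beta), and the error of the
    first-order expansion is quadratic in it. But that error carries a factor N^(beta-1), and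
    N^(beta-1) times the initial critic is bounded, so the estimate stays linear in the initial
    critic and its p-th moment suffices. Second, the errors themselves are not shown to be
    measurable; they are dominated almost surely by a bounded measurable majorant, and monotonicity
    of the integral is used in a form that tolerates this. A single exponential-moment inequality,
    [moment_le], serves the chains and the initial layers alike: in both cases the summands are
    bounded and orthogonal to their past, so N of them add up to order sqrt N for every p at
    once. *)

Section bounded_measurable.
Context d (T : measurableType d) (R : realType) (P : probability T R).
Implicit Types (f g h : T -> R) (D : set T).

(** Boundedness everywhere, not merely almost everywhere, makes sums, products, powers and
    exponentials integrable without side conditions, so expectations can be handled as real
    numbers. *)
Definition bmeas f :=
  measurable_fun [set: T] f /\ exists K : R, forall w, `|f w| <= K.

Lemma bmeas_cst (c : R) : bmeas (fun=> c).
Proof. by split=> //; exists `|c|. Qed.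

Lemma bmeasD f g : bmeas f -> bmeas g -> bmeas (fun w => f w + g w).
Proof.
move=> [mf [K fK]] [mg [L gL]]; split; first exact: measurable_funD.
by exists (K + L) => w; rewrite (le_trans (ler_normD _ _))// lerD.
Qed.

Lemma bmeasM f g : bmeas f -> bmeas g -> bmeas (fun w => f w * g w).
Proof.
move=> [mf [K fK]] [mg [L gL]]; split; first exact: measurable_funM.
by exists (K * L) => w; rewrite normrM ler_pM.
Qed.

Lemma bmeas_ind D : measurable D -> bmeas (fun w => \1_D w : R).
Proof.
move=> mD; split; first exact: measurable_indic.
by exists 1 => w; rewrite indicE; case: (_ \in _); rewrite /= ?normr0 ?normr1.
Qed.

Lemma bmeas_sum (I : Type) (s : seq I) (p : pred I) (F : I -> T -> R) :
  (forall i, p i -> bmeas (F i)) -> bmeas (fun w => \sum_(i <- s | p i) F i w).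
Proof.
move=> bF; elim: s => [|i s IH].
  rewrite (_ : (fun w => \sum_(j <- [::] | p j) F j w) = fun=> 0).
    exact: bmeas_cst.
  by apply/funext => w; rewrite big_nil.
rewrite (_ : (fun w => \sum_(j <- i :: s | p j) F j w) = fun w =>
    (if p i then F i w else 0) + \sum_(j <- s | p j) F j w).
  by apply: bmeasD => //; case: (boolP (p i)) => [/bF|_] //; exact: bmeas_cst.
by apply/funext => w; rewrite big_cons; case: ifP; rewrite ?add0r.
Qed.

Lemma bmeasN f : bmeas f -> bmeas (fun w => - f w).
Proof.
by move=> [mf [K fK]]; split; [exact: measurableT_comp|exists K=> w; rewrite normrN].
Qed.

Lemma bmeasB f g : bmeas f -> bmeas g -> bmeas (fun w => f w - g w).
Proof. by move=> bf bg; apply: bmeasD => //; exact: bmeasN. Qed.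

Lemma bmeas_norm f : bmeas f -> bmeas (fun w => `|f w|).
Proof.
move=> [mf [K fK]]; split; first exact: measurableT_comp.
by exists K=> w; rewrite normr_id.
Qed.

Lemma bmeas_exp f n : bmeas f -> bmeas (fun w => f w ^+ n).
Proof.
move=> bf; elim: n => [|n IH]; first exact: bmeas_cst.
rewrite (_ : (fun w => f w ^+ n.+1) = fun w => f w * f w ^+ n); first exact: bmeasM.
by apply/funext => w; rewrite exprS.
Qed.

Lemma bmeas_expR f : bmeas f -> bmeas (fun w => expR (f w)).
Proof.
move=> [mf [K fK]]; split; first exact: measurableT_comp.
exists (expR K) => w; rewrite ger0_norm ?expR_ge0// ler_expR.
by rewrite (le_trans (ler_norm _)).
Qed.

Lemma bmeas_int D f : measurable D -> bmeas f -> P.-integrable D (EFin \o f).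
Proof.
move=> mD [mf [K fK]]; apply: measurable_bounded_integrable => //.
- by rewrite (le_lt_trans (probability_le1 _ _))// ltry.
- exact: measurable_funTS.
- exists K; split; first exact: num_real.
  by move=> M KM w _; rewrite /= (le_trans (fK w))// ltW.
Qed.

Local Notation Ex f := (\int[P]_w f w).

Lemma ExD f g : bmeas f -> bmeas g -> Ex (fun w => f w + g w) = Ex f + Ex g.
Proof. by move=> bf bg; rewrite RintegralD//; exact: bmeas_int. Qed.

Lemma ExB f g : bmeas f -> bmeas g -> Ex (fun w => f w - g w) = Ex f - Ex g.
Proof. by move=> bf bg; rewrite RintegralB//; exact: bmeas_int. Qed.

Lemma ExZ c f : bmeas f -> Ex (fun w => c * f w) = c * Ex f.
Proof. by move=> bf; rewrite RintegralZl//; exact: bmeas_int. Qed.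

Lemma Ex_cst c : Ex (fun=> c) = c.
Proof. by rewrite Rintegral_cst// [X in fine X]probability_setT mulr1. Qed.

Lemma le_Ex f g : bmeas f -> bmeas g -> (forall w, f w <= g w) -> Ex f <= Ex g.
Proof. by move=> bf bg fg; apply: le_Rintegral => //; exact: bmeas_int. Qed.

Lemma norm_Ex f K : bmeas f -> (forall w, `|f w| <= K) -> `|Ex f| <= K.
Proof.
move=> bf fK; rewrite -[leRHS]Ex_cst.
apply: le_trans (le_normr_Rintegral _ _) _ => //; first exact: bmeas_int.
by apply: le_Ex => //; [exact: bmeas_norm|exact: bmeas_cst].
Qed.

Lemma Ex_sum (I : Type) (s : seq I) (F : I -> T -> R) :
  (forall i, bmeas (F i)) ->
  Ex (fun w => \sum_(i <- s) F i w) = \sum_(i <- s) Ex (F i).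
Proof.
move=> bF; elim: s => [|i s IH].
  rewrite big_nil; under eq_Rintegral do rewrite big_nil.
  by rewrite Ex_cst.
rewrite big_cons -IH -ExD//; last by apply: bmeas_sum.
by apply: eq_Rintegral => w _; rewrite big_cons.
Qed.

Lemma Ex_ind D f : \int[P]_(w in D) f w = Ex (fun w => \1_D w * f w).
Proof.
rewrite Rintegral_mkcond; apply: eq_Rintegral => w _.
by rewrite indicE patchE; case: ifP => _; rewrite ?mul1r ?mul0r.
Qed.

(* Discretize f at scale 1/n: the discretized integral is a finite sum of
   integrals of h over preimages under f. *)
Lemma Ex_mul_eq0 f h : bmeas f -> bmeas h ->
  (forall B, measurable B -> \int[P]_(w in f @^-1` B) h w = 0) ->
  Ex (fun w => f w * h w) = 0.
Proof.
move=> bf bh orth; have [mf [K fK]] := bf; have [_ [M hM]] := bh.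
have h0 : Ex h = 0 by have := orth setT measurableT; rewrite preimage_setT.
have bfK : bmeas (fun w => f w + K) by apply: bmeasD => //; exact: bmeas_cst.
have fK0 w : 0 <= f w + K by have /ler_normlP[? _] := fK w; lra.
(* Since [h] has mean zero, [f] may be shifted by [K]; it is then nonnegative and [truncn] finds its
   level. *)
have -> : Ex (fun w => f w * h w) = Ex (fun w => (f w + K) * h w).
  have -> : Ex (fun w => (f w + K) * h w) = Ex (fun w => f w * h w + K * h w).
    by apply: eq_Rintegral => w _; rewrite mulrDl.
  rewrite ExD ?ExZ// ?h0 ?mulr0 ?addr0//; first exact: bmeasM.
  by apply: bmeasM => //; exact: bmeas_cst.
apply/eqP; rewrite -normr_le0; apply/ler_addgt0Pr => /= e e0; rewrite add0r.
have M0 : 0 <= M by apply: le_trans (hM point).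
have [n n0 Mn] : exists2 n, (0 < n)%N & M / n%:R <= e.
  exists (Num.truncn (M / e)).+1 => //.
  rewrite ler_pdivrMr ?ltr0n// mulrC -ler_pdivrMr// ltW//.
  by have /andP[] := truncn_itv (divr_ge0 M0 (ltW e0)).
have n0' : 0 < n%:R :> R by rewrite ltr0n.
pose B j := [set x : R | j%:R <= n%:R * (x + K) < j.+1%:R].
have mB j : measurable (B j).
  rewrite (_ : B j = (fun x => n%:R * (x + K)) @^-1` `[j%:R, j.+1%:R[); last first.
    by apply/seteqP; split=> x; rewrite /B /= in_itv.
  rewrite -[X in measurable X]setTI.
  have : measurable_fun [set: R] (fun x : R => n%:R * (x + K)).
    apply: measurable_funM; first exact: measurable_cst.
    by apply: measurable_funD; [exact: measurable_id|exact: measurable_cst].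
  by apply => //; exact: measurable_itv.
have mfB j : measurable (f @^-1` B j) by rewrite -[X in measurable X]setTI; exact: mf.
pose J := (Num.truncn (n%:R * (K + K))).+1.
pose g w := \sum_(j < J) (j%:R / n%:R) * (\1_(f @^-1` B j) w * h w).
have bg j : bmeas (fun w => \1_(f @^-1` B j) w * h w).
  by apply: bmeasM => //; exact: bmeas_ind.
have bg' j : bmeas (fun w => (j%:R / n%:R) * (\1_(f @^-1` B j) w * h w)).
  by apply: bmeasM => //; exact: bmeas_cst.
have g0 : Ex g = 0.
  rewrite Ex_sum; last by move=> j; exact: bg'.
  by apply: big1 => j _; rewrite ExZ// -Ex_ind orth ?mulr0.
have bmg : bmeas g by apply: bmeas_sum => j _; exact: bg'.
rewrite -[X in `|X|]subr0 -g0 -ExB//; last exact: bmeasM.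
apply: le_trans Mn; apply: norm_Ex; first by apply: bmeasB => //; exact: bmeasM.
move=> w; set y := n%:R * (f w + K).
have y0 : 0 <= y by rewrite mulr_ge0// ltW.
pose j0 := Num.truncn y.
have /andP[jy yj] : j0%:R <= y < j0.+1%:R by exact: truncn_itv.
have yK : y <= n%:R * (K + K).
  rewrite ler_pM2l// lerD2r; exact: le_trans (ler_norm _) (fK w).
have j0J : (j0 < J)%N.
  rewrite ltnS /j0; apply: le_truncn => //.
have -> : g w = (j0%:R / n%:R) * h w.
  rewrite /g (bigD1 (Ordinal j0J))//= big1 ?addr0.
    by rewrite indicE mem_set ?mul1r// /B /=; apply/andP.
  move=> j jj0; rewrite indicE memNset ?mul0r ?mulr0//.
  rewrite /B /= -/y => /andP[jy' yj'].
  move/eqP: jj0; apply; apply/val_inj => /=; apply/eqP.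
  rewrite eqn_leq -[(_ <= j0)%N]ltnS -[(j0 <= _)%N]ltnS -!(ltr_nat R).
  by rewrite (le_lt_trans jy' yj) (le_lt_trans jy yj').
rewrite -mulrBl normrM mulrC.
have -> : f w + K - j0%:R / n%:R = (y - j0%:R) / n%:R.
  by rewrite /y mulrBl mulrAC divff ?mul1r// gt_eqF.
have ny0 : 0 <= (y - j0%:R) / n%:R by rewrite divr_ge0 ?subr_ge0// ltW.
rewrite (ger0_norm ny0) mulrA; apply: ler_wpM2r; first by rewrite invr_ge0 ltW.
rewrite -[leRHS]mulr1 ler_pM ?subr_ge0//.
by rewrite -natr1 in yj; lra.
Qed.

End bounded_measurable.

(** * Exponential moments of orthogonal increments *)

Section moments.
Context d (T : measurableType d) (R : realType) (P : probability T R).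
Local Notation Ex f := (\int[P]_w f w).

Definition measF (F : set (set T)) (f : T -> R) :=
  forall B, measurable B -> F (f @^-1` B).

(** From e^(-x) >= 1 - x one gets e^x <= 1/(1-x), and (1-x)(1+x+2x^2) = 1 + x^2(1-2x) >= 1 for x <=
    1/2. *)
Lemma expR_quad (x : R) : x <= 2^-1 -> expR x <= 1 + x + 2 * x ^+ 2.
Proof.
move=> x2; have h1 := expR_ge1Dx (- x); rewrite expRN in h1.
have x1 : 0 < 1 - x by lra.
have : expR x <= (1 - x)^-1.
  by rewrite -[expR x]invrK lef_pV2 ?posrE ?invr_gt0 ?expR_gt0.
move/le_trans; apply; rewrite -div1r ler_pdivrMr//; nra.
Qed.

Lemma exprn_le_expR (n : nat) (y : R) : 0 <= y -> y ^+ n <= n%:R ^+ n * expR y.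
Proof.
move=> y0; case: n => [|n]; first by rewrite !expr0 mul1r -expR0 ler_expR.
have n0 : 0 < n.+1%:R :> R by rewrite ltr0n.
have -> : expR y = expR (y / n.+1%:R) ^+ n.+1.
  by rewrite -expRM_natr divfK// gt_eqF.
rewrite -exprMn lerXn2r ?nnegrE ?mulr_ge0 ?expR_ge0//.
have := expR_ge1Dx (y / n.+1%:R) => h.
rewrite -ler_pdivrMl// [_^-1 * _]mulrC.
by apply: le_trans h; rewrite lerDr.
Qed.

(** Azuma-type recursion: when the last factor is expanded by [expR_quad], its linear term
    integrates to zero against the earlier exponential by [Ex_mul_eq0], and the quadratic term costs
    the factor 1 + 2 (l K)^2. *)
Lemma mgf_le (F : nat -> set (set T)) (X : nat -> T -> R) (K : R) (l : R) :
  (forall n, bmeas (X n)) -> (forall n w, `|X n w| <= K) ->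
  (forall n, measF (F n) (fun w => expR (l * \sum_(j < n) X j w))) ->
  (forall n D, F n D -> \int[P]_(w in D) X n w = 0) ->
  `|l| * K <= 2^-1 ->
  forall n, Ex (fun w => expR (l * \sum_(j < n) X j w))
    <= (1 + 2 * (l * K) ^+ 2) ^+ n.
Proof.
move=> bX XK mS orth lK; set S := fun n w => expR (l * \sum_(j < n) X j w).
have bS n : bmeas (S n).
  apply: bmeas_expR; apply: bmeasM; first exact: bmeas_cst.
  by apply: bmeas_sum.
have K0 : 0 <= K by apply: le_trans (XK 0%N point).
elim=> [|n IH].
  rewrite expr0 -[leRHS](Ex_cst P); apply: le_Ex; [exact: (bS 0%N)|exact: bmeas_cst|].
  by move=> w; rewrite big_ord0 mulr0 expR0.
pose c := 1 + 2 * (l * K) ^+ 2.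
have c0 : 0 <= c by rewrite addr_ge0// mulr_ge0// sqr_ge0.
have bSX : bmeas (fun w => l * (S n w * X n w)).
  by apply: bmeasM; [exact: bmeas_cst|exact: bmeasM].
have bcS : bmeas (fun w => c * S n w) by apply: bmeasM => //; exact: bmeas_cst.
apply: (@le_trans _ _ (Ex (fun w => c * S n w + l * (S n w * X n w)))).
  apply: le_Ex; [exact: (bS n.+1)|exact: bmeasD|].
  move=> w; rewrite /S big_ord_recr/= mulrDr expRD -/(S n w).
  have -> : c * S n w + l * (S n w * X n w) = S n w * (c + l * X n w) by ring.
  apply: ler_wpM2l; first exact: expR_ge0.
  have lX : `|l * X n w| <= `|l| * K by rewrite normrM ler_wpM2l.
  apply: le_trans (expR_quad _) _.
    exact: le_trans (ler_norm _) (le_trans lX lK).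
  have : (l * X n w) ^+ 2 <= (l * K) ^+ 2.
    rewrite -(real_normK (num_real (l * X n w))) -(real_normK (num_real (l * K))).
    by rewrite lerXn2r ?nnegrE// [leRHS]normrM (ger0_norm K0).
  by rewrite /c; lra.
rewrite ExD// !ExZ//; last exact: bmeasM.
rewrite Ex_mul_eq0//; last by move=> B mB; apply: orth; exact: mS.
by rewrite mulr0 addr0 exprS ler_wpM2l.
Qed.

(* From y^p <= p^p e^y at y = l |S_n| with l = 1 / (2 K s). *)
Lemma moment_le (F : nat -> set (set T)) (X : nat -> T -> R) (K : R) :
  0 < K ->
  (forall n, bmeas (X n)) -> (forall n w, `|X n w| <= K) ->
  (forall n l, measF (F n) (fun w => expR (l * \sum_(j < n) X j w))) ->
  (forall n D, F n D -> \int[P]_(w in D) X n w = 0) ->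
  forall (p n : nat) (s t : R), 1 <= s -> n%:R <= t * s ^+ 2 ->
  Ex (fun w => `|\sum_(j < n) X j w| ^+ p)
    <= 2 * p%:R ^+ p * (2 * K) ^+ p * expR t * s ^+ p.
Proof.
move=> K0 bX XK mS orth p n s t s1 ns; have s0 : 0 < s by lra.
pose l := (2 * K * s)^-1.
have l0 : 0 < l by rewrite invr_gt0 !mulr_gt0.
have lKs : l * K = (2 * s)^-1 by rewrite /l; field; rewrite !gt_eqF.
have lK : l * K <= 2^-1.
  by rewrite lKs lef_pV2 ?posrE//; lra.
have bS n' : bmeas (fun w => \sum_(j < n') X j w) by apply: bmeas_sum.
have bE (a : R) : bmeas (fun w => expR (a * \sum_(j < n) X j w)).
  by apply: bmeas_expR; apply: bmeasM; [exact: bmeas_cst|].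
have E1 (a : R) : `|a| = l -> Ex (fun w => expR (a * \sum_(j < n) X j w)) <= expR t.
  move=> al; apply: le_trans (@mgf_le F X K a _ _ _ _ _ n) _ => //.
    by rewrite al.
  have -> : (a * K) ^+ 2 = (l * K) ^+ 2.
    by rewrite !exprMn -al real_normK ?num_real.
  have h := expR_ge1Dx (2 * (l * K) ^+ 2).
  (* As l K = 1/(2s), the exponent 2 (l K)^2 n is n/(2 s^2) <= t/2. *)
  apply: (@le_trans _ _ (expR (2 * (l * K) ^+ 2) ^+ n)).
    by rewrite lerXn2r ?nnegrE ?expR_ge0// addr_ge0// mulr_ge0// sqr_ge0.
  rewrite -expRM_natr ler_expR lKs exprVn exprMn.
  have -> : 2 * (2 ^+ 2 * s ^+ 2)^-1 * n%:R = 2^-1 * (n%:R / s ^+ 2).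
    by field; rewrite gt_eqF.
  have : n%:R / s ^+ 2 <= t by rewrite ler_pdivrMr ?exprn_gt0.
  have : 0 <= n%:R / s ^+ 2 by rewrite divr_ge0// sqr_ge0.
  by lra.
pose c := p%:R ^+ p * (2 * K * s) ^+ p.
have c0 : 0 <= c by rewrite mulr_ge0 ?exprn_ge0// ltW// !mulr_gt0.
(* e^(l|S|) <= e^(lS) + e^(-lS), so the exponential bound is needed for both signs of l; hence the
   factor 2. *)
apply: (@le_trans _ _ (Ex (fun w => c * expR (l * \sum_(j < n) X j w) +
   c * expR (- l * \sum_(j < n) X j w)))).
  apply: le_Ex => //.
  - by apply: bmeas_exp; exact: bmeas_norm.
  - by apply: bmeasD; apply: bmeasM => //; exact: bmeas_cst.
  move=> w; set S := \sum_(j < n) X j w.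
  have -> : `|S| = (2 * K * s) * (l * `|S|).
    by rewrite mulrA divff ?mul1r// gt_eqF// !mulr_gt0.
  rewrite exprMn -mulrDr (_ : c = (2 * K * s) ^+ p * p%:R ^+ p); last first.
    exact: mulrC.
  rewrite -(mulrA _ (p%:R ^+ p)).
  apply: ler_wpM2l; first by rewrite exprn_ge0// ltW// !mulr_gt0.
  apply: le_trans (exprn_le_expR _ _) _; first by rewrite mulr_ge0// ltW.
  apply: ler_wpM2l; first by rewrite exprn_ge0.
  case: (ger0P S) => _; first by rewrite lerDl expR_ge0.
  by rewrite mulrN mulNr lerDr expR_ge0.
rewrite ExD//; [|by apply: bmeasM => //; exact: bmeas_cst..].
rewrite !ExZ//.
have e1 := E1 l (gtr0_norm l0).
have e2 : Ex (fun w => expR (- l * \sum_(j < n) X j w)) <= expR t.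
  by apply: E1; rewrite normrN gtr0_norm.
rewrite -mulrDr.
have -> : 2 * p%:R ^+ p * (2 * K) ^+ p * expR t * s ^+ p = c * (expR t + expR t).
  by rewrite /c [(2 * K * s) ^+ p]exprMn; ring.
by apply: ler_wpM2l => //; exact: lerD.
Qed.

End moments.

(** * Independence as orthogonality *)

Section independence.
Context d (T : measurableType d) (R : realType) (P : probability T R).
Local Notation Ex f := (\int[P]_w f w).

Lemma Rint_indic D : measurable D -> Ex (fun w => \1_D w) = fine (P D).
Proof. by move=> mD; rewrite /Rintegral integral_indic// setIT. Qed.

Lemma Rint_eq0 D f : measurable D -> bmeas f ->
  \int[P]_(w in D) f w = 0 -> (\int[P]_(w in D) (f w)%:E = 0)%E.
Proof.
move=> mD bf; rewrite /Rintegral => f0.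
by rewrite -[LHS]fineK ?f0// integrable_fin_num//; exact: bmeas_int.
Qed.

(** Dynkin's theorem: the measurable sets over which [f] integrates to zero form a Dynkin class; the
    vanishing total integral is what gives complements. *)
Lemma orth_g_sigma (G : set (set T)) f : bmeas f ->
  (forall D, G D -> measurable D) -> setI_closed G ->
  \int[P]_w f w = 0 -> (forall D, G D -> \int[P]_(w in D) f w = 0) ->
  forall D, <<s G >> D -> \int[P]_(w in D) f w = 0.
Proof.
move=> bf mG IG fT fG D.
rewrite -setI_closed_g_dynkin_g_sigma_algebra//.
suff : <<d G >> `<=` [set A | measurable A /\ \int[P]_(w in A) f w = 0].
  by move=> /[apply] -[].
apply: smallest_sub; last by move=> A GA; split; [exact: mG|exact: fG].
split => /=.
- by split.
- move=> A [mA fA]; split; first exact: measurableC.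
  rewrite Ex_ind (_ : (fun w => _) = fun w => f w - \1_A w * f w).
    rewrite ExB//; last by apply: bmeasM => //; exact: bmeas_ind.
    by rewrite -Ex_ind fT fA subr0.
  apply/funext => w; rewrite !indicE in_setC.
  by case: (w \in A); rewrite ?mul1r ?mul0r ?subrr ?subr0.
- move=> F tF FF; have mF k : measurable (F k) by have [] := FF k.
  split; first exact: bigcupT_measurable.
  rewrite /Rintegral integral_bigcup//; last first.
    by apply: bmeas_int => //; exact: bigcupT_measurable.
  rewrite eseries0// => k _ _; apply: Rint_eq0 => //.
  by have [] := FF k.
Qed.

Context (I : finType) (F : I -> set (set T)).
Hypotheses (mF : forall i E, F i E -> measurable E) (FT : forall i, F i setT)
  (FI : forall i, setI_closed (F i)) (ind : mutually_independent P F).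

(** A pi-system generating the join of the [F j], j in J; the plain union of the [F j] need not be
    stable under intersection. *)
Let cyl (J : {set I}) : set (set T) :=
  [set D | exists2 E : I -> set T, (forall i, i \in J -> F i (E i)) &
    D = \bigcap_(i in [set i | i \in J]) E i].

Let cyl_meas (J : {set I}) D : cyl J D -> measurable D.
Proof.
move=> [E FE ->]; apply: fin_bigcap_measurable => //.
by move=> i /= iJ; exact: (mF (FE _ iJ)).
Qed.

Let cylI (J : {set I}) : setI_closed (cyl J).
Proof.
move=> _ _ [E FE ->] [E' FE' ->]; exists (fun i => E i `&` E' i).
  by move=> i iJ; apply: FI; [exact: FE|exact: FE'].
by rewrite bigcapI.
Qed.

Let cyl_gen (J : {set I}) D : <<s \bigcup_(j in [set j | j \in J]) F j >> D -> <<s cyl J >> D.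
Proof.
apply: smallest_sub; first exact: smallest_sigma_algebra.
move=> E [j /= jJ FE]; apply: sub_sigma_algebra.
exists (fun i => if i == j then E else setT).
  by move=> i _; case: eqP => [->//|_]; exact: FT.
apply/seteqP; split => w.
  by move=> Ew i /= iJ; case: eqP.
by move=> /(_ j jJ) /=; rewrite eqxx.
Qed.

Let fineP_bigcap (J : {set I}) E : (forall i, i \in J -> F i (E i)) ->
  fine (P (\bigcap_(i in [set i | i \in J]) E i)) = \prod_(i in J) fine (P (E i)).
Proof.
move=> FE; rewrite ind//.
suff -> : (\prod_(i in J) P (E i))%E = (\prod_(i in J) fine (P (E i)))%:E by [].
rewrite -prodEFin; apply: eq_bigr => i iJ.
by rewrite fineK// fin_num_measure//; exact: mF (FE _ iJ).
Qed.

Let fineP_cylI (J : {set I}) D i A : cyl J D -> i \notin J -> F i A ->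
  fine (P (D `&` A)) = fine (P D) * fine (P A) /\ cyl (i |: J) (D `&` A).
Proof.
move=> [E FE ->] iJ FA.
pose E' j := if j == i then A else E j.
have E'E j : j \in J -> E' j = E j.
  by rewrite /E'; case: eqP => // -> ij; rewrite ij in iJ.
have FE' j : j \in i |: J -> F j (E' j).
  rewrite !inE => /orP[/eqP ->|jJ]; first by rewrite /E' eqxx.
  by rewrite E'E//; exact: FE.
have DA : \bigcap_(j in [set j | j \in J]) E j `&` A =
    \bigcap_(j in [set j | j \in i |: J]) E' j.
  apply/seteqP; split => w.
    move=> [DE Aw] j /=; rewrite !inE => /orP[/eqP ->|jJ]; rewrite /E' ?eqxx//.
    by rewrite -/(E' j) E'E//; exact: DE.
  move=> H; split; last by have := H i; rewrite /= !inE /E' eqxx; exact.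
  move=> j /= jJ; have := H j; rewrite /= !inE jJ orbT E'E//; exact.
split; last by exists E'.
rewrite DA !fineP_bigcap// big_setU1//= mulrC /E' eqxx; congr (_ * _).
by apply: eq_bigr => j jJ; rewrite -/(E' j) E'E.
Qed.

(** Follows from [Ex_mul_eq0] applied to [f] and 1_H - P(H), which integrates to zero over every
    event of [F i]. *)
Let Ex_indep H i f : measurable H -> bmeas f ->
  (forall B, measurable B -> F i (f @^-1` B)) ->
  (forall A, F i A -> fine (P (H `&` A)) = fine (P H) * fine (P A)) ->
  Ex (fun w => \1_H w * f w) = fine (P H) * Ex f.
Proof.
move=> mH bf fF HA.
have bH := @bmeas_ind _ T R _ mH.
have bc c : @bmeas _ T R (fun=> c) by exact: bmeas_cst.
have : Ex (fun w => f w * (\1_H w - fine (P H))) = 0.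
  apply: Ex_mul_eq0 => //; first exact: bmeasB.
  move=> B mB; have mA := mF (fF _ mB).
  have bA := @bmeas_ind _ T R _ mA.
  rewrite Ex_ind (_ : (fun w => _) = fun w =>
    \1_(H `&` f @^-1` B) w - fine (P H) * \1_(f @^-1` B) w).
    rewrite ExB//; [|by apply: bmeas_ind; exact: measurableI|exact: bmeasM].
    rewrite ExZ// !Rint_indic//; last exact: measurableI.
    by rewrite HA ?subrr//; exact: fF.
  apply/funext => w; rewrite indicI /=; ring.
rewrite (_ : (fun w => f w * _) = fun w => \1_H w * f w - fine (P H) * f w).
  by rewrite ExB ?ExZ//; [move/eqP; rewrite subr_eq0 => /eqP|exact: bmeasM..].
by apply/funext => w; ring.
Qed.

(** Turns mutual independence into the orthogonality that [moment_gen] asks for. On cylinders it is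
    obtained by splitting off [f2] and then [f1]; Dynkin's theorem extends it to the generated
    sigma-algebra. *)
Lemma indep_orth (J : {set I}) i1 i2 f1 f2 : i1 \notin J -> i2 \notin J ->
  i1 != i2 -> bmeas f1 -> bmeas f2 ->
  (forall B, measurable B -> F i1 (f1 @^-1` B)) ->
  (forall B, measurable B -> F i2 (f2 @^-1` B)) ->
  Ex (fun w => f1 w * f2 w) = Ex f1 * Ex f2 /\
  forall D, <<s \bigcup_(j in [set j | j \in J]) F j >> D ->
  \int[P]_(w in D) (f1 w * f2 w - Ex (fun w => f1 w * f2 w)) = 0.
Proof.
move=> i1J i2J i12 b1 b2 F1 F2.
have bc c : @bmeas _ T R (fun=> c) by exact: bmeas_cst.
have b12 := bmeasM b1 b2.
have main D : cyl J D ->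
    Ex (fun w => \1_D w * (f1 w * f2 w)) = fine (P D) * (Ex f1 * Ex f2).
  move=> cD; have mD := cyl_meas cD; have bD := @bmeas_ind _ T R _ mD.
  have D2 : Ex (fun w => \1_D w * f2 w) = fine (P D) * Ex f2.
    by apply: (Ex_indep (i := i2)) => // A FA; have [] := fineP_cylI cD i2J FA.
  (* For an event A of [f2], the intersection of D and A is a cylinder over i2 |: J, from which [f1]
     is still independent. *)
  have : Ex (fun w => f2 w * (\1_D w * (f1 w - Ex f1))) = 0.
    apply: Ex_mul_eq0 => //; first by apply: bmeasM => //; exact: bmeasB.
    move=> B mB; have FA := F2 _ mB; set A := f2 @^-1` B in FA *.
    have mA := mF FA; have bA := @bmeas_ind _ T R _ mA.
    have [PDA cDA] := fineP_cylI cD i2J FA.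
    have mDA : measurable (D `&` A) by exact: measurableI.
    have bDA := @bmeas_ind _ T R _ mDA.
    rewrite Ex_ind (_ : (fun w => _) = fun w =>
      \1_(D `&` A) w * f1 w - Ex f1 * \1_(D `&` A) w).
      rewrite ExB ?ExZ ?Rint_indic//; [|exact: bmeasM..].
      rewrite (Ex_indep (i := i1))//; first by rewrite mulrC subrr.
      move=> A' FA'; apply: (fineP_cylI cDA _ FA').1.
      by rewrite !inE negb_or i12.
    apply/funext => w; rewrite indicI /=; ring.
  rewrite (_ : (fun w => f2 w * _) = fun w =>
    \1_D w * (f1 w * f2 w) - Ex f1 * (\1_D w * f2 w)).
    rewrite ExB ?ExZ//; [|exact: bmeasM|exact: bmeasM|by apply: bmeasM => //; exact: bmeasM].
    by rewrite D2 => /eqP; rewrite subr_eq0 => /eqP ->; ring.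
  by apply/funext => w; ring.
have cT : cyl J setT.
  by exists (fun=> setT) => [//|]; apply/seteqP; split.
have E12 : Ex (fun w => f1 w * f2 w) = Ex f1 * Ex f2.
  have := main _ cT; rewrite probability_setT /= mul1r => <-.
  by apply: eq_Rintegral => w _; rewrite indicT /= mul1r.
split=> // D /cyl_gen; apply: orth_g_sigma.
- exact: bmeasB.
- exact: cyl_meas.
- exact: cylI.
- by rewrite ExB// Ex_cst subrr.
move=> {}D cD; have mD := cyl_meas cD; have bD := @bmeas_ind _ T R _ mD.
rewrite Ex_ind (_ : (fun w => _) = fun w => \1_D w * (f1 w * f2 w) -
    Ex (fun w => f1 w * f2 w) * \1_D w); last by apply/funext => w; ring.
rewrite ExB ?ExZ ?Rint_indic//; [|exact: bmeasM..].
by rewrite main// E12 mulrC subrr.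
Qed.

End independence.

Section nonmeasurable_integrand.
Import HBNNSimple.
Context d (T : measurableType d) (R : realType) (P : probability T R).
Local Notation Ex f := (\int[P]_w f w).

(* The integral of a nonnegative function is a supremum over simple functions,
   so monotonicity does not require the smaller function to be measurable. *)
Lemma ge0_ae_le_integral_nomeas (f g : T -> \bar R) :
  (forall w, 0 <= f w)%E -> (forall w, 0 <= g w)%E ->
  measurable_fun [set: T] g -> {ae P, forall w, (f w <= g w)%E} ->
  (\int[P]_w f w <= \int[P]_w g w)%E.
Proof.
move=> f0 g0 mg fg; rewrite [leLHS]ge0_integralTE//.
apply: ge_ereal_sup => _ [h /= hf <-].
rewrite -integralT_nnsfun; apply: ae_ge0_le_integral => //.
- by move=> x _; rewrite lee_fin; exact: fun_ge0.
- exact/measurable_EFinP.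
- by apply: filterS fg => w fgw _; exact: le_trans (hf w) fgw.
Qed.

End nonmeasurable_integrand.

(** * Martingale increments of the sampled chains *)

Section generated.
Context d (T : measurableType d) (R : realType) (P : probability T R).
Local Notation Ex f := (\int[P]_w f w).

(** Measurability for the generated sub-sigma-algebra, phrased through [g_sigma_algebraType] so that
    the closure properties of [measurable_fun] apply to it. *)
Definition gmeas (H : set (set T)) (f : T -> R) :=
  measurable_fun [set: g_sigma_algebraType H] (f : g_sigma_algebraType H -> R).

Lemma gmeasP H f :
  gmeas H f <-> (forall B, measurable B -> <<s H >> (f @^-1` B)).
Proof.
split=> mf => [B mB|_ B mB]; last by rewrite setTI; exact: mf.
by rewrite -[X in _ X]setTI; exact: mf.
Qed.

Lemma gmeas_sub H H' f : H `<=` H' -> gmeas H f -> gmeas H' f.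
Proof.
move=> HH' /gmeasP mf; apply/gmeasP => B mB.
by apply: sub_sigma_algebra2 HH' _ _; exact: mf.
Qed.

Lemma moment_gen (H : nat -> set (set T)) (X : nat -> T -> R) (K : R) :
  0 < K ->
  (forall n, bmeas (X n)) -> (forall n w, `|X n w| <= K) ->
  (forall n j, (j < n)%N -> gmeas (H n) (X j)) ->
  (forall n D, <<s H n >> D -> \int[P]_(w in D) X n w = 0) ->
  forall (p n : nat) (s t : R), 1 <= s -> n%:R <= t * s ^+ 2 ->
  Ex (fun w => `|\sum_(j < n) X j w| ^+ p)
    <= 2 * p%:R ^+ p * (2 * K) ^+ p * expR t * s ^+ p.
Proof.
move=> K0 bX XK mX orth; apply: (moment_le (F := fun n => <<s H n >>)) => // n l.
apply/gmeasP; apply: measurableT_comp; first exact: measurable_expR.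
apply: measurable_funM; first exact: measurable_cst.
by apply: measurable_sum => j; exact: mX.
Qed.

Lemma cond_prob_orth (H : set (set T)) E Y : (forall D, H D -> measurable D) ->
  measurable E -> bmeas Y -> is_cond_prob P <<s H >> E Y ->
  forall D, <<s H >> D -> \int[P]_(w in D) (\1_E w - Y w) = 0.
Proof.
move=> mH mE bY [_ HY] D HD.
have mD : measurable D.
  by move: HD; apply: smallest_sub => //; exact: sigma_algebra_measurable.
have iY := bmeas_int P mD bY.
have iE := bmeas_int P mD (bmeas_ind R mE).
by rewrite RintegralB// /Rintegral -HY// integral_indic// setIC subrr.
Qed.

Context (Z : finType) (xi : nat -> T -> Z) (Y : nat -> Z -> T -> R)
  (H : nat -> set (set T)).
Hypotheses (mH : forall n D, H n D -> measurable D)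
  (Hmono : forall n m, (n <= m)%N -> H n `<=` H m)
  (xiH : forall n z, H n (xi n @^-1` [set z]))
  (Ybd : forall n z w, 0 <= Y n z w <= 1)
  (Ycond : forall n z, is_cond_prob P <<s H n >> (xi n.+1 @^-1` [set z]) (Y n z)).

Let mxi n z : measurable (xi n @^-1` [set z]).
Proof. exact: mH (xiH n z). Qed.

Let gmeas_ind n m z : (n <= m)%N ->
  gmeas (H m) (fun w => \1_(xi n @^-1` [set z]) w).
Proof.
move=> nm; apply: measurable_indic; apply: sub_sigma_algebra.
exact: Hmono nm _ (xiH n z).
Qed.

Let gmeasY n m z : (n <= m)%N -> gmeas (H m) (Y n z).
Proof.
by move=> nm; apply: gmeas_sub (Hmono nm) _; apply/gmeasP; case: (Ycond n z).
Qed.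

Lemma gmeas_meas H' f : (forall D, H' D -> measurable D) -> gmeas H' f ->
  measurable_fun [set: T] f.
Proof.
move=> mH' /gmeasP mf _ B mB; rewrite setTI.
have := mf B mB; apply: smallest_sub => //; exact: sigma_algebra_measurable.
Qed.

(** When [Y j] is the conditional law of the next state, this is a martingale increment. The weight
    depends on both the current and the next state because a temporal difference does. *)
Definition chain_incr (v : nat -> Z -> Z -> R) j w : R :=
  v j (xi j w) (xi j.+1 w) - \sum_z Y j z w * v j (xi j w) z.

(** Reduces the increment to indicators of singleton events with deterministic coefficients;
    measurability and the conditional laws of the states are given only on such events. *)
Lemma chain_incrE v j : chain_incr v j = fun w => \sum_z \sum_z' v j z z' *
  (\1_(xi j @^-1` [set z]) w * (\1_(xi j.+1 @^-1` [set z']) w - Y j z' w)).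
Proof.
apply/funext => w; rewrite (bigD1 (xi j w))//= [X in _ = _ + X]big1 ?addr0.
  under eq_bigr do rewrite indicE mem_set//= mul1r mulrBr.
  rewrite sumrB; congr (_ - _); last by apply: eq_bigr => z _; rewrite mulrC.
  rewrite (bigD1 (xi j.+1 w))//= indicE mem_set//= mulr1 big1 ?addr0//.
  by move=> z /eqP zj; rewrite indicE memNset ?mulr0//= => /esym.
move=> z /eqP zj; apply: big1 => z' _.
by rewrite indicE memNset ?mul0r ?mulr0//= => /esym.
Qed.

Let bY j z : bmeas (Y j z).
Proof.
split; first by apply: (gmeas_meas (mH (n := j))); exact: gmeasY.
by exists 1 => w; have /andP[? ?] := Ybd j z w; rewrite ger0_norm.
Qed.

Let bI j z : bmeas (fun w => \1_(xi j @^-1` [set z]) w : R).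
Proof. exact: bmeas_ind. Qed.

Lemma chain_incr_bmeas v j : bmeas (chain_incr v j).
Proof.
rewrite chain_incrE; apply: bmeas_sum => z _; apply: bmeas_sum => z' _.
apply: bmeasM; first exact: bmeas_cst.
by apply: bmeasM => //; exact: bmeasB.
Qed.

Lemma chain_moment (v : nat -> Z -> Z -> R) (K : R) : 0 < K ->
  (forall n z z', `|v n z z'| <= K) ->
  forall (p n : nat) (s t : R), 1 <= s -> n%:R <= t * s ^+ 2 ->
  Ex (fun w => `|\sum_(j < n) chain_incr v j w| ^+ p)
    <= 2 * p%:R ^+ p * (2 * (K + #|Z|%:R * K)) ^+ p * expR t * s ^+ p.
Proof.
move=> K0 vK; set X := chain_incr v.
have XE j : X j = _ := chain_incrE v j.
have bc (c : R) : @bmeas _ T R (fun=> c) by exact: bmeas_cst.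
have bX j : bmeas (X j) by exact: chain_incr_bmeas.
apply: (moment_gen (H := H) (X := X)).
- by rewrite ltr_pwDl// mulr_ge0// ltW.
- exact: bX.
(* Each [Y n z] is at most 1, whence the term |Z| K. *)
- move=> n w; rewrite /X /chain_incr (le_trans (ler_normB _ _))// lerD//.
  rewrite (le_trans (ler_norm_sum _ _ _))// mulr_natl -sumr_const.
  apply: ler_sum => z _; have /andP[? ?] := Ybd n z w.
  by rewrite normrM ger0_norm// -[leRHS]mul1r ler_pM.
- move=> n j jn; rewrite XE.
  apply: measurable_sum => z; apply: measurable_sum => z'.
  apply: measurable_funM; first exact: measurable_cst.
  apply: measurable_funM; first by apply: gmeas_ind; exact: ltnW.
  by apply: measurable_funB; [exact: gmeas_ind|apply: gmeasY; exact: ltnW].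
move=> n D HD.
have mD : measurable D.
  move: HD; apply: smallest_sub; last exact: mH.
  exact: sigma_algebra_measurable.
have bD := @bmeas_ind _ T R _ mD.
have bW z z' : bmeas (fun w => \1_(xi n @^-1` [set z]) w *
    (\1_(xi n.+1 @^-1` [set z']) w - Y n z' w)).
  by apply: bmeasM => //; exact: bmeasB.
rewrite Ex_ind XE (_ : (fun w => _) = fun w => \sum_z \sum_z' v n z z' *
  (\1_D w * (\1_(xi n @^-1` [set z]) w *
    (\1_(xi n.+1 @^-1` [set z']) w - Y n z' w)))); last first.
  apply/funext => w; rewrite mulr_sumr; apply: eq_bigr => z _.
  by rewrite mulr_sumr; apply: eq_bigr => z' _; rewrite mulrCA.
rewrite Ex_sum => [|z]; last first.
  by apply: bmeas_sum => z' _; apply: bmeasM => //; exact: bmeasM.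
apply: big1 => z _; rewrite Ex_sum => [|z']; last first.
  by apply: bmeasM => //; exact: bmeasM.
apply: big1 => z' _; rewrite ExZ; last exact: bmeasM.
(* [H n] already knows the current state, so localizing to xi n = z stays inside the past and
   freezes the weight. *)
have HDz : <<s H n >> (D `&` xi n @^-1` [set z]).
  have : @measurable _ (g_sigma_algebraType (H n)) (D `&` xi n @^-1` [set z]).
    by apply: measurableI => //; apply: sub_sigma_algebra; exact: xiH.
  by [].
have := cond_prob_orth (mH (n := n)) (mxi n.+1 z') (bY n z') (Ycond n z') HDz.
rewrite Ex_ind => E0; rewrite -[RHS](mulr0 (v n z z')) -[in RHS]E0; congr (_ * _).
by apply: eq_Rintegral => w _; rewrite indicI /= mulrA.
Qed.
End generated.

(** * Pathwise expansion of the networks *)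

Section network.
Context (R : realType) (Z : finType) (N : nat) (s s' : R -> R) (G : Z -> Z -> R).
Context (D eps : R).
Hypotheses (N0 : (0 < N)%N) (eps01 : 0 < eps <= 1) (GD : forall z z', `|G z z'| <= D).
Hypotheses (s1 : forall x, `|s x| <= 1) (s'1 : forall x, `|s' x| <= 1).
Hypotheses (sL : forall x y, `|s x - s y| <= `|x - y|)
  (s'L : forall x y, `|s' x - s' y| <= `|x - y|)
  (sT : forall x y, `|s x - s y - s' y * (x - y)| <= (x - y) ^+ 2).
Local Notation n := (N%:R : R).
Implicit Types (c : 'I_N -> R) (y : 'I_N -> Z -> R) (m : Z -> R) (K mu T : R).

(** With eps = N^(beta-1) the prefactor is N^(-beta). Keeping eps abstract exposes the cancellation
    of this eps^-1 against the eps in the updates. *)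
Definition out c y z : R := (n * eps)^-1 * \sum_i c i * s (y i z).

(** Contribution of one hidden unit to the neural tangent kernel; [mker] is the empirical kernel of
    the layer. *)
Definition ker (c0 : R) (y0 : Z -> R) z z' : R :=
  s (y0 z) * s (y0 z') + c0 ^+ 2 * s' (y0 z) * s' (y0 z') * G z z'.

Definition mker c y z z' : R := n^-1 * \sum_i ker (c i) (y i) z z'.

(* An update sees the inner weights only through y i z, the inner product of the
   i-th one with the embedded state z; the mass m carries the error signal. *)
Definition upd_out c y m i : R := c i + eps / n * \sum_z m z * s (y i z).

Definition upd_in c y m i z : R :=
  y i z + eps / n * c i * \sum_z' m z' * (s' (y i z') * G z z').

Let n0 : 0 < n. Proof. by rewrite ltr0n. Qed.
Let n1 : 1 <= n. Proof. by rewrite ler1n. Qed.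
Let ni0 : 0 <= n^-1. Proof. by rewrite invr_ge0 ltW. Qed.
Let e0 : 0 < eps. Proof. by case/andP: eps01. Qed.
Let e1 : eps <= 1. Proof. by case/andP: eps01. Qed.

Lemma ler_norm_wsum (I : finType) (a b : I -> R) (B : R) :
  (forall i, `|b i| <= B) -> `|\sum_i a i * b i| <= (\sum_i `|a i|) * B.
Proof.
move=> bB; apply: le_trans (ler_norm_sum _ _ _) _.
by rewrite mulr_suml; apply: ler_sum => i _; rewrite normrM ler_wpM2l.
Qed.

Lemma D_ge0 (z : Z) : 0 <= D.
Proof. exact: le_trans (GD z z). Qed.

Lemma upd_out_le c y m i mu : \sum_z `|m z| <= mu ->
  `|upd_out c y m i - c i| <= eps / n * mu.
Proof.
move=> mmu; rewrite /upd_out addrAC subrr add0r normrM ger0_norm; last first.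
  by rewrite divr_ge0// ltW.
apply: ler_wpM2l; first by rewrite divr_ge0// ltW.
by apply: le_trans (ler_norm_wsum _ _) _ => //; rewrite mulr1.
Qed.

Lemma upd_in_le c y m i z K mu : \sum_z `|m z| <= mu -> `|c i| <= K ->
  `|upd_in c y m i z - y i z| <= eps / n * (K * D * mu).
Proof.
move=> mmu cK; rewrite /upd_in addrAC subrr add0r -mulrA normrM ger0_norm; last first.
  by rewrite divr_ge0// ltW.
apply: ler_wpM2l; first by rewrite divr_ge0// ltW.
rewrite normrM -mulrA; apply: ler_pM => //.
apply: le_trans (ler_norm_wsum _ (B := D) _) _ => [z'|].
  by rewrite normrM -[leRHS]mul1r ler_pM.
by rewrite mulrC; apply: ler_wpM2l => //; exact: D_ge0 z.
Qed.

Lemma sum_ord_le (f : 'I_N -> R) (B : R) :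
  (forall i, `|f i| <= B) -> `|\sum_i f i| <= n * B.
Proof.
move=> fB; apply: le_trans (ler_norm_sum _ _ _) _.
apply: (@le_trans _ _ (\sum_(i < N) B)); first exact: ler_sum.
by rewrite sumr_const card_ord mulr_natl.
Qed.

Let out_scale (f : 'I_N -> R) (B : R) : (forall i, `|f i| <= B) ->
  `|(n * eps)^-1 * \sum_i f i| <= eps^-1 * B.
Proof.
move=> fB; rewrite normrM ger0_norm; last by rewrite invr_ge0 mulr_ge0// ltW.
have -> : eps^-1 * B = (n * eps)^-1 * (n * B) by field; rewrite !gt_eqF.
by apply: ler_wpM2l; [rewrite invr_ge0 mulr_ge0// ltW|exact: sum_ord_le].
Qed.

Lemma out_le c y z K : (forall i, `|c i| <= K) -> `|out c y z| <= eps^-1 * K.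
Proof.
move=> cK; apply: out_scale => i.
by rewrite normrM -[leRHS]mulr1 ler_pM.
Qed.

(** The eps of the weight update cancels the eps^-1 of the output, so one update moves the output by
    O(1/n). This coarse estimate drives the growth bound [critic_le]. *)
Lemma out_upd_le c y m z K mu : (forall i, `|c i| <= K) -> \sum_z `|m z| <= mu ->
  `|out (upd_out c y m) (upd_in c y m) z - out c y z| <=
    n^-1 * ((1 + K ^+ 2 * D) * mu).
Proof.
move=> cK mmu; rewrite -mulrBr -sumrB.
have -> : n^-1 * ((1 + K ^+ 2 * D) * mu) =
   eps^-1 * (eps / n * mu + K * (eps / n * (K * D * mu))).
  by field; rewrite !gt_eqF.
apply: out_scale => i.
have -> : upd_out c y m i * s (upd_in c y m i z) - c i * s (y i z) =
  (upd_out c y m i - c i) * s (upd_in c y m i z) +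
  c i * (s (upd_in c y m i z) - s (y i z)) by ring.
apply: le_trans (ler_normD _ _) _; apply: lerD; rewrite normrM.
  by rewrite -[leRHS]mulr1 ler_pM//; exact: upd_out_le.
apply: ler_pM => //; apply: le_trans (sL _ _) _; exact: upd_in_le.
Qed.

(** The part linear in the weight increments is exactly n^-1 times the empirical kernel applied to
    [m]. What remains per unit is a product of two increments plus a second-order Taylor term, both
    of size (eps/n)^2 before the prefactor eps^-1. *)
Lemma out_upd_taylor c y m z K mu :
  (forall i, `|c i| <= K) -> \sum_z `|m z| <= mu ->
  `|out (upd_out c y m) (upd_in c y m) z - out c y z
     - n^-1 * \sum_z' m z' * mker c y z z'| <=
    eps / n ^+ 2 * ((K * D + K ^+ 3 * D ^+ 2) * mu ^+ 2).
Proof.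
move=> cK mmu.
have -> : n^-1 * \sum_z' m z' * mker c y z z' = (n * eps)^-1 * \sum_i
  ((upd_out c y m i - c i) * s (y i z) + c i * (s' (y i z) * (upd_in c y m i z - y i z))).
  rewrite /mker /ker /upd_out /upd_in.
  have -> : \sum_i ((c i + eps / n * \sum_z0 m z0 * s (y i z0) - c i) * s (y i z) +
     c i * (s' (y i z) * (y i z + eps / n * c i * \sum_z' m z' * (s' (y i z') * G z z') -
     y i z))) = \sum_i \sum_z' eps / n * (m z' * (s (y i z) * s (y i z') +
      c i ^+ 2 * s' (y i z) * s' (y i z') * G z z')).
    apply: eq_bigr => i _.
    rewrite !(addrAC _ _ (- _)) !subrr !add0r.
    rewrite mulrA mulrA mulr_sumr mulr_suml mulr_sumr -big_split/=.
    by apply: eq_bigr => z' _; ring.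
  rewrite exchange_big/= !mulr_sumr; apply: eq_bigr => z' _.
  rewrite !mulr_sumr; apply: eq_bigr => i _.
  by field; rewrite !gt_eqF.
rewrite -2!mulrBr -2!sumrB.
have -> : eps / n ^+ 2 * ((K * D + K ^+ 3 * D ^+ 2) * mu ^+ 2) =
   eps^-1 * ((eps / n * mu) * (eps / n * (K * D * mu)) +
     K * (eps / n * (K * D * mu)) ^+ 2).
  by field; rewrite !gt_eqF.
apply: out_scale => i.
set c' := upd_out c y m i; set y' := upd_in c y m i z.
have hc : `|c' - c i| <= eps / n * mu by exact: upd_out_le.
have hy : `|y' - y i z| <= eps / n * (K * D * mu) by exact: upd_in_le.
have -> : c' * s y' - c i * s (y i z) -
   ((c' - c i) * s (y i z) + c i * (s' (y i z) * (y' - y i z))) =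
   (c' - c i) * (s y' - s (y i z)) +
   c i * (s y' - s (y i z) - s' (y i z) * (y' - y i z)) by ring.
apply: le_trans (ler_normD _ _) _; apply: lerD; rewrite normrM.
  by apply: ler_pM => //; exact: le_trans (sL _ _) hy.
apply: ler_pM => //; apply: le_trans (sT _ _) _.
rewrite -(real_normK (num_real (y' - _))) lerXn2r ?nnegrE//.
exact: le_trans hy.
Qed.

Lemma ker_lip (c0 c1 : R) (y0 y1 : Z -> R) z z' K a b : `|c0| <= K -> `|c1| <= K ->
  `|c1 - c0| <= a -> (forall x, `|y1 x - y0 x| <= b) ->
  `|ker c1 y1 z z' - ker c0 y0 z z'| <= 2 * b + (2 * K * a + 2 * K ^+ 2 * b) * D.
Proof.
move=> c0K c1K ca yb.
have K0 : 0 <= K by exact: le_trans c0K.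
have b0 : 0 <= b by exact: le_trans (yb z).
have a0 : 0 <= a by exact: le_trans ca.
have prodL (u1 u0 v1 v0 U V du dv : R) : `|u0| <= U -> `|v1| <= V ->
    `|u1 - u0| <= du -> `|v1 - v0| <= dv -> `|u1 * v1 - u0 * v0| <= du * V + U * dv.
  move=> hu hv hdu hdv.
  have -> : u1 * v1 - u0 * v0 = (u1 - u0) * v1 + u0 * (v1 - v0) by ring.
  by apply: le_trans (ler_normD _ _) _; rewrite !normrM lerD// ler_pM.
have sb x : `|s (y1 x) - s (y0 x)| <= b by apply: le_trans (sL _ _) _.
have s'b x : `|s' (y1 x) - s' (y0 x)| <= b by apply: le_trans (s'L _ _) _.
rewrite /ker opprD addrACA; apply: le_trans (ler_normD _ _) _; apply: lerD.
  have := prodL _ _ _ _ 1 1 b b (s1 (y0 z)) (s1 (y1 z')) (sb z) (sb z').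
  by rewrite mulr1 mul1r => /le_trans; apply; lra.
rewrite -mulrBl normrM; apply: ler_pM => //.
have h1 : `|c1 ^+ 2 - c0 ^+ 2| <= a * K + K * a by rewrite !expr2; exact: prodL.
have h2 : `|c1 ^+ 2 * s' (y1 z) - c0 ^+ 2 * s' (y0 z)| <= (a * K + K * a) * 1 + K ^+ 2 * b.
  by apply: prodL => //; rewrite normrX lerXn2r ?nnegrE.
apply: le_trans (prodL _ _ _ _ (K ^+ 2) 1 _ b _ _ h2 _) _ => //.
  by rewrite normrM -[leRHS]mulr1 ler_pM// normrX lerXn2r ?nnegrE.
lra.
Qed.

Lemma mker_lip c0 c1 y0 y1 z z' K a b : (forall i, `|c0 i| <= K) ->
  (forall i, `|c1 i| <= K) ->
  (forall i, `|c1 i - c0 i| <= a) -> (forall i x, `|y1 i x - y0 i x| <= b) ->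
  `|mker c1 y1 z z' - mker c0 y0 z z'| <= 2 * b + (2 * K * a + 2 * K ^+ 2 * b) * D.
Proof.
move=> c0K c1K ca yb; rewrite -mulrBr -sumrB.
rewrite normrM (ger0_norm ni0) ler_pdivrMl//.
by apply: sum_ord_le => i; exact: ker_lip.
Qed.

Section net_trajectory.
Context (c : nat -> 'I_N -> R) (y : nat -> 'I_N -> Z -> R) (m : nat -> Z -> R).
Context (L : nat) (K mu T kap : R) (Bb : Z -> Z -> R).
Hypotheses (K0 : 0 <= K) (mu0 : 0 <= mu) (T0 : 0 <= T).
Hypotheses (cS : forall k i, c k.+1 i = upd_out (c k) (y k) (m k) i)
  (yS : forall k i z, y k.+1 i z = upd_in (c k) (y k) (m k) i z)
  (LT : L%:R <= n * T)
  (cK : forall k i, (k <= L)%N -> `|c k i| <= K)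
  (mmu : forall k, (k < L)%N -> \sum_z `|m k z| <= mu)
  (kapP : forall z z', `|mker (c 0%N) (y 0%N) z z' - Bb z z'| <= kap).

Let kT k : (k <= L)%N -> k%:R * n^-1 <= T.
Proof.
by move=> kL; rewrite ler_pdivrMr// mulrC (le_trans _ LT)// ler_nat.
Qed.

Let telescope_le (u : nat -> R) (B : R) k : (k <= L)%N -> 0 <= B ->
  (forall j, (j < k)%N -> `|u j.+1 - u j| <= n^-1 * B) ->
  `|u k - u 0%N| <= T * B.
Proof.
move=> kL B0 uB; apply: (@le_trans _ _ (k%:R * n^-1 * B)); last first.
  by apply: ler_wpM2r => //; exact: kT.
elim: k kL uB => [|k IH] kL uB; first by rewrite subrr normr0 !mul0r.
have -> : u k.+1 - u 0%N = (u k.+1 - u k) + (u k - u 0%N) by ring.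
apply: le_trans (ler_normD _ _) _; rewrite -natr1 mulrDl mul1r mulrDl addrC lerD//.
  by apply: IH => [|j jk]; [exact: ltnW|apply: uB; exact: leqW].
exact: uB.
Qed.

Let drift_out k i : (k <= L)%N -> `|c k i - c 0%N i| <= T * (eps * mu).
Proof.
move=> kL; apply: (telescope_le (u := fun j => c j i)) => //.
  by rewrite mulr_ge0// ltW.
move=> j jk; rewrite cS (_ : n^-1 * _ = eps / n * mu); last by ring.
by apply: upd_out_le; apply: mmu; exact: leq_trans jk kL.
Qed.

Let drift_in k i z : (k <= L)%N ->
  `|y k i z - y 0%N i z| <= T * (eps * (K * D * mu)).
Proof.
move=> kL; apply: (telescope_le (u := fun j => y j i z)) => //.
  by rewrite !mulr_ge0 ?(D_ge0 z)// ltW.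
move=> j jk; rewrite yS (_ : n^-1 * _ = eps / n * (K * D * mu)); last by ring.
apply: upd_in_le; first by apply: mmu; exact: leq_trans jk kL.
by apply: cK; exact: leq_trans (ltnW jk) kL.
Qed.

(** Summing the one-step expansions, the empirical kernel is first replaced by its value at time 0,
    at a cost of order eps since the weights drift by O(eps) up to time T, and then by [Bb], at the
    cost [kap]. *)
Lemma net_trajectory z k : (k <= L)%N ->
  `|out (c k) (y k) z - out (c 0%N) (y 0%N) z
     - n^-1 * \sum_(j < k) \sum_z' m j z' * Bb z z'| <=
  T * ((K * D + K ^+ 3 * D ^+ 2 + 2 * T * K * D + 2 * K * T * D +
        2 * K ^+ 3 * D ^+ 2 * T) * (eps * mu ^+ 2) + mu * kap).
Proof.
move=> kL; have D0 := D_ge0 z.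
have kap0 : 0 <= kap by exact: le_trans (kapP z z).
(* Output minus the accumulated frozen sum: its increments are pure error, which [telescope_le] adds
   up. *)
pose u k := out (c k) (y k) z - n^-1 * \sum_(j < k) \sum_z' m j z' * Bb z z'.
have -> : out (c k) (y k) z - out (c 0%N) (y 0%N) z
     - n^-1 * \sum_(j < k) \sum_z' m j z' * Bb z z' = u k - u 0%N.
  by rewrite /u big_ord0; ring.
apply: telescope_le => // [|j jk].
  by rewrite addr_ge0// mulr_ge0// ?mulr_ge0 ?addr_ge0 ?mulr_ge0 ?exprn_ge0// ltW.
have jL := leq_trans jk kL.
set c1 := upd_out (c j) (y j) (m j); set y1 := upd_in (c j) (y j) (m j).
have outE : out (c j.+1) (y j.+1) z = out c1 y1 z.
  by rewrite /out; congr (_ * _); apply: eq_bigr => i _; rewrite cS yS.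
have -> : u j.+1 - u j = (out c1 y1 z - out (c j) (y j) z
    - n^-1 * \sum_z' m j z' * mker (c j) (y j) z z')
  + n^-1 * \sum_z' m j z' * (mker (c j) (y j) z z' - Bb z z').
  rewrite /u big_ord_recr/= outE.
  under [X in _ = _ + n^-1 * X]eq_bigr do rewrite mulrBr.
  rewrite sumrB; ring.
apply: le_trans (ler_normD _ _) _.
have cjK i : `|c j i| <= K by apply: cK; exact: ltnW.
have h1' := out_upd_taylor (y j) z cjK (mmu jL).
pose b := T * (eps * (K * D * mu)); pose a := T * (eps * mu).
have h2 z' : `|mker (c j) (y j) z z' - Bb z z'| <=
    2 * b + (2 * K * a + 2 * K ^+ 2 * b) * D + kap.
  have -> : mker (c j) (y j) z z' - Bb z z' =
    (mker (c j) (y j) z z' - mker (c 0%N) (y 0%N) z z') +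
    (mker (c 0%N) (y 0%N) z z' - Bb z z') by ring.
  apply: le_trans (ler_normD _ _) _; apply: lerD => //; apply: mker_lip => [i|i|i|i x].
  - exact: cK.
  - by apply: cK; exact: ltnW.
  - by apply: drift_out; exact: ltnW.
  - by apply: drift_in; exact: ltnW.
have h3 : `|\sum_z' m j z' * (mker (c j) (y j) z z' - Bb z z')| <=
    (\sum_z' `|m j z'|) * (2 * b + (2 * K * a + 2 * K ^+ 2 * b) * D + kap).
  exact: ler_norm_wsum.
have B0 : 0 <= 2 * b + (2 * K * a + 2 * K ^+ 2 * b) * D + kap.
  exact: le_trans (h2 z).
have h4 := le_trans h3 (ler_wpM2r B0 (mmu jL)).
(* One of the two factors n^-1 of the Taylor remainder is given away; the error eps is of the right
   order without it. *)
have h1 : eps / n ^+ 2 * ((K * D + K ^+ 3 * D ^+ 2) * mu ^+ 2) <=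
   n^-1 * ((K * D + K ^+ 3 * D ^+ 2) * (eps * mu ^+ 2)).
  have -> : eps / n ^+ 2 * ((K * D + K ^+ 3 * D ^+ 2) * mu ^+ 2) =
    n^-1 * (n^-1 * ((K * D + K ^+ 3 * D ^+ 2) * (eps * mu ^+ 2))).
    by field; rewrite gt_eqF.
  apply: ler_wpM2l; first by rewrite invr_ge0 ltW.
  rewrite ler_pdivrMl// ler_peMl// mulr_ge0 ?addr_ge0 ?mulr_ge0 ?exprn_ge0//.
  exact: ltW.
rewrite [X in _ <= X](_ : _ = n^-1 * ((K * D + K ^+ 3 * D ^+ 2) * (eps * mu ^+ 2)) +
   n^-1 * (mu * (2 * b + (2 * K * a + 2 * K ^+ 2 * b) * D + kap))); last first.
  by rewrite /a /b; ring.
apply: lerD; first exact: le_trans h1' h1.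
by rewrite normrM (ger0_norm ni0); exact: ler_wpM2l.
Qed.
End net_trajectory.
End network.

(** * The activation and the softmax policy *)

Section activation_facts.
Context (R : realType).

Lemma lip1_of_derive (f : R -> R) : (forall x, derivable f x 1) ->
  (forall x, `|derive1 f x| <= 1) -> forall x y, `|f x - f y| <= `|x - y|.
Proof.
move=> df f1.
have H x y : x < y -> `|f y - f x| <= `|y - x|.
  move=> xy; have cf : {within `[x, y], continuous f}.
    apply: continuous_subspaceT => z.
    by apply: differentiable_continuous; apply/derivable1_diffP.
  have [z _ ->] := MVT xy (fun z _ => derivableP (df z)) cf.
  by rewrite normrM -[leRHS]mul1r ler_wpM2r// -derive1E.
move=> x y; case: (ltgtP x y) => [xy|yx|->]; last by rewrite !subrr.
- by rewrite distrC (distrC x); exact: H.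
- exact: H.
Qed.

(** By the mean value theorem the difference quotient is f' at an intermediate point, and the
    Lipschitz bound compares it with f' at y; hence the constant 1 instead of 1/2. *)
Lemma taylor1_of_lip (f : R -> R) : (forall x, derivable f x 1) ->
  (forall x y, `|derive1 f x - derive1 f y| <= `|x - y|) ->
  forall x y, `|f x - f y - derive1 f y * (x - y)| <= (x - y) ^+ 2.
Proof.
move=> df lf.
have cf x y : {within `[x, y], continuous f}.
  apply: continuous_subspaceT => z.
  by apply: differentiable_continuous; apply/derivable1_diffP.
have key x y z : `|z - y| <= `|x - y| -> f x - f y = derive1 f z * (x - y) ->
    `|f x - f y - derive1 f y * (x - y)| <= (x - y) ^+ 2.
  move=> zxy ->; rewrite -mulrBl normrM -(real_normK (num_real (x - y))) expr2.
  by apply: ler_wpM2r => //; exact: le_trans (lf _ _) zxy.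
move=> x y; case: (ltgtP x y) => [xy|yx|->]; last by rewrite !subrr mulr0 subrr expr2 mul0r normr0.
- have [z + fz] := MVT xy (fun z _ => derivableP (df z)) (cf _ _).
  rewrite in_itv/= => /andP[xz zy]; apply: (key x y z).
    by rewrite distrC (distrC x) !ger0_norm ?subr_ge0 ?ltW//; lra.
  by rewrite derive1E -opprB fz -mulrN opprB.
- have [z + fz] := MVT yx (fun z _ => derivableP (df z)) (cf _ _).
  rewrite in_itv/= => /andP[xz zy]; apply: (key x y z).
    by rewrite !ger0_norm ?subr_ge0 ?ltW//; lra.
  by rewrite derive1E fz.
Qed.

Lemma activation_lip (sigma : R -> R) : activation sigma ->
  [/\ forall x, `|sigma x| <= 1, forall x, `|derive1 sigma x| <= 1,
      forall x y, `|sigma x - sigma y| <= `|x - y|,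
      forall x y, `|derive1 sigma x - derive1 sigma y| <= `|x - y| &
      forall x y, `|sigma x - sigma y - derive1 sigma y * (x - y)| <= (x - y) ^+ 2].
Proof.
move=> [ds _ bs _ _].
have s1 x : `|derive1 sigma x| <= 1 by exact: (bs 1%N).
have d1 x : derivable sigma x 1 by exact: (ds 0%N).
have L2 : forall x y, `|derive1 sigma x - derive1 sigma y| <= `|x - y|.
  by apply: lip1_of_derive => x; [exact: (ds 1%N)|exact: (bs 2%N)].
split => //.
- by move=> x; exact: (bs 0%N).
- exact: lip1_of_derive.
- exact: taylor1_of_lip.
Qed.

Lemma activation_continuous (sigma : R -> R) : activation sigma ->
  continuous sigma /\ continuous (derive1 sigma).
Proof.
move=> [ds _ _ _ _]; split=> x;
  apply: differentiable_continuous; apply/derivable1_diffP.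
- exact: (ds 0%N).
- exact: (ds 1%N).
Qed.

End activation_facts.

Section softmax_facts.
Context (R : realType) (dx da : nat) (M : mdp R dx da).
Local Notation Z := (stX M * acA M)%type.
Implicit Types (h : Z -> R) (f : Z -> R).

(** An empty sum would be 0, while [rho0] sums to 1. A state is needed for the softmax denominator
    and wherever nonnegativity of a bound is read off from a norm that it dominates. *)
Lemma mdp_inhabited : inhabited Z.
Proof.
apply: contrapT => nz; have [_] := rho0_distr M.
rewrite big1 => [/esym/eqP|z _]; first by rewrite oner_eq0.
by exfalso; apply: nz; split.
Qed.

Lemma sumZ (F : Z -> R) : \sum_z F z = \sum_x \sum_a F (x, a).
Proof. by rewrite pair_big/=; apply: eq_bigr => -[]. Qed.

Lemma softmax_sum_gt0 h x : 0 < \sum_(a : acA M) expR (h (x, a)).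
Proof.
have [[x0 a0]] := mdp_inhabited.
rewrite (bigD1 a0)//= ltr_pwDl ?expR_gt0// sumr_ge0// => a _; exact: expR_ge0.
Qed.

Lemma softmax_gt0 h z : 0 < softmax h z.
Proof. by rewrite divr_gt0 ?expR_gt0//; exact: softmax_sum_gt0. Qed.

Lemma softmax_sum h x : \sum_(a : acA M) softmax h (x, a) = 1.
Proof. by rewrite /softmax /= -mulr_suml divff// gt_eqF//; exact: softmax_sum_gt0. Qed.

Lemma sum1_le1 f : (forall z, 0 <= f z) ->
  (forall x, \sum_(a : acA M) f (x, a) = 1) -> forall z, f z <= 1.
Proof.
move=> f0 f1 [x a]; rewrite -(f1 x) (bigD1 a)//= lerDl.
by apply: sumr_ge0 => b _; exact: f0.
Qed.

Lemma softmax_le1 h z : softmax h z <= 1.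
Proof.
by apply: sum1_le1 => [?|]; [exact/ltW/softmax_gt0|exact: softmax_sum].
Qed.

(** Numerator and denominator each change by a factor at most e^d, so e^(-2d) softmax(u) <=
    softmax(v). With softmax(u) <= 1 and e^(-2d) >= 1 - 2d this is the one-sided bound; the other
    follows by symmetry. *)
Lemma softmax_lip h h' d : (forall z, `|h z - h' z| <= d) ->
  forall z, `|softmax h z - softmax h' z| <= 2 * d.
Proof.
have half u v : (forall z, `|u z - v z| <= d) -> forall z : Z,
    softmax u z - softmax v z <= 2 * d.
  move=> uv z.
  have d0 : 0 <= d by exact: le_trans (uv z).
  have uvE z' : expR (u z') <= expR d * expR (v z').
    by rewrite -expRD ler_expR; have /ler_normlP[_] := uv z'; lra.
  have vuE z' : expR (v z') <= expR d * expR (u z').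
    by rewrite -expRD ler_expR; have /ler_normlP[] := uv z'; lra.
  have Su0 := softmax_sum_gt0 u z.1; have Sv0 := softmax_sum_gt0 v z.1.
  have S : (\sum_(a : acA M) expR (u (z.1, a)))^-1 <=
      expR d * (\sum_(a : acA M) expR (v (z.1, a)))^-1.
    rewrite ler_pdivlMr// ler_pdivrMl// mulrC mulr_sumr.
    exact: ler_sum.
  have key : softmax u z <= expR (2 * d) * softmax v z.
    have -> : expR (2 * d) = expR d * expR d by rewrite -expRD; congr expR; ring.
    rewrite /softmax mulrACA; apply: ler_pM => //; rewrite ?expR_ge0// invr_ge0.
    exact: ltW.
  have ge1 := expR_ge1Dx (- (2 * d)).
  have : expR (- (2 * d)) * softmax u z <= softmax v z.
    by rewrite expRN mulrC ler_pdivrMr ?expR_gt0// mulrC.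
  have := softmax_gt0 u z; have := softmax_le1 u z => u1 u0.
  nra.
move=> hh z; apply/ler_normlP; split.
  by rewrite opprB; apply: half => z'; rewrite distrC.
exact: half.
Qed.

End softmax_facts.

Section growth.
Context (R : realType).

Lemma expR_pow_le (c x T : R) (k : nat) : 0 <= c -> 0 <= x -> k%:R * x <= T ->
  (1 + c * x) ^+ k <= expR (c * T).
Proof.
move=> c0 x0 kx; apply: (@le_trans _ _ (expR (c * x) ^+ k)).
  by rewrite lerXn2r ?nnegrE ?expR_ge0 ?addr_ge0 ?mulr_ge0//; exact: expR_ge1Dx.
by rewrite -expRM_natl ler_expR mulrCA ler_wpM2l.
Qed.

End growth.

(** * A priori growth of the weights and the critic *)

Section run_path.
Context (R : realType) (dx da : nat) (M : mdp R dx da).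
Context (beta alpha : R) (sigma : R -> R).
Hypotheses (hbeta : 2^-1 < beta < 1) (halpha : 0 < alpha) (hsigma : activation sigma).
Local Notation X := (stX M).
Local Notation A := (acA M).
Local Notation Z := (X * A)%type.

Definition gram (z z' : Z) : R := dotv (emb z) (emb z').
Definition gram_sum : R := \sum_z \sum_z' `|gram z z'|.

Lemma gram_le z z' : `|gram z z'| <= gram_sum.
Proof.
rewrite /gram_sum (bigD1 z)//= (bigD1 z')//= -addrA lerDl addr_ge0//.
  by apply: sumr_ge0.
by apply: sumr_ge0 => *; apply: sumr_ge0.
Qed.

Lemma gram_sum_ge0 : 0 <= gram_sum.
Proof. by apply: sumr_ge0 => *; apply: sumr_ge0. Qed.

Lemma dotvDl n (u v w : 'rV[R]_n) : dotv (u + v) w = dotv u w + dotv v w.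
Proof.
by rewrite -big_split/=; apply: eq_bigr => j _; rewrite !mxE mulrDl.
Qed.

Lemma dotvZl n a (u w : 'rV[R]_n) : dotv (a *: u) w = a * dotv u w.
Proof. by rewrite mulr_sumr; apply: eq_bigr => j _; rewrite !mxE mulrA. Qed.

Lemma dotv_suml n (I : Type) (s : seq I) (F : I -> 'rV[R]_n) w :
  dotv (\sum_(i <- s) F i) w = \sum_(i <- s) dotv (F i) w.
Proof.
elim: s => [|i s IH]; last by rewrite !big_cons dotvDl IH.
by rewrite !big_nil /dotv big1// => j _; rewrite mxE mul0r.
Qed.

Lemma dotvC n (u w : 'rV[R]_n) : dotv u w = dotv w u.
Proof. by apply: eq_bigr => j _; rewrite mulrC. Qed.

(* N^-beta = (N * scl N)^-1, and both learning rates divided by N^beta are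
   scl N / N up to a factor that does not grow with N. *)
Definition scl (N : nat) : R := N%:R `^ (beta - 1).

Section fixed_size.
Context (N : nat).
Hypothesis (N0 : (0 < N)%N).
Local Notation n := (N%:R : R).
Local Notation eps := (scl N).

Let n0 : 0 < n. Proof. by rewrite ltr0n. Qed.
Let n1 : 1 <= n. Proof. by rewrite ler1n. Qed.

Lemma scl01 : 0 < eps <= 1.
Proof.
rewrite powR_gt0//= -(powRr0 n) ler_powR//.
by case/andP: hbeta => _ ?; lra.
Qed.

Lemma powR_scl : n `^ beta = n * eps.
Proof.
rewrite -{2}(powRr1 (ltW n0)) /scl -powRD; last by rewrite (gt_eqF n0) implybT.
by congr powR; ring.
Qed.

(** N^(2 beta - 2) is eps^2, of which one factor cancels the eps in N^beta = N eps. *)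
Lemma alphaN_scl : alphaN beta alpha N / n `^ beta = alpha * (eps / n).
Proof.
have e0 : 0 < eps by case/andP: scl01.
rewrite /alphaN powR_scl.
have -> : n `^ (2 * beta - 2) = eps * eps.
  rewrite /scl -powRD; last by rewrite (gt_eqF n0) implybT.
  by congr powR; ring.
by field; rewrite !gt_eqF.
Qed.

Lemma zetaN_scl k : zetaN beta N k / n `^ beta = zeta (k%:R / n) * (eps / n).
Proof.
have e0 : 0 < eps by case/andP: scl01.
rewrite /zetaN /zeta powR_scl.
have -> : n `^ (2 - 2 * beta) = (eps * eps)^-1.
  rewrite /scl -powRD; last by rewrite (gt_eqF n0) implybT.
  by rewrite -powRN; congr powR; ring.
have k0 : 0 < 1 + k%:R / n by rewrite ltr_pwDl// divr_ge0// ltW.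
have k1 : 0 < n + k%:R by rewrite ltr_pwDl.
by field; rewrite !gt_eqF.
Qed.

Lemma net_out (c : 'I_N -> R) w (z : Z) :
  net beta sigma c w z = out sigma eps c (fun i z => dotv (w i) (emb z)) z.
Proof. by rewrite /net /out powR_scl. Qed.

Lemma zeta01 k : 0 <= zeta (k%:R / n) <= 1.
Proof.
have k0 : 0 <= k%:R / n by rewrite divr_ge0// ltW.
by rewrite /zeta invr_ge0 invf_le1 ?lerDl ?addr_ge0 ?k0// ltr_pwDl.
Qed.

Definition td_error (th : params R dx da N) (z z1 : Z) : R :=
  reward z + gam M * criticQ beta sigma th z1 - criticQ beta sigma th z.

Definition mass_critic (th : params R dx da N) (z z1 : Z) (z' : Z) : R :=
  alpha * td_error th z z1 * (z' == z)%:R.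

(** The actor update integrates against a signed measure: unit mass at the sampled pair minus the
    policy's law at the same state. This puts actor and critic under the same abstract update; the
    total variation is at most twice the critic's absolute value. *)
Definition mass_actor k (th : params R dx da N) (zt z' : Z) : R :=
  zeta (k%:R / n) * criticQ beta sigma th zt *
   ((z' == zt)%:R - (z'.1 == zt.1)%:R * polf beta sigma th z').

Lemma sum_eq1 (F : Z -> R) (z : Z) : \sum_z' (z' == z)%:R * F z' = F z.
Proof.
rewrite (bigD1 z)//= eqxx mul1r big1 ?addr0// => z' /negbTE ->.
by rewrite mul0r.
Qed.

Lemma sum_fst1 (F : Z -> R) (x : X) :
  \sum_z' (z'.1 == x)%:R * F z' = \sum_a F (x, a).
Proof.
rewrite sumZ (bigD1 x)//= [X in _ + X]big1 ?addr0.
  by apply: eq_bigr => a _; rewrite eqxx mul1r.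
by move=> x' /negbTE xx; apply: big1 => a _; rewrite xx mul0r.
Qed.

Lemma sum_mass_critic (th : params R dx da N) z z1 (F : Z -> R) :
  \sum_z' mass_critic th z z1 z' * F z' = alpha * td_error th z z1 * F z.
Proof.
rewrite -[in RHS](sum_eq1 F z) mulr_sumr; apply: eq_bigr => z' _.
by rewrite /mass_critic; ring.
Qed.

Lemma sum_mass_actor k (th : params R dx da N) zt (F : Z -> R) :
  \sum_z' mass_actor k th zt z' * F z' =
  zeta (k%:R / n) * criticQ beta sigma th zt *
   (F zt - \sum_a polf beta sigma th (zt.1, a) * F (zt.1, a)).
Proof.
rewrite -[in RHS](sum_eq1 F zt).
rewrite -(sum_fst1 (fun z => polf beta sigma th z * F z)) -sumrB mulr_sumr.
by apply: eq_bigr => z' _; rewrite /mass_actor; ring.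
Qed.

Lemma mass_critic_le (th : params R dx da N) z z1 (q : R) :
  (forall z : Z, `|criticQ beta sigma th z| <= q) ->
  \sum_z' `|mass_critic th z z1 z'| <= alpha * (1 + 2 * q).
Proof.
move=> Qq.
have -> : \sum_z' `|mass_critic th z z1 z'| = alpha * `|td_error th z z1|.
  rewrite -[in RHS](sum_eq1 (fun=> `|td_error th z z1|) z) mulr_sumr.
  apply: eq_bigr => z' _; rewrite /mass_critic !normrM (gtr0_norm halpha).
  by case: (z' == z); rewrite /= ?normr1 ?normr0; ring.
apply: ler_wpM2l; first exact: ltW.
have /andP[g0 g1] := gam_bound M.
have r1 : `|reward z| <= 1 by rewrite ler_norml; exact: reward_bound.
have gQ : `|gam M * criticQ beta sigma th z1| <= q.
  by rewrite normrM gtr0_norm// -[leRHS]mul1r ler_pM// ltW.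
apply: le_trans (ler_normB _ _) _; apply: le_trans (lerD (ler_normD _ _) (Qq z)) _.
lra.
Qed.

Lemma mass_actor_le k (th : params R dx da N) zt (q : R) : `|criticQ beta sigma th zt| <= q ->
  \sum_z' `|mass_actor k th zt z'| <= 2 * q.
Proof.
move=> Qq; have q0 : 0 <= q by exact: le_trans Qq.
have f0 z : 0 <= polf beta sigma th z by exact/ltW/softmax_gt0.
apply: (@le_trans _ _ (\sum_z' (((z' == zt)%:R * q +
    (z'.1 == zt.1)%:R * (q * polf beta sigma th z'))))).
  apply: ler_sum => z' _.
  have -> : (z' == zt)%:R * q + (z'.1 == zt.1)%:R * (q * polf beta sigma th z')
     = q * ((z' == zt)%:R + (z'.1 == zt.1)%:R * polf beta sigma th z') by ring.
  rewrite /mass_actor normrM; apply: ler_pM => //.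
    have /andP[z0 z1] := zeta01 k.
    by rewrite normrM ger0_norm// -[leRHS]mul1r ler_pM.
  apply: le_trans (ler_normB _ _) _.
  by rewrite !ger0_norm// mulr_ge0.
rewrite big_split/= sum_eq1 sum_fst1 -mulr_sumr softmax_sum.
lra.
Qed.

Context (th : nat -> params R dx da N) (xi xit : nat -> Z).
Hypothesis (thS : forall k, th k.+1 =
  step beta alpha sigma k (th k) (xi k) (xi k.+1) (xit k)).

Definition yC k i (z : Z) : R := dotv (prmW (th k) i) (emb z).
Definition yA k i (z : Z) : R := dotv (prmU (th k) i) (emb z).
Definition mC k := mass_critic (th k) (xi k) (xi k.+1).
Definition mA k := mass_actor k (th k) (xit k).
Local Notation sigma' := (derive1 sigma).

Lemma criticE k (z : Z) : criticQ beta sigma (th k) z =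
  out sigma eps (prmC (th k)) (yC k) z.
Proof. exact: net_out. Qed.

Lemma actorE k (z : Z) : actorP beta sigma (th k) z =
  out sigma eps (prmB (th k)) (yA k) z.
Proof. exact: net_out. Qed.

Lemma prmCS k i : prmC (th k.+1) i =
  upd_out sigma eps (prmC (th k)) (yC k) (mC k) i.
Proof.
rewrite thS /upd_out /mC (sum_mass_critic _ _ _ (fun z => sigma (yC k i z))) /=.
by rewrite alphaN_scl -/(td_error _ _ _); congr (_ + _); rewrite /yC; ring.
Qed.

Lemma yCS k i z : yC k.+1 i z =
  upd_in sigma' gram eps (prmC (th k)) (yC k) (mC k) i z.
Proof.
rewrite {1}/yC thS /upd_in /mC.
rewrite (sum_mass_critic _ _ _ (fun z' => sigma' (yC k i z') * gram z z')) /=.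
rewrite dotvDl dotvZl alphaN_scl -/(td_error _ _ _) (dotvC (emb (xi k))) -/(gram _ _).
by congr (_ + _); rewrite /yC; ring.
Qed.

Lemma prmBS k i : prmB (th k.+1) i =
  upd_out sigma eps (prmB (th k)) (yA k) (mA k) i.
Proof.
rewrite thS /upd_out /mA (sum_mass_actor _ _ _ (fun z => sigma (yA k i z))) /=.
by rewrite zetaN_scl; congr (_ + _); rewrite /yA; ring.
Qed.

Lemma yAS k i z : yA k.+1 i z =
  upd_in sigma' gram eps (prmB (th k)) (yA k) (mA k) i z.
Proof.
rewrite {1}/yA thS /upd_in /mA.
rewrite (sum_mass_actor _ _ _ (fun z' => sigma' (yA k i z') * gram z z')) /=.
rewrite dotvDl dotvZl zetaN_scl dotvDl dotvZl -scaleN1r dotvZl dotv_suml.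
rewrite (dotvC (emb (xit k))) -/(gram _ _).
have -> : \sum_(a : A) dotv ((polf beta sigma (th k) ((xit k).1, a) *
     sigma' (dotv (prmU (th k) i) (emb ((xit k).1, a)))) *: emb ((xit k).1, a)) (emb z) =
   \sum_(a : A) polf beta sigma (th k) ((xit k).1, a) *
     (sigma' (yA k i ((xit k).1, a)) * gram z ((xit k).1, a)).
  by apply: eq_bigr => a _; rewrite dotvZl (dotvC (emb (_, a)) (emb z)) mulrA.
by congr (_ + _); rewrite /yA; ring.
Qed.

Context (K T : R).
Hypotheses (K0 : 0 <= K) (T0 : 0 <= T) (C0K : forall i, `|prmC (th 0) i| <= K)
  (B0K : forall i, `|prmB (th 0) i| <= K).

(* boundQ only controls the growth of the critic relative to its initial value,
   which is not bounded uniformly in N; hence the factors 1 + 2 q0 below. *)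
Definition boundC := expR (2 * alpha * T) * (1 + 2 * K).
Definition boundB := K + T * (2 * boundC).
Definition boundQ := expR (2 * (alpha * (1 + boundC ^+ 2 * gram_sum)) * T).

Let kT k : k%:R <= n * T -> k%:R * n^-1 <= T.
Proof. by move=> kL; rewrite ler_pdivrMr// mulrC. Qed.

Let k_prev k : k.+1%:R <= n * T -> k%:R <= n * T.
Proof. by apply: le_trans; rewrite ler_nat. Qed.

Let s1 := (let: And5 h _ _ _ _ := activation_lip hsigma in h).
Let s'1 := (let: And5 _ h _ _ _ := activation_lip hsigma in h).
Let sL := (let: And5 _ _ h _ _ := activation_lip hsigma in h).
Let e0 : 0 < eps. Proof. by case/andP: scl01. Qed.
Let e1 : eps <= 1. Proof. by case/andP: scl01. Qed.

Lemma boundC_ge0 : 0 <= boundC.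
Proof. by rewrite mulr_ge0 ?expR_ge0// addr_ge0// mulr_ge0. Qed.

(** The output is at most eps^-1 times the largest outer weight, and the update multiplies it by
    eps/n; so the bound on 1 + 2|C| grows by the factor 1 + 2 alpha/n per step, uniformly in N. *)
Lemma prmC_le k i : k%:R <= n * T -> `|prmC (th k) i| <= boundC.
Proof.
move=> kL; pose b k := (1 + 2 * alpha * n^-1) ^+ k * (1 + 2 * K).
have b0 j : 0 <= b j.
  rewrite mulr_ge0 ?exprn_ge0 ?addr_ge0 ?mulr_ge0 ?invr_ge0//; exact: ltW.
have H j : forall i, 1 + 2 * `|prmC (th j) i| <= b j.
  elim: j => [|j IH] i'.
    by rewrite /b expr0 mul1r lerD2l ler_pM2l.
  have cb i0 : `|prmC (th j) i0| <= (b j - 1) / 2 by have := IH i0; lra.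
  have Qb (z : Z) : `|criticQ beta sigma (th j) z| <= eps^-1 * ((b j - 1) / 2).
    by rewrite criticE; apply: out_le => //; exact: scl01.
  have dl := upd_out_le scl01 s1 (prmC (th j)) (yC j) i' (mass_critic_le (xi j) (xi j.+1) Qb).
  rewrite -/(mC j) -prmCS in dl.
  have := ler_normB (prmC (th j.+1) i' - prmC (th j) i') (- prmC (th j) i').
  rewrite opprK subrK normrN => tri.
  (* The reward contributes eps rather than 1, and eps <= 1 restores the closed form of the
     recursion. *)
  have : eps / n * (alpha * (1 + 2 * (eps^-1 * ((b j - 1) / 2)))) <= alpha / n * b j.
    have -> : eps / n * (alpha * (1 + 2 * (eps^-1 * ((b j - 1) / 2)))) =
      alpha / n * (eps + (b j - 1)) by field; rewrite !gt_eqF.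
    apply: ler_wpM2l; first by rewrite divr_ge0 ?ltW.
    by rewrite addrCA gerDl subr_le0.
  have -> : b j.+1 = b j + 2 * (alpha / n * b j) by rewrite /b exprS; ring.
  have := IH i'; lra.
have : b k <= boundC.
  apply: ler_wpM2r; first by rewrite addr_ge0// mulr_ge0.
  apply: expR_pow_le; [by rewrite mulr_ge0// ltW|by rewrite invr_ge0 ltW|exact: kT].
have := H k i; have : 0 <= `|prmC (th k) i| by []. lra.
Qed.

(** The signal of the actor is the critic, at most eps^-1 [boundC] whatever the actor weights are,
    so the growth is only linear in time. *)
Lemma prmB_le k i : k%:R <= n * T -> `|prmB (th k) i| <= boundB.
Proof.
have C0 := boundC_ge0.
suff H : k%:R <= n * T -> `|prmB (th k) i| <= K + k%:R * n^-1 * (2 * boundC).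
  move=> kL; apply: le_trans (H kL) _; rewrite lerD2l; apply: ler_wpM2r.
    by rewrite mulr_ge0.
  exact: kT.
elim: k => [_|k IH kL]; first by rewrite !mul0r addr0.
have Qb : `|criticQ beta sigma (th k) (xit k)| <= eps^-1 * boundC.
  rewrite criticE; apply: out_le => // [|i']; first exact: scl01.
  by apply: prmC_le; exact: k_prev.
have dl := upd_out_le scl01 s1 (prmB (th k)) (yA k) i (mass_actor_le k Qb).
rewrite -/(mA k) -prmBS in dl.
have := ler_normB (prmB (th k.+1) i - prmB (th k) i) (- prmB (th k) i).
rewrite opprK subrK normrN => tri.
have := IH (k_prev kL).
rewrite (_ : eps / n * _ = n^-1 * (2 * boundC)) in dl; last by field; rewrite !gt_eqF.
rewrite -[k.+1%:R]natr1 2!mulrDl mul1r; lra.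
Qed.

(** The weight bound alone gives |Q| <= eps^-1 [boundC], which diverges with N. Running the
    recursion on the output itself, whose steps are O(1/n) by [out_upd_le], keeps the bound
    proportional to 1 + 2 q0. *)
Lemma critic_le k (z : Z) (q0 : R) : (forall z : Z, `|criticQ beta sigma (th 0%N) z| <= q0) ->
  k%:R <= n * T -> 1 + 2 * `|criticQ beta sigma (th k) z| <= boundQ * (1 + 2 * q0).
Proof.
move=> hq0 kL.
have q00 : 0 <= q0 by exact: le_trans (hq0 z).
pose c := alpha * (1 + boundC ^+ 2 * gram_sum).
have c0 : 0 <= c.
  apply: mulr_ge0; first exact: ltW.
  apply: addr_ge0 => //; apply: mulr_ge0; last exact: gram_sum_ge0.
  by apply: exprn_ge0; exact: boundC_ge0.
pose b k := (1 + 2 * c * n^-1) ^+ k * (1 + 2 * q0).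
have b0 j : 0 <= b j.
  have q1 : 0 <= 1 + 2 * q0 by lra.
  apply: mulr_ge0 => //; apply: exprn_ge0; apply: addr_ge0 => //.
  by apply: mulr_ge0; [exact: mulr_ge0|rewrite invr_ge0 ltW].
have H j : j%:R <= n * T ->
    forall z' : Z, 1 + 2 * `|criticQ beta sigma (th j) z'| <= b j.
  elim: j => [_|j IH jL] z'.
    by rewrite /b expr0 mul1r lerD2l ler_pM2l.
  have Qb (z0 : Z) : `|criticQ beta sigma (th j) z0| <= (b j - 1) / 2.
    by have := IH (k_prev jL) z0; lra.
  have cb i : `|prmC (th j) i| <= boundC by apply: prmC_le; exact: k_prev.
  have := out_upd_le N0 scl01 gram_le s1 s'1 sL (yC j) z' cb
    (mass_critic_le (xi j) (xi j.+1) Qb).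
  rewrite -/(mC j).
  have -> : out sigma eps (upd_out sigma eps (prmC (th j)) (yC j) (mC j))
     (upd_in sigma' gram eps (prmC (th j)) (yC j) (mC j)) z' =
     criticQ beta sigma (th j.+1) z'.
    rewrite criticE /out; congr (_ * _); apply: eq_bigr => i _.
    by rewrite prmCS yCS.
  rewrite -criticE => dl.
  have := ler_normB (criticQ beta sigma (th j.+1) z' - criticQ beta sigma (th j) z')
    (- criticQ beta sigma (th j) z').
  rewrite opprK subrK normrN => tri.
  have : n^-1 * ((1 + boundC ^+ 2 * gram_sum) * (alpha * (1 + 2 * ((b j - 1) / 2)))) =
    n^-1 * c * b j by rewrite /c; field; rewrite gt_eqF.
  have -> : b j.+1 = b j + 2 * (n^-1 * c * b j) by rewrite /b exprS; ring.
  have := IH (k_prev jL) z'; lra.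
apply: le_trans (H k kL z) _; apply: ler_wpM2r; first by rewrite addr_ge0// mulr_ge0.
apply: expR_pow_le; [by rewrite mulr_ge0|by rewrite invr_ge0 ltW|exact: kT].
Qed.

End fixed_size.
End run_path.

Section path_expansion.
Context (R : realType) (dx da : nat) (M : mdp R dx da).
Context (beta alpha : R) (sigma : R -> R).
Hypotheses (hbeta : 2^-1 < beta < 1) (halpha : 0 < alpha) (hsigma : activation sigma).
Local Notation X := (stX M).
Local Notation A := (acA M).
Local Notation Z := (X * A)%type.
Local Notation sigma' := (derive1 sigma).

(** The first two terms come from the Taylor remainder, the other three from the drift of the kernel
    away from time 0. *)
Definition net_cst (K D T : R) : R :=
  K * D + K ^+ 3 * D ^+ 2 + 2 * T * K * D + 2 * K * T * D + 2 * K ^+ 3 * D ^+ 2 * T.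

Lemma net_cst_ge0 K D T : 0 <= K -> 0 <= D -> 0 <= T -> 0 <= net_cst K D T.
Proof. by move=> K0 D0 T0; rewrite !addr_ge0// !mulr_ge0// exprn_ge0. Qed.

(** Since (1 + 2 q0)^2 <= 2 + 8 q0^2 and eps q0 <= K, the term eps (1 + 2 q0)^2 is at most 2 eps + 8
    K q0; likewise q0 kap <= KM q0. The error becomes linear in eps, q0 and kap, so p-th moments
    suffice later. *)
Lemma err_collect (T c A1 K KM eps q0 kap : R) : 0 <= T -> 0 <= c -> 0 <= A1 ->
  0 <= K -> 0 <= KM -> 0 < eps -> 0 <= q0 -> eps * q0 <= K -> 0 <= kap <= KM ->
  T * (c * (eps * (A1 * (1 + 2 * q0)) ^+ 2) + A1 * (1 + 2 * q0) * kap) <=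
  T * (c * A1 ^+ 2 * (2 + 8 * K) + A1 * (1 + 2 * KM)) * (eps + q0 + kap).
Proof.
move=> T0 c0 A0 K0 KM0 e0 q00 eq /andP[k0 kM].
have -> : T * (c * A1 ^+ 2 * (2 + 8 * K) + A1 * (1 + 2 * KM)) * (eps + q0 + kap) =
  T * (c * (A1 ^+ 2 * ((2 + 8 * K) * (eps + q0 + kap))) +
       A1 * ((1 + 2 * KM) * (eps + q0 + kap))) by ring.
apply: ler_wpM2l => //; apply: lerD.
  apply: ler_wpM2l => //.
  have -> : eps * (A1 * (1 + 2 * q0)) ^+ 2 = A1 ^+ 2 * (eps * (1 + 2 * q0) ^+ 2) by ring.
  apply: ler_wpM2l; first exact: exprn_ge0.
  have h1 : eps * q0 * q0 <= K * q0 by exact: ler_wpM2r.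
  have h2 : 0 <= K * eps by rewrite mulr_ge0// ltW.
  have h3 : 0 <= K * kap by rewrite mulr_ge0.
  have h4 : 0 <= eps * (1 - 2 * q0) ^+ 2 by rewrite mulr_ge0 ?sqr_ge0// ltW.
  nra.
rewrite -mulrA; apply: ler_wpM2l => //.
have h1 : q0 * kap <= q0 * KM by exact: ler_wpM2l.
have h2 : 0 <= KM * eps by rewrite mulr_ge0// ltW.
have h3 : 0 <= KM * kap by rewrite mulr_ge0.
nra.
Qed.

(** The factor 1 + alpha lets one constant bound the signal of the critic, which carries alpha, and
    that of the actor, which does not. *)
Definition growth_cst (K T : R) := (1 + alpha) * boundQ M alpha K T.

Definition path_cst (K T KM : R) : R :=
  let Kp := boundC alpha K T + boundB alpha K T in
  T * (net_cst Kp (gram_sum M) T * growth_cst K T ^+ 2 * (2 + 8 * K) + growth_cst K T * (1 + 2 * KM)).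

Context (N : nat).
Hypothesis (N0 : (0 < N)%N).
Local Notation n := (N%:R : R).
Local Notation eps := (scl beta N).
Context (th : nat -> params R dx da N) (xi xit : nat -> Z).
Hypothesis (thS : forall k, th k.+1 =
  step beta alpha sigma k (th k) (xi k) (xi k.+1) (xit k)).
Context (K T KM q0 kv ku : R) (Bv Bu : Z -> Z -> R).
Hypotheses (K0 : 0 <= K) (T0 : 0 <= T) (KM0 : 0 <= KM)
  (C0K : forall i, `|prmC (th 0%N) i| <= K) (B0K : forall i, `|prmB (th 0%N) i| <= K)
  (hq0 : forall z : Z, `|criticQ beta sigma (th 0%N) z| <= q0) (eq0 : eps * q0 <= K)
  (kvM : 0 <= kv <= KM) (kuM : 0 <= ku <= KM)
  (hkv : forall z z', `|mker sigma sigma' (@gram _ _ _ M)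
     (prmC (th 0%N)) (yC th 0%N) z z' - Bv z z'| <= kv)
  (hku : forall z z', `|mker sigma sigma' (@gram _ _ _ M)
     (prmB (th 0%N)) (yA th 0%N) z z' - Bu z z'| <= ku).

Let bC0 : 0 <= boundC alpha K T. Proof. exact: boundC_ge0. Qed.
Let bB0 : 0 <= boundB alpha K T.
Proof. by rewrite addr_ge0// mulr_ge0// mulr_ge0. Qed.
Let bQ0 : 0 <= boundQ M alpha K T. Proof. exact: expR_ge0. Qed.
Let A10 : 0 <= growth_cst K T. Proof. by rewrite mulr_ge0// addr_ge0// ltW. Qed.
Let D0 : 0 <= gram_sum M. Proof. exact: gram_sum_ge0. Qed.
Let Kp := boundC alpha K T + boundB alpha K T.
Let Kp0 : 0 <= Kp. Proof. exact: addr_ge0. Qed.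
Let q00 : 0 <= q0.
Proof. by have [z] := mdp_inhabited M; exact: le_trans (hq0 z). Qed.

Let mu := growth_cst K T * (1 + 2 * q0).
Let mu0 : 0 <= mu. Proof. by rewrite mulr_ge0// addr_ge0// mulr_ge0. Qed.

Let ltkL (k L : nat) : L%:R <= n * T -> (k <= L)%N -> k%:R <= n * T.
Proof. by move=> LT kL; apply: le_trans LT; rewrite ler_nat. Qed.

Let critic_q k (z : Z) : k%:R <= n * T ->
  `|criticQ beta sigma (th k) z| <= (boundQ M alpha K T * (1 + 2 * q0) - 1) / 2.
Proof.
move=> kT.
have := critic_le hbeta halpha hsigma N0 thS K0 C0K z hq0 kT; lra.
Qed.

Let bQmu : boundQ M alpha K T * (1 + 2 * q0) <= mu.
Proof.
rewrite /mu /growth_cst -mulrA; apply: ler_peMl; last by rewrite lerDl ltW.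
by rewrite mulr_ge0// addr_ge0// mulr_ge0.
Qed.

Let mass_C k : k%:R <= n * T -> \sum_z `|mC beta alpha sigma th xi k z| <= mu.
Proof.
move=> kT; apply: le_trans (mass_critic_le halpha _ _ (fun z => critic_q z kT)) _.
rewrite /mu /growth_cst (_ : 1 + 2 * _ = boundQ M alpha K T * (1 + 2 * q0)); last by field.
rewrite -mulrA; apply: ler_wpM2r; last by rewrite lerDr.
by rewrite mulr_ge0// addr_ge0// mulr_ge0.
Qed.

Let mass_A k : k%:R <= n * T -> \sum_z `|mA beta sigma th xit k z| <= mu.
Proof.
move=> kT; apply: le_trans; first exact: (mass_actor_le k (critic_q (xit k) kT)).
by have := bQmu; lra.
Qed.

Let s1 := (let: And5 h _ _ _ _ := activation_lip hsigma in h).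
Let s'1 := (let: And5 _ h _ _ _ := activation_lip hsigma in h).
Let sL := (let: And5 _ _ h _ _ := activation_lip hsigma in h).
Let s'L := (let: And5 _ _ _ h _ := activation_lip hsigma in h).
Let sT := (let: And5 _ _ _ _ h := activation_lip hsigma in h).
Let e01 := scl01 hbeta N0.

Lemma critic_expansion k (z : Z) : k%:R <= n * T ->
  `|criticQ beta sigma (th k) z - criticQ beta sigma (th 0%N) z -
     n^-1 * \sum_(j < k) alpha * td_error beta sigma (th j) (xi j) (xi j.+1) * Bv z (xi j)|
  <= path_cst K T KM * (eps + q0 + kv).
Proof.
move=> kT.
have := net_trajectory N0 e01 (@gram_le _ _ _ M) s1 s'1 sL s'L sT
  (c := fun k => prmC (th k)) (y := yC th) (m := mC beta alpha sigma th xi)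
  (L := k) (K := Kp) (mu := mu) (T := T) (kap := kv) (Bb := Bv) Kp0 mu0 T0
  (prmCS hbeta N0 thS) (yCS hbeta N0 thS) kT _ _ hkv z (leqnn k).
rewrite -!criticE//.
have -> : \sum_(j < k) \sum_z' mC beta alpha sigma th xi j z' * Bv z z' =
  \sum_(j < k) alpha * td_error beta sigma (th j) (xi j) (xi j.+1) * Bv z (xi j).
  by apply: eq_bigr => j _; rewrite sum_mass_critic.
move=> H; apply: le_trans (H _ _) _.
- move=> j i jk; apply: (@le_trans _ _ (boundC alpha K T)); last by rewrite lerDl.
  by apply: (prmC_le hbeta halpha hsigma N0 thS) => //; exact: ltkL jk.
- by move=> j jk; apply: mass_C; apply: ltkL (ltnW jk).
by apply: err_collect => //; [exact: net_cst_ge0|case/andP: e01].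
Qed.

Lemma actor_expansion k (z : Z) : k%:R <= n * T ->
  `|actorP beta sigma (th k) z - actorP beta sigma (th 0%N) z -
     n^-1 * \sum_(j < k) zeta (j%:R / n) * criticQ beta sigma (th j) (xit j) *
       (Bu z (xit j) - \sum_(a : A) polf beta sigma (th j) ((xit j).1, a) * Bu z ((xit j).1, a))|
  <= path_cst K T KM * (eps + q0 + ku).
Proof.
move=> kT.
have := net_trajectory N0 e01 (@gram_le _ _ _ M) s1 s'1 sL s'L sT
  (c := fun k => prmB (th k)) (y := yA th) (m := mA beta sigma th xit)
  (L := k) (K := Kp) (mu := mu) (T := T) (kap := ku) (Bb := Bu) Kp0 mu0 T0
  (prmBS hbeta N0 thS) (yAS hbeta N0 thS) kT _ _ hku z (leqnn k).
rewrite -!actorE//.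
have -> : \sum_(j < k) \sum_z' mA beta sigma th xit j z' * Bu z z' =
  \sum_(j < k) zeta (j%:R / n) * criticQ beta sigma (th j) (xit j) *
   (Bu z (xit j) - \sum_(a : A) polf beta sigma (th j) ((xit j).1, a) * Bu z ((xit j).1, a)).
  by apply: eq_bigr => j _; rewrite sum_mass_actor.
move=> H; apply: le_trans (H _ _) _.
- move=> j i jk; apply: (@le_trans _ _ (boundB alpha K T)); last by rewrite lerDr.
  by apply: (prmB_le hbeta halpha hsigma N0 thS) => //; exact: ltkL jk.
- by move=> j jk; apply: mass_A; apply: ltkL (ltnW jk).
by apply: err_collect => //; [exact: net_cst_ge0|case/andP: e01].
Qed.

End path_expansion.

(** * Summation by parts and the error inequality *)

Section poisson_sum.
Context (R : realType) (Z : finType).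

(* Summation by parts along a trajectory: if h solves the Poisson equation of
   the kernel K0, then phi - F is a martingale increment up to telescoping
   terms, the time variation of h and the error made by replacing K0 by Kr. *)
Lemma poisson_sum (h phi : nat -> Z -> R) (xi : nat -> Z) (Kr : nat -> Z -> R)
    (K0 : nat -> Z -> Z -> R) (F dl : nat -> R) (Lh x : R) (k : nat) :
  (forall j, (j <= k)%N -> forall z, `|h j z| <= Lh) ->
  (forall j, (j < k)%N -> forall z, `|h j.+1 z - h j z| <= Lh * x) ->
  (forall j, (j < k)%N -> \sum_z `|Kr j z - K0 j (xi j) z| <= dl j) ->
  (forall j, (j < k)%N ->
     F j = phi j (xi j) - h j (xi j) + \sum_z K0 j (xi j) z * h j z) ->
  `|\sum_(j < k) (phi j (xi j) - F j)
    - \sum_(j < k) (h j (xi j.+1) - \sum_z Kr j z * h j z)|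
  <= 2 * Lh + k%:R * (Lh * x) + Lh * \sum_(j < k) dl j.
Proof.
move=> hL hx Kd FE.
have -> : \sum_(j < k) (phi j (xi j) - F j)
    - \sum_(j < k) (h j (xi j.+1) - \sum_z Kr j z * h j z) =
    (h 0%N (xi 0%N) - h k (xi k)) + \sum_(j < k) (h j.+1 (xi j.+1) - h j (xi j.+1))
     + \sum_(j < k) \sum_z (Kr j z - K0 j (xi j) z) * h j z.
  have -> : h 0%N (xi 0%N) - h k (xi k) = \sum_(j < k) (h j (xi j) - h j.+1 (xi j.+1)).
    rewrite -(big_mkord xpredT (fun j => h j (xi j) - h j.+1 (xi j.+1))).
    by rewrite -[LHS]opprB -(telescope_sumr (fun j => h j (xi j)) (leq0n k)) -sumrN;
      apply: eq_bigr => j _; rewrite opprB.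
  rewrite -!big_split/= -sumrB; apply: eq_bigr => j _.
  rewrite FE//.
  under [X in _ = _ + X]eq_bigr do rewrite mulrBl.
  by rewrite sumrB; ring.
apply: le_trans (ler_normD _ _) _; apply: lerD.
  apply: le_trans (ler_normD _ _) _; apply: lerD.
    apply: le_trans (ler_normB _ _) _.
    have := hL 0%N (leq0n k) (xi 0%N); have := hL k (leqnn k) (xi k); lra.
  apply: le_trans (ler_norm_sum _ _ _) _.
  apply: (@le_trans _ _ (\sum_(j < k) Lh * x)); first by apply: ler_sum => j _; exact: hx.
  by rewrite sumr_const card_ord mulr_natl.
apply: le_trans (ler_norm_sum _ _ _) _; rewrite mulr_sumr; apply: ler_sum => j _.
apply: le_trans (ler_norm_wsum (B := Lh) _ _) _ => [z|].
  by apply: hL; exact: ltnW.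
rewrite mulrC; apply: ler_wpM2l; last exact: Kd.
by apply: le_trans (hL j (ltnW _) (xi j)) => //.
Qed.

(** The maximum in the theorem, up to unfolding; starting it at 0 is harmless because all terms are
    nonnegative. *)
Definition supdist (u v : Z -> R) : R := \big[Num.max/0]_z `|u z - v z|.

Lemma supdist_ge u v z : `|u z - v z| <= supdist u v.
Proof. exact: (le_bigmax _ (fun z => `|u z - v z|)). Qed.

Lemma supdist_ge0 u v : 0 <= supdist u v.
Proof. exact: bigmax_ge_id. Qed.

Lemma supdist_le u v (B : R) : 0 <= B -> (forall z, `|u z - v z| <= B) ->
  supdist u v <= B.
Proof. by move=> B0 uv; apply: bigmax_le. Qed.

End poisson_sum.

Section error_inequality.
Context (R : realType) (dx da : nat) (M : mdp R dx da).
Context (beta alpha : R) (sigma : R -> R).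
Hypotheses (hbeta : 2^-1 < beta < 1) (halpha : 0 < alpha) (hsigma : activation sigma).
Local Notation X := (stX M).
Local Notation A := (acA M).
Local Notation Z := (X * A)%type.
Local Notation sigma' := (derive1 sigma).

Definition limf (P0 : R -> Z -> R) (s : R) : Z -> R := softmax (P0 s).
Definition limg (P0 : R -> Z -> R) (s : R) : Z -> R := explore (eta s) (limf P0 s).

(** Integrand of the limit equation with the next pair averaged out: a function of the current pair
    only, as the Poisson equation requires. *)
Definition phiC (Q0 P0 : R -> Z -> R) (Bv : Z -> Z -> R) (z : Z) (s : R) (z' : Z) : R :=
  alpha * (reward z' + gam M * (\sum_z'' chain (@trans _ _ _ M) (limg P0 s) z' z'' * Q0 s z'')
    - Q0 s z') * Bv z z'.

Definition phiA (Q0 P0 : R -> Z -> R) (Bu : Z -> Z -> R) (z : Z) (s : R) (z' : Z) : R :=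
  zeta s * Q0 s z' * (Bu z z' - \sum_(a : A) limf P0 s (z'.1, a) * Bu z (z'.1, a)).

(* FQ, FP are the time derivatives of the limits and hC, hA the solutions of the
   Poisson equations of the critic and actor chains under the limit policy. *)
Record limit_facts (T Ld Bb : R) (Q0 P0 : R -> Z -> R) (Bv Bu : Z -> Z -> R)
    (FQ FP : Z -> R -> R) (hC hA : Z -> R -> Z -> R) : Prop := LimitFacts {
  lfL : 0 <= Ld;
  lfB : 0 <= Bb;
  lfBv : forall z z', `|Bv z z'| <= Bb;
  lfBu : forall z z', `|Bu z z'| <= Bb;
  lfQ : forall s z, 0 <= s <= T -> `|Q0 s z| <= Ld;
  lfC : forall z s z', 0 <= s <= T -> `|hC z s z'| <= Ld;
  lfA : forall z s z', 0 <= s <= T -> `|hA z s z'| <= Ld;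
  lfC_lip : forall z s t z', 0 <= s <= T -> 0 <= t <= T ->
    `|hC z t z' - hC z s z'| <= Ld * `|t - s|;
  lfA_lip : forall z s t z', 0 <= s <= T -> 0 <= t <= T ->
    `|hA z t z' - hA z s z'| <= Ld * `|t - s|;
  lfC_poisson : forall z s z', 0 <= s <= T ->
    FQ z s = phiC Q0 P0 Bv z s z' - hC z s z'
      + \sum_z'' chain (@trans _ _ _ M) (limg P0 s) z' z'' * hC z s z'';
  lfA_poisson : forall z s z', 0 <= s <= T ->
    FP z s = phiA Q0 P0 Bu z s z' - hA z s z'
      + \sum_z'' chain (@trans_aux _ _ _ M) (limg P0 s) z' z'' * hA z s z'';
  lfQ0 : forall z, Q0 0 z = 0;
  lfP0 : forall z, P0 0 z = 0;
  lfQ_riemann : forall z s t, 0 <= s -> s <= t -> t <= T ->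
    `|Q0 t z - Q0 s z - (t - s) * FQ z s| <= Ld * (t - s) ^+ 2;
  lfP_riemann : forall z s t, 0 <= s -> s <= t -> t <= T ->
    `|P0 t z - P0 s z - (t - s) * FP z s| <= Ld * (t - s) ^+ 2;
  lfQ_lip : forall z s t, 0 <= s -> s <= t -> t <= T ->
    `|Q0 t z - Q0 s z| <= Ld * (t - s);
  lfP_lip : forall z s t, 0 <= s -> s <= t -> t <= T ->
    `|P0 t z - P0 s z| <= Ld * (t - s)
}.

Lemma trans01 (z : Z) x : 0 <= trans z x <= 1.
Proof.
have [t0 t1] := trans_distr z; rewrite t0 /= -t1 (bigD1 x)//= lerDl.
by apply: sumr_ge0.
Qed.

Lemma rho0x01 x : 0 <= rho0x (M := M) x <= 1.
Proof.
have [r0 r1] := rho0_distr M.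
have S x' : 0 <= rho0x (M := M) x' by apply: sumr_ge0.
rewrite S /= -r1 sumZ (bigD1 x)//= lerDl.
by apply: sumr_ge0 => *; exact: S.
Qed.

Lemma trans_aux01 (z : Z) x : 0 <= trans_aux z x <= 1.
Proof.
have /andP[g0 g1] := gam_bound M; have /andP[t0 t1] := trans01 z x.
have /andP[r0 r1] := rho0x01 x; rewrite /trans_aux.
have h1 : gam M * trans z x <= gam M by rewrite -[leRHS]mulr1 ler_wpM2l// ltW.
have h2 : (1 - gam M) * rho0x x <= 1 - gam M.
  by rewrite -[leRHS]mulr1 ler_wpM2l// subr_ge0 ltW.
rewrite addr_ge0/=; [lra|by rewrite mulr_ge0// ltW|by rewrite mulr_ge0// subr_ge0 ltW].
Qed.

Lemma eta01 (s : R) : 0 < eta s <= 1.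
Proof.
have s0 : 0 <= ln (1 + s) ^+ 2 by exact: sqr_ge0.
by rewrite /eta invr_gt0 invf_le1 ?lerDl ?s0 ltr_pwDl.
Qed.

Lemma explore_lip (e : R) (f f' : Z -> R) z : 0 <= e <= 1 ->
  `|explore e f z - explore e f' z| <= `|f z - f' z|.
Proof.
move=> /andP[e0 e1]; rewrite /explore opprD addrACA subrr add0r -mulrBr normrM.
by rewrite ger0_norm ?subr_ge0// -[leRHS]mul1r ler_wpM2r// lerBlDr lerDl.
Qed.

Lemma chain_lip (q : Z -> X -> R) (g g' : Z -> R) (B : R) z :
  (forall z x, 0 <= q z x <= 1) -> (forall z, `|g z - g' z| <= B) ->
  \sum_z' `|chain q g z z' - chain q g' z z'| <= #|{: Z}|%:R * B.
Proof.
move=> q01 gB; rewrite mulr_natl -sumr_const; apply: ler_sum => z' _.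
rewrite /chain -mulrBr normrM -[leRHS]mul1r; apply: ler_pM => //.
by have /andP[? ?] := q01 z z'.1; rewrite ger0_norm.
Qed.

Context (N : nat).
Hypothesis (N0 : (0 < N)%N).
Local Notation n := (N%:R : R).
Local Notation eps := (scl beta N).
Context (th : nat -> params R dx da N) (xi xit : nat -> Z).
Hypothesis (thS : forall k, th k.+1 =
  step beta alpha sigma k (th k) (xi k) (xi k.+1) (xit k)).
Context (K T KM q0 p0 kv ku : R) (Bv Bu : Z -> Z -> R).
Hypotheses (K0 : 0 <= K) (T0 : 0 <= T) (KM0 : 0 <= KM)
  (C0K : forall i, `|prmC (th 0%N) i| <= K) (B0K : forall i, `|prmB (th 0%N) i| <= K)
  (hq0 : forall z : Z, `|criticQ beta sigma (th 0%N) z| <= q0) (eq0 : eps * q0 <= K)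
  (hp0 : forall z : Z, `|actorP beta sigma (th 0%N) z| <= p0)
  (kvM : 0 <= kv <= KM) (kuM : 0 <= ku <= KM)
  (hkv : forall z z', `|mker sigma sigma' (@gram _ _ _ M)
     (prmC (th 0%N)) (yC th 0%N) z z' - Bv z z'| <= kv)
  (hku : forall z z', `|mker sigma sigma' (@gram _ _ _ M)
     (prmB (th 0%N)) (yA th 0%N) z z' - Bu z z'| <= ku).
Context (Ld Bb : R) (Q0 P0 : R -> Z -> R) (FQ FP : Z -> R -> R) (hC hA : Z -> R -> Z -> R).
Hypothesis (lf : limit_facts T Ld Bb Q0 P0 Bv Bu FQ FP hC hA).

Local Notation tm j := (j%:R / n).
Definition eQ j := supdist (criticQ beta sigma (M := M) (th j)) (Q0 (tm j)).
Definition eP j := supdist (actorP beta sigma (M := M) (th j)) (P0 (tm j)).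

(* The next state enters through the TD error as well as through hC. *)
Definition vC (z : Z) (j : nat) (z1 z2 : Z) : R :=
  alpha * gam M * Bv z z1 * Q0 (tm j) z2 + hC z (tm j) z2.
Definition vA (z : Z) (j : nat) (z1 z2 : Z) : R := hA z (tm j) z2.

(** Conditional law of the next pair under the policy actually used for sampling. The Poisson
    solution belongs to the limit policy, and the gap is a multiple of the actor error. *)
Definition rowC j z' := trans (xi j) z'.1 * polg beta sigma j (th j) z'.
Definition rowA j z' := trans_aux (xit j) z'.1 * polg beta sigma j (th j) z'.

Definition martC (z : Z) k : R :=
  \sum_(j < k) (vC z j (xi j) (xi j.+1) - \sum_z' rowC j z' * vC z j (xi j) z').
Definition martA (z : Z) k : R :=
  \sum_(j < k) (vA z j (xit j) (xit j.+1) - \sum_z' rowA j z' * vA z j (xit j) z').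

Let n0 : 0 < n. Proof. by rewrite ltr0n. Qed.
Let e01 := scl01 hbeta N0.

Let ninv_eps : n^-1 <= eps.
Proof.
rewrite -powR_inv1 ?ler0n// /scl ler_powR ?ler1n//.
by case/andP: hbeta => b1 b2; lra.
Qed.

Let ltkL (k L : nat) : L%:R <= n * T -> (k <= L)%N -> k%:R <= n * T.
Proof. by move=> LT kL; apply: le_trans LT; rewrite ler_nat. Qed.

Let tm_itv (k L : nat) : L%:R <= n * T -> (k <= L)%N -> 0 <= tm k <= T.
Proof.
move=> LT kL; rewrite divr_ge0 ?ler0n//= ler_pdivrMr// mulrC.
exact: ltkL kL.
Qed.

Let tmS j : tm j.+1 - tm j = n^-1.
Proof. by rewrite -mulrBl -[j.+1%:R]natr1 addrAC subrr add0r mul1r. Qed.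

Let polg_lip j z : `|polg beta sigma j (th j) z - limg P0 (tm j) z| <= 2 * eP j.
Proof.
apply: le_trans (explore_lip _ _ _ _) _.
  by have /andP[? ?] := eta01 (tm j); rewrite ltW.
by apply: softmax_lip => z'; exact: (supdist_ge _ (P0 (tm j))).
Qed.

Let c2 : R := #|{: Z}|%:R * 2.

Let rowC_lip j : \sum_z' `|rowC j z' - chain (@trans _ _ _ M) (limg P0 (tm j)) (xi j) z'|
  <= c2 * eP j.
Proof.
rewrite /c2 -mulrA.
apply: (chain_lip (g := polg beta sigma j (th j)) (xi j) trans01).
exact: polg_lip.
Qed.

Let rowA_lip j : \sum_z' `|rowA j z' - chain (@trans_aux _ _ _ M) (limg P0 (tm j)) (xit j) z'|
  <= c2 * eP j.
Proof.
rewrite /c2 -mulrA.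
apply: (chain_lip (g := polg beta sigma j (th j)) (xit j) trans_aux01).
exact: polg_lip.
Qed.

(** Each of the k steps loses Ld/n^2 by the first-order expansion of [u], and k/n <= T. *)
Let riemann_sum (u : R -> R) (F : R -> R) k : k%:R <= n * T ->
  (forall s t, 0 <= s -> s <= t -> t <= T ->
    `|u t - u s - (t - s) * F s| <= Ld * (t - s) ^+ 2) ->
  `|u (tm k) - u 0 - n^-1 * \sum_(j < k) F (tm j)| <= T * Ld * n^-1.
Proof.
move=> kT uF; have L0 := lfL lf.
suff : `|u (tm k) - u 0 - n^-1 * \sum_(j < k) F (tm j)| <= tm k * Ld * n^-1.
  move/le_trans; apply; apply: ler_wpM2r; first by rewrite invr_ge0 ltW.
  by apply: ler_wpM2r => //; case/andP: (tm_itv kT (leqnn k)).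
elim: k kT => [_|k IH kT].
  by rewrite big_ord0 mul0r !mul0r subrr mulr0 subrr normr0.
have kT' : k%:R <= n * T by exact: ltkL kT _.
rewrite big_ord_recr/=.
have -> : u (tm k.+1) - u 0 - n^-1 * (\sum_(i < k) F (tm i) + F (tm k)) =
  (u (tm k) - u 0 - n^-1 * \sum_(i < k) F (tm i)) +
  (u (tm k.+1) - u (tm k) - (tm k.+1 - tm k) * F (tm k)).
  by rewrite tmS; ring.
apply: le_trans (ler_normD _ _) _.
have /andP[k1 k2] := tm_itv kT' (leqnn k); have /andP[k3 k4] := tm_itv kT (leqnn k.+1).
have kk : tm k <= tm k.+1 by rewrite -subr_ge0 tmS invr_ge0 ltW.
apply: le_trans (lerD (IH kT') (uF (tm k) (tm k.+1) k1 kk k4)) _.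
have -> : tm k.+1 = tm k + n^-1 by apply: (@addIr _ (- tm k)); rewrite tmS; ring.
have -> : tm k + n^-1 - tm k = n^-1 by ring.
by rewrite (_ : (tm k + n^-1) * Ld * n^-1 = tm k * Ld * n^-1 + Ld * n^-1 ^+ 2)//; ring.
Qed.

Let pc := path_cst M alpha K T KM.
Lemma path_cst_ge0 : 0 <= path_cst M alpha K T KM.
Proof.
have bC0 := boundC_ge0 alpha T K0.
have bB0 : 0 <= boundB alpha K T by rewrite addr_ge0// mulr_ge0// mulr_ge0.
have A10 : 0 <= growth_cst M alpha K T.
  by rewrite mulr_ge0 ?expR_ge0// addr_ge0// ltW.
rewrite /path_cst; apply: mulr_ge0 => //; apply: addr_ge0.
  apply: mulr_ge0; last by rewrite addr_ge0// mulr_ge0.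
  apply: mulr_ge0; last exact: exprn_ge0.
  by apply: net_cst_ge0 => //; [exact: addr_ge0|exact: gram_sum_ge0].
by rewrite mulr_ge0// addr_ge0// mulr_ge0.
Qed.

Let pc0 : 0 <= pc. Proof. exact: path_cst_ge0. Qed.
Let eQ0 j : 0 <= eQ j. Proof. exact: supdist_ge0. Qed.
Let eP0 j : 0 <= eP j. Proof. exact: supdist_ge0. Qed.
Let c20 : 0 <= c2. Proof. by rewrite mulr_ge0. Qed.
Let q00 : 0 <= q0.
Proof. by have [z] := mdp_inhabited M; exact: le_trans (hq0 z). Qed.
Let p00 : 0 <= p0.
Proof. by have [z] := mdp_inhabited M; exact: le_trans (hp0 z). Qed.

(** Coefficients that add up: 1 for the initial output, [pc] for the expansion, (2 + 2T) Ld for the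
    boundary terms and time variation of the Poisson solution and for the Riemann sum, Ld c2 for the
    change of policy in the chain, [a1] and [a2] for putting limit quantities into the update. *)
Definition err_cst (a1 a2 : R) : R := 1 + pc + (2 + 2 * T) * Ld + Ld * c2 + a1 + a2.
Definition err_cstC : R := err_cst (2 * (alpha * Bb)) (alpha * Bb * (Ld * c2)).
Definition err_cstA : R := err_cst (2 * Bb) (#|{: A}|%:R * 2 * (Ld * Bb)).

(** Bookkeeping shared by critic and actor: [d0] is the initial output, [dE] the expansion error,
    [S] the Poisson remainder, [Mg] the martingale, [rho] the cost of putting limit quantities into
    the update, [r] the Riemann error. *)
Let collect_error (a1 a2 q kp d0 dE S Mg rho r : R) k : k%:R <= n * T ->
  0 <= a1 -> 0 <= a2 -> 0 <= kp -> q0 <= q ->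
  `|d0| <= q -> `|dE| <= pc * (eps + q0 + kp) ->
  `|S| <= 2 * Ld + k%:R * (Ld * n^-1) + Ld * \sum_(j < k) c2 * eP j ->
  `|rho| <= \sum_(j < k) (a1 * eQ j + a2 * eP j) -> `|r| <= T * Ld * n^-1 ->
  `|d0 + dE + n^-1 * (S + Mg + rho) - r| <=
  err_cst a1 a2 * (eps + q + kp) + n^-1 * `|Mg|
   + n^-1 * (err_cst a1 a2 * \sum_(j < k) (eQ j + eP j)).
Proof.
move=> kT a10 a20 kp0 q0q d0q dEq SL rhoL rL; have L0 := lfL lf.
have ni0 : 0 <= n^-1 by rewrite invr_ge0 ltW.
have /andP[_ kn] := tm_itv kT (leqnn k).
have Lc0 : 0 <= Ld * c2 by rewrite mulr_ge0.
have TL0 : 0 <= T * Ld by rewrite mulr_ge0.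
apply: le_trans (ler_normB _ _) _.
apply: le_trans (lerD (ler_normD _ _) rL) _.
apply: le_trans (lerD (lerD (ler_normD _ _) (lexx _)) (lexx _)) _.
rewrite [X in _ + X + _ <= _]normrM (ger0_norm ni0).
have t1 := le_trans (ler_normD (S + Mg) rho) (lerD (ler_normD S Mg) rhoL).
have t2 := le_trans t1 (lerD (lerD SL (lexx _)) (lexx _)).
apply: le_trans (lerD (lerD (lerD d0q dEq) (ler_wpM2l ni0 t2)) (lexx _)) _.
have sumE : Ld * (\sum_(j < k) c2 * eP j) + \sum_(j < k) (a1 * eQ j + a2 * eP j) <=
    err_cst a1 a2 * \sum_(j < k) (eQ j + eP j).
  rewrite !mulr_sumr -big_split/=; apply: ler_sum => j _.
  have -> : Ld * (c2 * eP j) + (a1 * eQ j + a2 * eP j) =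
    a1 * eQ j + (Ld * c2 + a2) * eP j by ring.
  rewrite (mulrDr (err_cst a1 a2)); apply: lerD; apply: ler_wpM2r => //; rewrite /err_cst;
    move: pc0 L0 Lc0 TL0 a10 a20; move: (c2) (pc) => c p *; lra.
have {}sumE := ler_wpM2l ni0 sumE.
have small : q + pc * (eps + q0 + kp) + n^-1 * (2 * Ld) + n^-1 * (k%:R * (Ld * n^-1)) +
   T * Ld * n^-1 <= err_cst a1 a2 * (eps + q + kp).
  have h1 : n^-1 * Ld <= eps * Ld by exact: ler_wpM2r.
  have h2 : n^-1 * (k%:R * (Ld * n^-1)) <= T * (eps * Ld).
    have -> : n^-1 * (k%:R * (Ld * n^-1)) = k%:R * n^-1 * (n^-1 * Ld) by ring.
    by apply: ler_pM => //; rewrite ?mulr_ge0.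
  have h3 : T * (n^-1 * Ld) <= T * (eps * Ld) by exact: ler_wpM2l.
  have e0 : 0 < eps by case/andP: e01.
  have q_ge0 : 0 <= q by exact: le_trans q0q.
  have h6 : 0 <= ((2 + 2 * T) * Ld) * (q + kp).
    by rewrite mulr_ge0 ?addr_ge0// mulr_ge0// addr_ge0// mulr_ge0.
  have h7 : 0 <= (Ld * c2 + a1 + a2) * (eps + q + kp).
    by rewrite mulr_ge0 ?addr_ge0// ltW.
  have h8 : pc * (eps + q0 + kp) <= pc * (eps + q + kp).
    by apply: ler_wpM2l => //; rewrite lerD2r lerD2l.
  rewrite /err_cst; move: pc0 h1 h2 h3 h6 h7 h8 e0 q_ge0 kp0 L0 T0.
  move: (c2) (pc) => c p *; lra.
move: small sumE; move: (pc) => p *; lra.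
Qed.

Let gam01 : 0 <= gam M <= 1.
Proof. by have /andP[? ?] := gam_bound M; rewrite !ltW. Qed.

Lemma critic_error k (z : Z) : k%:R <= n * T ->
  `|criticQ beta sigma (th k) z - Q0 (tm k) z| <=
  err_cstC * (eps + q0 + kv) + n^-1 * `|martC z k|
   + n^-1 * (err_cstC * \sum_(j < k) (eQ j + eP j)).
Proof.
move=> kT; have L0 := lfL lf; have B0 := lfB lf; have /andP[g0 g1] := gam01.
have jT j : (j <= k)%N -> 0 <= tm j <= T by exact: tm_itv.
have ni0 : 0 <= n^-1 by rewrite invr_ge0 ltW.
pose phi j := phiC Q0 P0 Bv z (tm j).
have PS := @poisson_sum R _ (fun j => hC z (tm j)) phi xi rowC
  (fun j => chain (@trans _ _ _ M) (limg P0 (tm j))) (fun j => FQ z (tm j))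
  (fun j => c2 * eP j) Ld n^-1 k.
have {}PS := PS (fun j jk z' => lfC lf z z' (jT j jk)) _ (fun j _ => rowC_lip j)
  (fun j jk => lfC_poisson lf z (xi j) (jT j (ltnW jk))).
have {}PS : `|\sum_(j < k) (phi j (xi j) - FQ z (tm j)) -
    \sum_(j < k) (hC z (tm j) (xi j.+1) - \sum_z0 rowC j z0 * hC z (tm j) z0)|
    <= 2 * Ld + k%:R * (Ld * n^-1) + Ld * \sum_(j < k) c2 * eP j.
  apply: PS => j jk z'; have := lfC_lip lf z z' (jT j (ltnW jk)) (jT j.+1 jk).
  by rewrite tmS (ger0_norm ni0).
have RS := riemann_sum (u := fun s => Q0 s z) kT (lfQ_riemann lf z).
rewrite (lfQ0 lf) subr0 in RS.
have EX := critic_expansion hbeta halpha hsigma N0 thS K0 T0 KM0 C0K hq0 eq0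
  kvM hkv z kT.
(* Cost of inserting the limit critic at the current and the next state, and of averaging it over
   the limit row instead of the sampling row. *)
pose rho j := alpha * Bv z (xi j) * (gam M * (criticQ beta sigma (th j) (xi j.+1) -
    Q0 (tm j) (xi j.+1)) - (criticQ beta sigma (th j) (xi j) - Q0 (tm j) (xi j)))
  + alpha * Bv z (xi j) * gam M *
    \sum_z' (rowC j z' - chain (@trans _ _ _ M) (limg P0 (tm j)) (xi j) z') * Q0 (tm j) z'.
have rhoL j : (j < k)%N -> `|rho j| <= alpha * Bb * (2 * eQ j + Ld * (c2 * eP j)).
  move=> jk; rewrite mulrDr; apply: le_trans (ler_normD _ _) _; apply: lerD.
    rewrite normrM; apply: ler_pM => //.
      by rewrite normrM gtr0_norm// ler_pM2l// (lfBv lf).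
    apply: le_trans (ler_normB _ _) _.
    have h1 := supdist_ge (criticQ beta sigma (th j)) (Q0 (tm j)) (xi j).
    have h2 : `|gam M * (criticQ beta sigma (th j) (xi j.+1) - Q0 (tm j) (xi j.+1))| <= eQ j.
      rewrite normrM ger0_norm// -[leRHS]mul1r; apply: ler_pM => //.
      exact: supdist_ge.
    by rewrite -/(eQ j) in h1; lra.
  rewrite normrM; apply: ler_pM => //.
    rewrite normrM (ger0_norm g0) -[leRHS]mulr1; apply: ler_pM => //.
    by rewrite normrM gtr0_norm// ler_pM2l// (lfBv lf).
  apply: le_trans (ler_norm_wsum (B := Ld) _ _) _ => [z'|].
    by apply: (lfQ lf); apply: jT; exact: ltnW.
  by rewrite mulrC; apply: ler_wpM2l.
(* Pure algebra: the fluctuation of the limit critic at the next state moves into [martC], while its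
   mean under the limit row is already in [phi]. *)
have key : \sum_(j < k) alpha * td_error beta sigma (th j) (xi j) (xi j.+1) * Bv z (xi j) -
    \sum_(j < k) FQ z (tm j) =
  (\sum_(j < k) (phi j (xi j) - FQ z (tm j)) -
    \sum_(j < k) (hC z (tm j) (xi j.+1) - \sum_z0 rowC j z0 * hC z (tm j) z0))
  + martC z k + \sum_(j < k) rho j.
  rewrite -!sumrB -!big_split/=; apply: eq_bigr => j _.
  rewrite /phi /phiC /rho /td_error /vC.
  under [X in _ = _ + (_ - X) + _]eq_bigr do rewrite mulrDr mulrCA.
  under [X in _ = _ + (_ + _ * X)]eq_bigr do rewrite mulrBl.
  rewrite big_split/= -mulr_sumr sumrB; ring.
have -> : criticQ beta sigma (th k) z - Q0 (tm k) z =
  criticQ beta sigma (th 0%N) z +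
  (criticQ beta sigma (th k) z - criticQ beta sigma (th 0%N) z -
   n^-1 * \sum_(j < k) alpha * td_error beta sigma (th j) (xi j) (xi j.+1) * Bv z (xi j))
  + n^-1 * (\sum_(j < k) alpha * td_error beta sigma (th j) (xi j) (xi j.+1) * Bv z (xi j) -
    \sum_(j < k) FQ z (tm j))
  - (Q0 (tm k) z - n^-1 * \sum_(j < k) FQ z (tm j)) by ring.
rewrite key; apply: collect_error => //.
- by rewrite !mulr_ge0// ltW.
- by rewrite !mulr_ge0// ltW.
- by case/andP: kvM.
apply: le_trans (ler_norm_sum _ _ _) _; apply: ler_sum => j _.
have -> : 2 * (alpha * Bb) * eQ j + alpha * Bb * (Ld * c2) * eP j =
  alpha * Bb * (2 * eQ j + Ld * (c2 * eP j)) by ring.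
exact: rhoL.
Qed.

Lemma actor_error k (z : Z) : k%:R <= n * T ->
  `|actorP beta sigma (th k) z - P0 (tm k) z| <=
  err_cstA * (eps + (q0 + p0) + ku) + n^-1 * `|martA z k|
   + n^-1 * (err_cstA * \sum_(j < k) (eQ j + eP j)).
Proof.
move=> kT; have L0 := lfL lf; have B0 := lfB lf.
have jT j : (j <= k)%N -> 0 <= tm j <= T by exact: tm_itv.
have ni0 : 0 <= n^-1 by rewrite invr_ge0 ltW.
pose phi j := phiA Q0 P0 Bu z (tm j).
have PS := @poisson_sum R _ (fun j => hA z (tm j)) phi xit rowA
  (fun j => chain (@trans_aux _ _ _ M) (limg P0 (tm j))) (fun j => FP z (tm j))
  (fun j => c2 * eP j) Ld n^-1 k.
have {}PS := PS (fun j jk z' => lfA lf z z' (jT j jk)) _ (fun j _ => rowA_lip j)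
  (fun j jk => lfA_poisson lf z (xit j) (jT j (ltnW jk))).
have {}PS : `|\sum_(j < k) (phi j (xit j) - FP z (tm j)) - martA z k|
    <= 2 * Ld + k%:R * (Ld * n^-1) + Ld * \sum_(j < k) c2 * eP j.
  apply: PS => j jk z'; have := lfA_lip lf z z' (jT j (ltnW jk)) (jT j.+1 jk).
  by rewrite tmS (ger0_norm ni0).
have RS := riemann_sum (u := fun s => P0 s z) kT (lfP_riemann lf z).
rewrite (lfP0 lf) subr0 in RS.
have EX := actor_expansion hbeta halpha hsigma N0 thS K0 T0 KM0 C0K B0K hq0 eq0
  kuM hku z kT.
pose f j := polf (M := M) beta sigma (th j); pose f0 j := limf P0 (tm j).
pose w j := Bu z (xit j) - \sum_(a : A) f j ((xit j).1, a) * Bu z ((xit j).1, a).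
(* Cost of inserting the limit critic, and then the limit policy in the average that the update
   subtracts. *)
pose rho j := zeta (tm j) * (criticQ beta sigma (th j) (xit j) - Q0 (tm j) (xit j)) * w j
  + zeta (tm j) * Q0 (tm j) (xit j) *
    \sum_(a : A) (f0 j ((xit j).1, a) - f j ((xit j).1, a)) * Bu z ((xit j).1, a).
have rhoL j : (j < k)%N ->
    `|rho j| <= 2 * Bb * eQ j + #|{: A}|%:R * 2 * (Ld * Bb) * eP j.
  move=> jk; have /andP[z0 z1] := zeta01 R N j.
  apply: le_trans (ler_normD _ _) _; apply: lerD.
    rewrite mulrC normrM; apply: ler_pM => //.
      apply: le_trans (ler_normB _ _) _.
      have h1 : `|\sum_(a : A) f j ((xit j).1, a) * Bu z ((xit j).1, a)| <= Bb.
        apply: le_trans (ler_norm_wsum (B := Bb) _ _) _ => [a|]; first exact: (lfBu lf).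
        rewrite (eq_bigr (fun a => softmax (actorP beta sigma (th j)) ((xit j).1, a))).
          by rewrite softmax_sum mul1r.
        by move=> a _; rewrite ger0_norm//; exact/ltW/softmax_gt0.
      have h2 := lfBu lf z (xit j); lra.
    rewrite normrM (ger0_norm z0) -[leRHS]mul1r; apply: ler_pM => //.
    exact: (supdist_ge _ (Q0 (tm j))).
  have -> : #|{: A}|%:R * 2 * (Ld * Bb) * eP j = Ld * (#|{: A}|%:R * (2 * eP j) * Bb) by ring.
  rewrite normrM; apply: ler_pM => //.
    rewrite normrM (ger0_norm z0) -[leRHS]mul1r; apply: ler_pM => //.
    by apply: (lfQ lf); apply: jT; exact: ltnW.
  apply: le_trans (ler_norm_wsum (B := Bb) _ _) _ => [a|]; first exact: (lfBu lf).
  apply: ler_wpM2r => //; rewrite mulr_natl -sumr_const; apply: ler_sum => a _.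
  rewrite distrC; apply: softmax_lip => z'.
  exact: (supdist_ge _ (P0 (tm j))).
have key : \sum_(j < k) zeta (tm j) * criticQ beta sigma (th j) (xit j) * w j -
    \sum_(j < k) FP z (tm j) =
  (\sum_(j < k) (phi j (xit j) - FP z (tm j)) - martA z k)
  + martA z k + \sum_(j < k) rho j.
  rewrite subrK -!sumrB -!big_split/=; apply: eq_bigr => j _.
  rewrite /phi /phiA /rho /w -/(f0 j).
  under [X in _ = _ + (_ + _ * X)]eq_bigr do rewrite mulrBl.
  by rewrite sumrB; ring.
have -> : actorP beta sigma (th k) z - P0 (tm k) z =
  actorP beta sigma (th 0%N) z +
  (actorP beta sigma (th k) z - actorP beta sigma (th 0%N) z -
   n^-1 * \sum_(j < k) zeta (tm j) * criticQ beta sigma (th j) (xit j) * w j)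
  + n^-1 * (\sum_(j < k) zeta (tm j) * criticQ beta sigma (th j) (xit j) * w j -
    \sum_(j < k) FP z (tm j))
  - (P0 (tm k) z - n^-1 * \sum_(j < k) FP z (tm j)) by ring.
rewrite key; apply: collect_error => //.
- by rewrite mulr_ge0.
- by rewrite !mulr_ge0.
- by case/andP: kuM.
- by rewrite lerDl.
- by apply: le_trans (hp0 z) _; rewrite lerDr.
by apply: le_trans (ler_norm_sum _ _ _) _; apply: ler_sum => j _; exact: rhoL.
Qed.

End error_inequality.

(** * Poisson equation and regularity of the limit *)

Section tame_functions.
Context (R : realType) (I : Type) (D : I -> Prop) (w : I -> I -> R).
Hypothesis (w0 : forall s t, 0 <= w s t).
Implicit Types (f g : I -> R).

(* The modulus w is first |s - t| plus the oscillation of the limit functions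
   themselves, and then |s - t|: continuity is bootstrapped to Lipschitz
   continuity. *)
Definition tame f := exists2 L : R, 0 <= L &
  (forall s, D s -> `|f s| <= L) /\
  forall s t, D s -> D t -> `|f s - f t| <= L * w s t.

Lemma tame_ext f g : (forall s, D s -> f s = g s) -> tame f -> tame g.
Proof.
move=> fg [L L0 [Lb Ll]]; exists L => //; split => [s Ds|s t Ds Dt].
  by rewrite -fg//; exact: Lb.
by rewrite -!fg//; exact: Ll.
Qed.

Lemma tame_cst (c : R) : tame (fun=> c).
Proof.
exists `|c| => //; split => // s t _ _.
by rewrite subrr normr0 mulr_ge0.
Qed.

Lemma tameD f g : tame f -> tame g -> tame (fun s => f s + g s).
Proof.
move=> [L L0 [Lb Ll]] [K K0 [Kb Kl]]; exists (L + K); first exact: addr_ge0.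
split => [s Ds|s t Ds Dt].
  by apply: le_trans (ler_normD _ _) _; apply: lerD; [exact: Lb|exact: Kb].
rewrite opprD addrACA mulrDl; apply: le_trans (ler_normD _ _) _.
by apply: lerD; [exact: Ll|exact: Kl].
Qed.

Lemma tameM f g : tame f -> tame g -> tame (fun s => f s * g s).
Proof.
move=> [L L0 [Lb Ll]] [K K0 [Kb Kl]]; exists (2 * (L * K)).
  by rewrite mulr_ge0// mulr_ge0.
split => [s Ds|s t Ds Dt].
  rewrite normrM (@le_trans _ _ (L * K))//.
    by apply: ler_pM => //; [exact: Lb|exact: Kb].
  by have := mulr_ge0 L0 K0; lra.
have -> : f s * g s - f t * g t = (f s - f t) * g s + f t * (g s - g t) by ring.
apply: le_trans (ler_normD _ _) _; rewrite !normrM.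
have -> : 2 * (L * K) * w s t = L * w s t * K + L * (K * w s t) by ring.
by apply: lerD; apply: ler_pM => //; [exact: Ll|exact: Kb|exact: Lb|exact: Kl].
Qed.

Lemma tameN f : tame f -> tame (fun s => - f s).
Proof.
move=> tf; apply: tame_ext (tameM (tame_cst (-1)) tf) => s _.
by rewrite mulN1r.
Qed.

Lemma tameB f g : tame f -> tame g -> tame (fun s => f s - g s).
Proof. by move=> tf tg; apply: tameD => //; exact: tameN. Qed.

Lemma tame_sum (J : Type) (r : seq J) (p : pred J) (F : J -> I -> R) :
  (forall j, tame (F j)) -> tame (fun s => \sum_(j <- r | p j) F j s).
Proof.
move=> tF; elim: r => [|j r IH].
  by apply: tame_ext (tame_cst 0) => s _; rewrite big_nil.
apply: tame_ext (tameD (f := fun s => if p j then F j s else 0) _ IH) => [s _|].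
  by rewrite big_cons; case: ifP; rewrite ?add0r.
by case: (p j); [exact: tF|exact: tame_cst].
Qed.

Lemma tame_prod (J : Type) (r : seq J) (F : J -> I -> R) :
  (forall j, tame (F j)) -> tame (fun s => \prod_(j <- r) F j s).
Proof.
move=> tF; elim: r => [|j r IH].
  by apply: tame_ext (tame_cst 1) => s _; rewrite big_nil.
by apply: tame_ext (tameM (tF j) IH) => s _; rewrite big_cons.
Qed.

Lemma tame_inv f (c : R) : 0 < c -> (forall s, D s -> c <= `|f s|) -> tame f ->
  tame (fun s => (f s)^-1).
Proof.
move=> c0 cf [L L0 [Lb Ll]]; exists (c^-1 + c^-1 ^+ 2 * L).
  by rewrite addr_ge0 ?invr_ge0 ?mulr_ge0 ?exprn_ge0 ?invr_ge0// ltW.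
have fi s : D s -> `|(f s)^-1| <= c^-1.
  by move=> Ds; rewrite normfV lef_pV2 ?posrE ?cf//; exact: lt_le_trans c0 (cf s Ds).
have f0 s : D s -> f s != 0.
  by move=> Ds; rewrite -normr_gt0; exact: lt_le_trans c0 (cf s Ds).
split => [s Ds|s t Ds Dt].
  by rewrite (le_trans (fi s Ds))// lerDl mulr_ge0// exprn_ge0// invr_ge0 ltW.
have -> : (f s)^-1 - (f t)^-1 = (f s)^-1 * (f t)^-1 * (f t - f s).
  by field; rewrite !f0.
rewrite mulrDl (@le_trans _ _ (c^-1 ^+ 2 * L * w s t))//; last first.
  by rewrite lerDr mulr_ge0// invr_ge0 ltW.
rewrite normrM expr2 -(mulrA _ L); apply: ler_pM => //.
  by rewrite normrM; apply: ler_pM => //; exact: fi.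
by rewrite distrC; exact: Ll.
Qed.

Lemma tame_unif (J : finType) (F : J -> I -> R) : (forall j, tame (F j)) ->
  exists2 L : R, 0 <= L & forall j, (forall s, D s -> `|F j s| <= L) /\
  forall s t, D s -> D t -> `|F j s - F j t| <= L * w s t.
Proof.
move=> tF.
have : forall j, exists L : R, 0 <= L /\ ((forall s, D s -> `|F j s| <= L) /\
  forall s t, D s -> D t -> `|F j s - F j t| <= L * w s t).
  by move=> j; have [L L0 H] := tF j; exists L.
move=> /choice[L HL]; exists (\sum_j L j).
  by apply: sumr_ge0 => j _; have [] := HL j.
move=> j; have [L0 [Lb Ll]] := HL j.
have LS : L j <= \sum_j L j.
  by rewrite (bigD1 j)//= lerDl; apply: sumr_ge0 => i _; have [] := HL i.
split => [s Ds|s t Ds Dt]; first exact: le_trans (Lb s Ds) LS.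
by apply: le_trans (Ll s t Ds Dt) _; exact: ler_wpM2r.
Qed.

(** The Leibniz formula is a polynomial in the entries, so the regularity of Cramer's rule needs no
    operator norms. *)
Lemma tame_det n (A : I -> 'M[R]_n) : (forall i j, tame (fun s => A s i j)) ->
  tame (fun s => \det (A s)).
Proof.
move=> tA; apply: tame_sum => p; apply: tameM; first exact: tame_cst.
by apply: tame_prod => i; exact: tA.
Qed.

Lemma tame_cofactor n (A : I -> 'M[R]_n) i j : (forall i j, tame (fun s => A s i j)) ->
  tame (fun s => cofactor (A s) i j).
Proof.
move=> tA; apply: tameM; first exact: tame_cst.
apply: tame_det => i' j'; apply: tame_ext (tA (lift i i') (lift j j')) => s _.
by rewrite !mxE.
Qed.

End tame_functions.

(** * The Poisson equation of an irreducible chain *)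

Section poisson_equation.
Context (R : realType) (Z : finType).

Definition stochastic (K : Z -> Z -> R) :=
  (forall z z', 0 <= K z z') /\ forall z, \sum_z' K z z' = 1.

Lemma nstep_stochastic K k : stochastic K -> stochastic (nstep K k).
Proof.
move=> [K0 K1]; elim: k => [|k [IH0 IH1]].
  split => [z z'|z]; first by rewrite /= ler0n.
  rewrite /= (bigD1 z)//= eqxx big1 ?addr0// => z' /negbTE.
  by rewrite eq_sym => ->.
split => [z z'|z] /=; first by apply: sumr_ge0 => u _; exact: mulr_ge0.
rewrite exchange_big/= -[RHS](K1 z); apply: eq_bigr => u _.
by rewrite -mulr_sumr IH1 mulr1.
Qed.

(* A maximum of h is attained at every state reachable from a maximizer. *)
Lemma irreducible_harmonic_const (K : Z -> Z -> R) (h : Z -> R) : stochastic K ->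
  irreducible_chain K -> (forall z, h z = \sum_z' K z z' * h z') ->
  forall z z', h z = h z'.
Proof.
move=> sK iK hK.
have hn k z : h z = \sum_z' nstep K k z z' * h z'.
  elim: k z => [|k IH] z /=.
    rewrite (bigD1 z)//= eqxx mul1r big1 ?addr0// => z' /negbTE.
    by rewrite eq_sym => ->; rewrite mul0r.
  rewrite hK; under [RHS]eq_bigr do rewrite mulr_suml.
  rewrite exchange_big/=; apply: eq_bigr => u _.
  by rewrite [in LHS]IH mulr_sumr; apply: eq_bigr => z' _; rewrite mulrA.
suff H z0 : (forall z, h z <= h z0) -> forall z, h z = h z0.
  move=> z z'; have [z0 hz0] : exists z0, forall z, h z <= h z0.
    case: (@Order.TotalTheory.arg_maxP _ _ _ z xpredT h isT) => z0 _ z0max.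
    by exists z0 => y; exact: z0max.
  by rewrite (H z0 hz0 z) (H z0 hz0 z').
move=> z0max z; have [k kz] := iK z0 z.
have [n0 n1] := nstep_stochastic k sK.
have : \sum_z' nstep K k z0 z' * (h z0 - h z') = 0.
  under eq_bigr do rewrite mulrBr.
  by rewrite sumrB -mulr_suml n1 mul1r -hn subrr.
move/eqP; rewrite psumr_eq0 => [|z' _]; last by rewrite mulr_ge0// subr_ge0.
move/allP => /(_ z); rewrite mem_index_enum => /(_ isT) /=.
by rewrite mulf_eq0 (gt_eqF kz)/= subr_eq0 => /eqP.
Qed.

(* I - K + 1 m^T, invertible although I - K is not. *)
Definition poisson_mx (K : Z -> Z -> R) (m : Z -> R) : 'M[R]_#|Z| :=
  \matrix_(i, j) ((i == j)%:R - K (enum_val i) (enum_val j) + m (enum_val j)).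

Lemma sum_enum_val (F : Z -> R) : \sum_(i < #|Z|) F (enum_val i) = \sum_z F z.
Proof.
by rewrite (reindex (@enum_rank Z))//=; [apply: eq_bigr => z _; rewrite enum_rankK
  |exists enum_val => z _; [exact: enum_rankK|exact: enum_valK]].
Qed.

Lemma poisson_mxE K m (v : Z -> R) i :
  \sum_j poisson_mx K m i j * v (enum_val j) =
  v (enum_val i) - \sum_z K (enum_val i) z * v z + \sum_z m z * v z.
Proof.
rewrite -(sum_enum_val (fun z => K (enum_val i) z * v z)).
rewrite -(sum_enum_val (fun z => m z * v z)).
have -> : v (enum_val i) = \sum_j (i == j)%:R * v (enum_val j).
  rewrite (bigD1 i)//= eqxx mul1r big1 ?addr0// => j /negbTE.
  by rewrite eq_sym => ->; rewrite mul0r.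
rewrite -sumrB -big_split/=; apply: eq_bigr => j _.
by rewrite mxE; ring.
Qed.

(** A null vector satisfies h - Kh + <m,h> = 0. Pairing with the stationary m leaves <m,h> = 0, so h
    is harmonic, hence constant by irreducibility, and the constant equals <m,h> = 0. *)
Lemma poisson_mx_unit K m : stochastic K -> irreducible_chain K ->
  stationary K m -> \det (poisson_mx K m) != 0.
Proof.
(* [det0P] yields a row vector killed from the left; transposing first makes it a column null vector
   of the matrix itself. *)
move=> sK iK [[m0 m1] mK]; apply/negP => /eqP; rewrite -det_tr => /eqP /det0P[v v0].
move=> /matrixP vA.
pose h (z : Z) : R := v 0 (enum_rank z).
have hA (i : 'I_#|Z|) : h (enum_val i) - \sum_z K (enum_val i) z * h z + \sum_z m z * h z = 0.
  rewrite -(poisson_mxE K m h i); have := vA 0 i; rewrite !mxE => E.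
  by rewrite -[RHS]E; apply: eq_bigr => j _; rewrite [_^T _ _]mxE /h enum_valK mulrC.
have {}hA z : h z - \sum_z' K z z' * h z' + \sum_z m z * h z = 0.
  by have := hA (enum_rank z); rewrite enum_rankK.
have mh : \sum_z m z * h z = 0.
  have : \sum_z m z * (h z - \sum_z' K z z' * h z' + \sum_z m z * h z) = 0.
    by apply: big1 => z _; rewrite hA mulr0.
  under eq_bigr do rewrite mulrDr mulrBr.
  rewrite big_split/= sumrB -mulr_suml m1 mul1r.
  have -> : \sum_i m i * (\sum_z' K i z' * h z') = \sum_z m z * h z.
    under eq_bigr do rewrite mulr_sumr.
    rewrite exchange_big/=; apply: eq_bigr => z _.
    by rewrite -[in RHS]mK mulr_suml; apply: eq_bigr => u _; rewrite mulrA.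
  by rewrite subrr add0r.
have hc : forall z z', h z = h z'.
  apply: (irreducible_harmonic_const sK iK) => z; have := hA z.
  by rewrite mh addr0 => /eqP; rewrite subr_eq0 => /eqP.
move/eqP: v0; apply; apply/rowP => i; rewrite mxE.
have -> : v 0 i = h (enum_val i) by rewrite /h enum_valK.
rewrite -mh -[LHS]mul1r -m1 mulr_suml; apply: eq_bigr => z _.
by rewrite (hc (enum_val i) z).
Qed.

(** Cramer's rule for [poisson_mx] gives h - Kh + <m,h> = phi; pairing with m shows <m,h> = <m,phi>,
    which turns this into the Poisson equation. The lower bound on the determinant makes the
    division tame. *)
Lemma poisson_solution (I : Type) (D : I -> Prop) (w : I -> I -> R)
    (K : I -> Z -> Z -> R) (m phi : I -> Z -> R) (c : R) :
  (forall s t, 0 <= w s t) ->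
  (forall s, D s -> stochastic (K s)) ->
  (forall s, D s -> stationary (K s) (m s)) ->
  (forall z z', tame D w (fun s => K s z z')) ->
  (forall z, tame D w (fun s => m s z)) ->
  (forall z, tame D w (fun s => phi s z)) ->
  0 < c -> (forall s, D s -> c <= `|\det (poisson_mx (K s) (m s))|) ->
  exists2 h : I -> Z -> R, (forall z, tame D w (fun s => h s z)) &
   forall s z, D s ->
     h s z - \sum_z' K s z z' * h s z' = phi s z - \sum_z' m s z' * phi s z'.
Proof.
move=> w0 sK mK tK tm tphi c0 cdet.
pose A s := poisson_mx (K s) (m s).
have tA i j : tame D w (fun s => A s i j).
  apply: (tame_ext (f := fun s => (i == j)%:R - K s (enum_val i) (enum_val j) +
     m s (enum_val j))) => [s _|]; first by rewrite mxE.
  by apply: tameD => //; apply: tameB => //; exact: tame_cst.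
pose h s z := (\det (A s))^-1 *
   \sum_j cofactor (A s) j (enum_rank z) * phi s (enum_val j).
exists h => [z|s z Ds].
  apply: tameM => //; first by apply: (tame_inv w0 c0) => //; exact: tame_det.
  by apply: tame_sum => // j; apply: tameM => //; exact: tame_cofactor.
have det0 : \det (A s) != 0 by rewrite -normr_gt0; exact: lt_le_trans c0 (cdet s Ds).
have Ah i : \sum_j A s i j * h s (enum_val j) = phi s (enum_val i).
  have E : \sum_j A s i j * h s (enum_val j) =
      (\det (A s))^-1 * \sum_l (A s *m \adj (A s)) i l * phi s (enum_val l).
    rewrite /h mulr_sumr.
    under eq_bigr do rewrite mulrCA mulr_sumr mulr_sumr.
    rewrite exchange_big/=; apply: eq_bigr => l _.
    rewrite mxE mulr_suml mulr_sumr; apply: eq_bigr => j _.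
    by rewrite [\adj _ _ _]mxE enum_valK; ring.
  rewrite E mul_mx_adj (bigD1 i)//= big1 => [|l /negbTE li].
    by rewrite mxE eqxx mulr1n addr0 mulrA mulVf// mul1r.
  by rewrite mxE eq_sym li mul0r.
have {}Ah z' : h s z' - \sum_u K s z' u * h s u + \sum_u m s u * h s u = phi s z'.
  by have := Ah (enum_rank z'); rewrite poisson_mxE enum_rankK.
have [[m0 m1] mKs] := mK s Ds.
have mh : \sum_u m s u * h s u = \sum_z' m s z' * phi s z'.
  under [RHS]eq_bigr do rewrite -Ah mulrDr mulrBr.
  rewrite big_split/= sumrB -mulr_suml m1 mul1r.
  have -> : \sum_i m s i * (\sum_u K s i u * h s u) = \sum_u m s u * h s u.
    under eq_bigr do rewrite mulr_sumr.
    rewrite exchange_big/=; apply: eq_bigr => u _.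
    by rewrite -[in RHS]mKs mulr_suml; apply: eq_bigr => v _; rewrite mulrA.
  by rewrite subrr add0r.
by rewrite -mh -Ah; ring.
Qed.

End poisson_equation.

Section tame_continuity.
Context (R : realType) (T : R).
Hypothesis (T0 : 0 <= T).
Local Notation D := (fun s : R => 0 <= s <= T).

Let inD s : `[0, T]%classic s <-> D s.
Proof. by rewrite /= in_itv. Qed.

(** First half of the bootstrap: the oscillations in the modulus tend to 0 because the [u j] are
    continuous. *)
Lemma tame_continuous (J : finType) (u : J -> R -> R) (f : R -> R) :
  (forall j, {within `[0, T], continuous (u j)}) ->
  tame D (fun s t => `|s - t| + \sum_j `|u j s - u j t|) f ->
  {within `[0, T], continuous f}.
Proof.
move=> cu [L L0 [_ Lf]]; apply/subspace_continuousP => x Dx.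
apply/cvgrPdist_lt => e e0.
(* The added 1 keeps c positive when L = 0. *)
pose c := L * (1 + #|J|%:R) + 1.
have c0 : 0 < c by rewrite ltr_wpDl// mulr_ge0// addr_ge0.
pose e' := e / c; have e'0 : 0 < e' by exact: divr_gt0.
have near1 : \forall y \near within `[0, T] (nbhs x), forall j, `|u j x - u j y| < e'.
  apply: filter_forall => j.
  have /subspace_continuousP/(_ x Dx)/cvgrPdist_lt := cu j; exact.
have near2 : \forall y \near within `[0, T] (nbhs x), `|x - y| < e'.
  by apply: cvg_within; exact: (nbhsx_ballx x e' e'0).
have near3 : \forall y \near within `[0, T] (nbhs x), `[0, T]%classic y.
  exact: withinT.
near=> y.
have Dy : `[0, T]%classic y by near: y.
apply: le_lt_trans (Lf x y _ _) _; [exact/inD|exact/inD|].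
apply: (@le_lt_trans _ _ (L * (e' + \sum_(j : J) e'))).
  apply: ler_wpM2l => //; apply: lerD.
    by apply: ltW; near: y.
  apply: ler_sum => j _; apply: ltW; move: j; near: y; exact: near1.
rewrite sumr_const -mulr_natl.
have -> : L * (e' + #|J|%:R * e') = e' * (L * (1 + #|J|%:R)) by ring.
by rewrite -[ltRHS](divfK (lt0r_neq0 c0)) ltr_pM2l// /c ltrDl.
Unshelve. all: end_near. Qed.

Lemma continuous_bounded_itv (u : R -> R) : {within `[0, T], continuous u} ->
  exists2 L : R, 0 <= L & forall s, D s -> `|u s| <= L.
Proof.
move=> cu.
have [a _ au] := EVT_max T0 cu; have [b _ bu] := EVT_min T0 cu.
exists (`|u a| + `|u b|) => [|s Ds]; first exact: addr_ge0.
have sD : s \in `[0, T] by rewrite in_itv.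
have := au s sD; have := bu s sD.
have := ler_norm (u a); have := ler_norm (- u b); rewrite normrN.
have := normr_ge0 (u a); have := normr_ge0 (u b).
by move=> *; rewrite ler_norml; apply/andP; split; lra.
Qed.

Lemma continuous_lower_bound (f : R -> R) : {within `[0, T], continuous f} ->
  (forall s, D s -> f s != 0) ->
  exists2 c : R, 0 < c & forall s, D s -> c <= `|f s|.
Proof.
move=> cf f0.
have cnf : {within `[0, T], continuous (fun s => `|f s|)}.
  by move=> x; apply: cvg_norm; exact: cf.
have [c cT cm] := EVT_min T0 cnf; exists `|f c|.
  by rewrite normr_gt0; apply: f0; move: cT; rewrite in_itv.
by move=> s Ds; apply: cm; rewrite in_itv.
Qed.

(** Serves twice: c = 0 makes the integral Lipschitz, and c = F s gives its first-order
    expansion. *)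
Lemma Rintegral_increment (F : R -> R) (c B s t : R) :
  {within `[0, T], continuous F} -> 0 <= s -> s <= t -> t <= T ->
  (forall v, s <= v <= t -> `|F v - c| <= B) ->
  `|\int[lebesgue_measure]_(v in `[0, t]) F v - \int[lebesgue_measure]_(v in `[0, s]) F v
    - (t - s) * c| <= B * (t - s).
Proof.
move=> cF s0 st tT FB.
have sub (a b : R) : 0 <= a -> b <= T -> `[a, b] `<=` `[0, T].
  by move=> a0 bT v /=; rewrite !in_itv/= => /andP[av vb]; apply/andP; split; lra.
have iF (a b : R) : 0 <= a -> b <= T ->
    lebesgue_measure.-integrable `[a, b] (EFin \o F).
  move=> a0 bT; apply: continuous_compact_integrable; first exact: segment_compact.
  by apply: continuous_subspaceW cF; exact: sub.
have ioc : lebesgue_measure.-integrable `]s, t] (EFin \o F).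
  apply: integrableS (iF s t s0 tT) => //; exact: subset_itv_oc_cc.
have mu_st : fine (lebesgue_measure `]s, t]%classic) = t - s :> R.
  by rewrite lebesgue_measure_itv/= lte_fin; move: st;
    rewrite le_eqVlt => /predU1P[->|->//]; rewrite ltxx subrr.
have ic (x : R) : lebesgue_measure.-integrable `]s, t] (EFin \o (fun=> x : R)).
  apply: measurable_bounded_integrable => //.
    by rewrite /= lebesgue_measure_itv/= lte_fin; case: ifP => //; rewrite ltry.
  by exists `|x|; split; [exact: num_real|move=> M xM v _ /=; exact: ltW].
rewrite Rintegral_itvB//; [|exact: iF].
have iB : lebesgue_measure.-integrable `]s, t] (EFin \o (fun v => F v - c)).
  have : lebesgue_measure.-integrable `]s, t]
      ((EFin \o F) \- (EFin \o (fun=> c)))%E by exact: integrableB.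
  by apply: eq_integrable => // v _; rewrite /= EFinB.
have -> : (t - s) * c = \int[lebesgue_measure]_(v in `]s, t]) c.
  by rewrite Rintegral_cst// mu_st mulrC.
rewrite -RintegralB//.
apply: le_trans (le_normr_Rintegral _ iB) _ => //.
have -> : B * (t - s) = \int[lebesgue_measure]_(v in `]s, t]) B.
  by rewrite Rintegral_cst// mu_st.
apply: le_Rintegral => //.
  exact: (integrable_norm iB).
move=> v /=; rewrite in_itv/= => /andP[sv vt]; apply: FB.
by rewrite ltW.
Qed.

End tame_continuity.

(** * Regularity of the limit *)

Section limit_regularity.
Context (R : realType) (dx da : nat) (M : mdp R dx da).
Local Notation X := (stX M).
Local Notation A := (acA M).
Local Notation Z := (X * A)%type.
Context (statd statd_aux : (Z -> R) -> Z -> R).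
Hypothesis (hM : standing_assumption statd statd_aux).
Context (alpha : R).
Context (Bv Bu : Z -> Z -> R) (Q P : R -> Z -> R) (T : R).
Hypothesis (T0 : 0 <= T).
Local Notation D := (fun s : R => 0 <= s <= T).

Definition driftC (z : Z) (s : R) : R :=
  \sum_z' statd (limg P s) z' * phiC alpha Q P Bv z s z'.
Definition driftA (z : Z) (s : R) : R :=
  \sum_z' statd_aux (limg P s) z' * phiA Q P Bu z s z'.

(** The exploration term supplies the strict positivity that the standing assumption asks for. *)
Lemma explore_pos (e : R) (h : Z -> R) : 0 < e <= 1 -> pos_policy (explore e (softmax h)).
Proof.
move=> /andP[e0 e1]; have [[x0 a0]] := mdp_inhabited M.
have A0 : 0 < #|{: A}|%:R :> R by rewrite ltr0n; apply/card_gt0P; exists a0.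
have g0 z : 0 < explore e (softmax h) z.
  rewrite /explore ltr_pwDl ?divr_gt0// mulr_ge0 ?subr_ge0//.
  exact/ltW/softmax_gt0.
have g1 x : \sum_(a : A) explore e (softmax h) (x, a) = 1.
  rewrite big_split/= sumr_const -mulr_sumr softmax_sum.
  have An0 : #|{: A}|%:R != 0 :> R by rewrite gt_eqF.
  rewrite -[X in X + _]mulr_natr divfK//; ring.
split=> //; split=> // z; rewrite ltW//=.
by apply: sum1_le1 => // z'; exact: ltW.
Qed.

Lemma limg_pos s : pos_policy (limg P s).
Proof. by apply: explore_pos; exact: eta01. Qed.

Lemma chain_stochastic (q : Z -> X -> R) g : (forall z x, 0 <= q z x) ->
  (forall z, \sum_x q z x = 1) -> is_policy g -> stochastic (chain q g).
Proof.
move=> q0 q1 [g01 g1]; split=> [z z'|z].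
  by rewrite mulr_ge0//; have /andP[] := g01 z'.
rewrite sumZ -[RHS](q1 z); apply: eq_bigr => x _.
by rewrite /chain /= -mulr_sumr g1 mulr1.
Qed.

Lemma chain_trans_stochastic g : is_policy g ->
  stochastic (chain (@trans _ _ _ M) g).
Proof. by apply: chain_stochastic => z; have [] := trans_distr z. Qed.

Lemma chain_aux_stochastic g : is_policy g ->
  stochastic (chain (@trans_aux _ _ _ M) g).
Proof.
apply: chain_stochastic => [z x|z]; first by have /andP[] := trans_aux01 z x.
rewrite big_split/= -!mulr_sumr; have [_ ->] := trans_distr z.
rewrite -(sumZ (rho0 (m := M))).
have [_ ->] := rho0_distr M; ring.
Qed.

Section modulus.
Context (w : R -> R -> R).
Hypotheses (w0 : forall s t, 0 <= w s t) (wd : forall s t, `|s - t| <= w s t)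
  (tQ : forall z, tame D w (fun s => Q s z)) (tP : forall z, tame D w (fun s => P s z)).

Lemma tame_id : tame D w (fun s => s).
Proof.
exists (T + 1); first by rewrite addr_ge0.
split=> [s /andP[s0 sT]|s t _ _]; first by rewrite ger0_norm//; lra.
by apply: le_trans (wd s t) _; apply: ler_peMl; [|rewrite lerDr].
Qed.

(** For 0 <= s <= t, ln((1+t)/(1+s)) <= (t-s)/(1+s) <= t-s; the exploration rate inherits the
    Lipschitz bound. *)
Lemma tame_ln1D : tame D w (fun s => ln (1 + s)).
Proof.
have H (s t : R) : 0 <= s -> s <= t -> 0 <= ln (1 + t) - ln (1 + s) <= t - s.
  move=> s0 st; have ps : 0 < 1 + s by lra.
  have pt : 0 < 1 + t by lra.
  rewrite -ln_div ?posrE//.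
  have -> : (1 + t) / (1 + s) = 1 + (t - s) / (1 + s) by field; rewrite gt_eqF.
  have h0 : 0 <= (t - s) / (1 + s) by rewrite divr_ge0 ?subr_ge0// ltW.
  rewrite ln_ge0 ?lerDl//=; apply: le_trans (le_ln1Dx _) _; first by lra.
  by rewrite ler_pdivrMr// ler_peMr ?subr_ge0// lerDl.
exists (T + 1); first by rewrite addr_ge0.
split=> [s /andP[s0 sT]|s t /andP[s0 sT] /andP[t0 tT]].
  have := H 0 s (lexx 0) s0; rewrite addr0 ln1 !subr0 => /andP[l0 ls].
  by rewrite ger0_norm//; lra.
apply: (@le_trans _ _ `|s - t|); last first.
  by apply: le_trans (wd s t) _; apply: ler_peMl; [|rewrite lerDr].
case: (leP s t) => st.
  have /andP[l0 ls] := H s t s0 st.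
  by rewrite distrC (distrC s) (ger0_norm l0) ger0_norm ?subr_ge0.
have ts := ltW st; have /andP[l0 ls] := H t s t0 ts.
by rewrite (ger0_norm l0) ger0_norm ?subr_ge0.
Qed.

Lemma tame_eta : tame D w (fun s => eta s).
Proof.
apply: (tame_inv w0 (c := 1)) => //.
  by move=> s _; rewrite ger0_norm ?lerDl ?sqr_ge0// addr_ge0// sqr_ge0.
apply: tameD; first exact: tame_cst.
by apply: (tame_ext (f := fun s => ln (1 + s) * ln (1 + s))) => //;
  apply: tameM => //; exact: tame_ln1D.
Qed.

Lemma tame_zeta : tame D w (fun s => zeta s).
Proof.
apply: (tame_inv w0 (c := 1)) => //.
  by move=> s /andP[s0 _]; rewrite ger0_norm ?lerDl// addr_ge0.
by apply: tameD; [exact: tame_cst|exact: tame_id].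
Qed.

Lemma tame_limf z : tame D w (fun s => limf P s z).
Proof.
have [L L0 HL] := tame_unif w0 tP.
exists (1 + 2 * L); first by rewrite addr_ge0// mulr_ge0.
split=> [s Ds|s t Ds Dt].
  rewrite ger0_norm; last exact/ltW/softmax_gt0.
  by rewrite (le_trans (softmax_le1 _ _))// lerDl mulr_ge0.
apply: le_trans (softmax_lip (d := L * w s t) _ _) _ => [z'|].
  by have [_] := HL z'; apply.
have := mulr_ge0 L0 (w0 s t); have := w0 s t; lra.
Qed.

Lemma tame_limg z : tame D w (fun s => limg P s z).
Proof.
apply: tameD; first by apply: tameM => //; [exact: tame_eta|exact: tame_cst].
apply: tameM => //; last exact: tame_limf.
by apply: tameB => //; [exact: tame_cst|exact: tame_eta].
Qed.

(** The total-variation hypothesis transfers the modulus of the policy to its stationary law; the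
    factors 1/2 in [dTV] cancel, and one coordinate is bounded by the full sum. *)
Let tame_stat (st : (Z -> R) -> Z -> R) (L : R) z : 0 <= L ->
  (forall s, is_distr (st (limg P s))) ->
  (forall s t, dTV (st (limg P s)) (st (limg P t)) <= L * dTV (limg P s) (limg P t)) ->
  tame D w (fun s => st (limg P s) z).
Proof.
move=> L0 sd sl; have [Lg Lg0 HL] := tame_unif w0 tame_limg.
exists (1 + L * (#|{: Z}|%:R * Lg)).
  by rewrite addr_ge0// mulr_ge0// mulr_ge0.
split=> [s Ds|s t Ds Dt].
  have [st0 st1] := sd s; rewrite ger0_norm//.
  apply: (@le_trans _ _ 1); last by rewrite lerDl mulr_ge0// mulr_ge0.
  by rewrite -st1 (bigD1 z)//= lerDl; apply: sumr_ge0.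
have h1 : `|st (limg P s) z - st (limg P t) z| <=
    \sum_z' `|st (limg P s) z' - st (limg P t) z'|.
  by rewrite (bigD1 z)//= lerDl; apply: sumr_ge0.
apply: le_trans h1 _.
have h2 : \sum_z' `|limg P s z' - limg P t z'| <= #|{: Z}|%:R * Lg * w s t.
  rewrite -mulrA mulr_natl -sumr_const; apply: ler_sum => z' _.
  by have [_] := HL z'; apply.
have := sl s t; rewrite /dTV mulrCA ler_pM2l ?invr_gt0// => h3.
apply: le_trans h3 _; apply: le_trans (ler_wpM2l L0 h2) _.
have := w0 s t; lra.
Qed.

Lemma tame_statd z : tame D w (fun s => statd (limg P s) z).
Proof.
have [erg [L L0 HL]] := hM; apply: (tame_stat (L := L)) => [|s|s t].
- exact: ltW.
- by have [[_ []]] := erg _ (limg_pos s).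
- by apply: le_trans (HL _ _ (limg_pos s) (limg_pos t)); rewrite le_max lexx.
Qed.

Lemma tame_statd_aux z : tame D w (fun s => statd_aux (limg P s) z).
Proof.
have [erg [L L0 HL]] := hM; apply: (tame_stat (L := L)) => [|s|s t].
- exact: ltW.
- by have [_ [_ []]] := erg _ (limg_pos s).
- by apply: le_trans (HL _ _ (limg_pos s) (limg_pos t)); rewrite le_max lexx orbT.
Qed.

Lemma tame_chain (q : Z -> X -> R) z z' :
  tame D w (fun s => chain q (limg P s) z z').
Proof. by apply: tameM => //; [exact: tame_cst|exact: tame_limg]. Qed.

Lemma tame_phiC z z' : tame D w (fun s => phiC alpha Q P Bv z s z').
Proof.
apply: tameM => //; last exact: tame_cst.
apply: tameM => //; first exact: tame_cst.
apply: tameB => //; apply: tameD; first exact: tame_cst.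
apply: tameM => //; first exact: tame_cst.
by apply: tame_sum => // z''; apply: tameM => //; exact: tame_chain.
Qed.

Lemma tame_phiA z z' : tame D w (fun s => phiA Q P Bu z s z').
Proof.
apply: tameM => //; first by apply: tameM => //; exact: tame_zeta.
apply: tameB => //; first exact: tame_cst.
by apply: tame_sum => // a; apply: tameM => //; [exact: tame_limf|exact: tame_cst].
Qed.

Lemma tame_driftC z : tame D w (driftC z).
Proof.
apply: tame_sum => // z'; apply: tameM => //; first exact: tame_statd.
exact: tame_phiC.
Qed.

Lemma tame_driftA z : tame D w (driftA z).
Proof.
apply: tame_sum => // z'; apply: tameM => //; first exact: tame_statd_aux.
exact: tame_phiA.
Qed.

End modulus.

Let lin (s t : R) := `|s - t|.
Let lin0 s t : 0 <= lin s t. Proof. exact: normr_ge0. Qed.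

Lemma tame_lin_continuous (f : R -> R) : tame D lin f ->
  {within `[0, T], continuous f}.
Proof.
move=> tf; apply: (tame_continuous (J := void) (u := fun _ => id)) => [[]|].
have [L L0 [Lb Ll]] := tf; exists L => //; split=> // s t Ds Dt.
apply: le_trans (Ll s t Ds Dt) _; apply: ler_wpM2l => //.
by rewrite lerDl; apply: sumr_ge0.
Qed.

(** The determinant is continuous and never zero, so compactness of [0,T] gives the lower bound that
    [poisson_solution] needs. *)
Lemma poisson_tame (K : R -> Z -> Z -> R) (m phi : R -> Z -> R) :
  (forall s, stochastic (K s)) -> (forall s, irreducible_chain (K s)) ->
  (forall s, stationary (K s) (m s)) ->
  (forall z z', tame D lin (fun s => K s z z')) ->
  (forall z, tame D lin (fun s => m s z)) ->
  (forall z, tame D lin (fun s => phi s z)) ->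
  exists2 h : R -> Z -> R, (forall z, tame D lin (fun s => h s z)) &
   forall s z, D s ->
     \sum_z' m s z' * phi s z' = phi s z - h s z + \sum_z' K s z z' * h s z'.
Proof.
move=> sK iK mK tK tm tphi.
have cdet : {within `[0, T], continuous (fun s => \det (poisson_mx (K s) (m s)))}.
  apply: tame_lin_continuous; apply: tame_det => // i j.
  apply: (tame_ext (f := fun s => (i == j)%:R - K s (enum_val i) (enum_val j) +
     m s (enum_val j))) => [s _|]; first by rewrite mxE.
  by apply: tameD => //; apply: tameB => //; exact: tame_cst.
have [c c0 cd] := continuous_lower_bound T0 cdet
  (fun s _ => poisson_mx_unit (sK s) (iK s) (mK s)).
have [h th hP] := poisson_solution lin0 (fun s _ => sK s) (fun s _ => mK s)
  tK tm tphi c0 cd.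
by exists h => // s z Ds; have := hP s z Ds; lra.
Qed.

End limit_regularity.

Section limit_facts_existence.
Context (R : realType) (dx da : nat) (M : mdp R dx da).
Local Notation X := (stX M).
Local Notation A := (acA M).
Local Notation Z := (X * A)%type.
Context (statd statd_aux : (Z -> R) -> Z -> R).
Hypothesis (hM : standing_assumption statd statd_aux).
Context (alpha : R) (sigma : R -> R) (v0 mu0 : probability (R * 'rV[R]_(dx + da))%type R).
Hypothesis (halpha : 0 < alpha).
Context (Q P : R -> Z -> R) (T : R).
Hypothesis (hlim : limit_system statd statd_aux alpha sigma v0 mu0 Q P) (T0 : 0 <= T).
Local Notation D := (fun s : R => 0 <= s <= T).
Local Notation Bv := (Bmean sigma v0).
Local Notation Bu := (Bmean sigma mu0).
Local Notation dC := (driftC statd alpha Bv Q P).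
Local Notation dA := (driftA statd_aux Bu Q P).

Lemma sum_chain_policy (q : Z -> X -> R) g z : stochastic (chain q g) ->
  \sum_z' chain q g z z' = 1.
Proof. by case. Qed.

(** The next pair is averaged out because rows of the chain sum to 1. The drift contains alpha while
    the given integrand does not, hence the form a times the integral of a^-1 F, shared with the
    actor at a = 1. *)
Lemma limit_QE t z : 0 <= t ->
  Q t z = alpha * \int[lebesgue_measure]_(s in `[0, t]) (alpha^-1 * dC z s).
Proof.
move=> t0; have [_ _ QE _] := hlim; rewrite QE//; congr (_ * _).
apply: eq_Rintegral => s _.
have a0 : alpha != 0 by rewrite gt_eqF.
rewrite /driftC mulr_sumr; apply: eq_bigr => z' _.
have [pg _] := limg_pos P s.
have S1 := sum_chain_policy z' (chain_trans_stochastic pg).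
have -> : \sum_z'' (reward z' + gam M * Q s z'' - Q s z') * Bv z z' *
    statd (explore (eta s) (softmax (P s))) z' *
    explore (eta s) (softmax (P s)) z'' * trans z' z''.1 =
  Bv z z' * statd (limg P s) z' * \sum_z'' (chain (@trans _ _ _ M) (limg P s) z' z'' *
    (reward z' - Q s z') + gam M * (chain (@trans _ _ _ M) (limg P s) z' z'' * Q s z'')).
  rewrite mulr_sumr; apply: eq_bigr => z'' _.
  by rewrite /chain /limg /limf; ring.
rewrite big_split/= -mulr_suml S1 -mulr_sumr /phiC.
by field.
Qed.

Lemma limit_PE t z : 0 <= t ->
  P t z = 1 * \int[lebesgue_measure]_(s in `[0, t]) dA z s.
Proof.
move=> t0; have [_ _ _ PE] := hlim; rewrite PE// mul1r.
apply: eq_Rintegral => s _; apply: eq_bigr => z' _.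
rewrite /phiA -[Bu z z' in RHS]mulr1 -(softmax_sum (P s) z'.1) mulr_sumr -sumrB.
rewrite !mulr_sumr; apply: eq_bigr => a _.
by rewrite /limg /limf; ring.
Qed.

Lemma limit_increment (u F : R -> R) (a c B s t : R) : a != 0 ->
  {within `[0, T], continuous F} ->
  (forall t, 0 <= t -> u t = a * \int[lebesgue_measure]_(s in `[0, t]) (a^-1 * F s)) ->
  0 <= s -> s <= t -> t <= T ->
  (forall v, s <= v <= t -> `|F v - c| <= B) ->
  `|u t - u s - (t - s) * c| <= B * (t - s).
Proof.
move=> a0 cF uE s0 st tT FB.
have na : 0 < `|a^-1| by rewrite normr_gt0 invr_eq0.
have caF : {within `[0, T], continuous (fun v => a^-1 * F v)}.
  by move=> x; apply: cvgM; [exact: cvg_cst|exact: cF].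
have H := Rintegral_increment (c := a^-1 * c) (B := `|a^-1| * B) caF s0 st tT.
rewrite !uE//; last exact: le_trans st.
rewrite -mulrBr (_ : (t - s) * c = a * ((t - s) * (a^-1 * c))); last by field.
rewrite -mulrBr normrM.
apply: (@le_trans _ _ (`|a| * (`|a^-1| * B * (t - s)))); last first.
  by rewrite !mulrA -normrM divff// normr1 mul1r.
apply: ler_wpM2l => //; apply: H => v vst.
by rewrite -mulrBr normrM ler_pM2l//; exact: FB.
Qed.

Let lin (s t : R) : R := `|s - t|.
Let lin0 s t : 0 <= lin s t. Proof. exact: normr_ge0. Qed.

Let u (i : Z + Z) (s : R) : R := match i with inl z => Q s z | inr z => P s z end.

Let cu i : {within `[0, T], continuous (u i)}.
Proof.
have [cQ cP _ _] := hlim.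
have sub : (`[0, T] : set R) `<=` `[0, +oo[.
  by move=> x /=; rewrite !in_itv/= => /andP[-> _].
by case: i => z; apply: continuous_subspaceW sub _; [exact: cQ|exact: cP].
Qed.

Let w (s t : R) : R := `|s - t| + \sum_i `|u i s - u i t|.
Let w0 s t : 0 <= w s t. Proof. by rewrite addr_ge0// sumr_ge0. Qed.
Let wd s t : `|s - t| <= w s t. Proof. by rewrite lerDl sumr_ge0. Qed.

(** Holds by the choice of [w], which contains the oscillation of [u i] itself; the drifts, being
    built from the limits, are then tame for [w] too. *)
Let tame_u i : tame D w (u i).
Proof.
have [L L0 Lb] := continuous_bounded_itv T0 (cu (i := i)).
exists (L + 1); first by rewrite addr_ge0.
split=> [s Ds|s t Ds Dt]; first by rewrite (le_trans (Lb s Ds))// lerDl.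
apply: (@le_trans _ _ (w s t)); last by apply: ler_peMl; rewrite ?lerDr.
rewrite /w (bigD1 i)//= addrCA lerDl addr_ge0// sumr_ge0//.
Qed.

Let cdC z : {within `[0, T], continuous (dC z)}.
Proof.
apply: (tame_continuous cu); apply: (tame_driftC hM) => // z'.
- exact: (tame_u (inl z')).
- exact: (tame_u (inr z')).
Qed.

Let cdA z : {within `[0, T], continuous (dA z)}.
Proof.
apply: (tame_continuous cu); apply: (tame_driftA hM) => // z'.
- exact: (tame_u (inl z')).
- exact: (tame_u (inr z')).
Qed.

Let QE z t : 0 <= t ->
  Q t z = alpha * \int[lebesgue_measure]_(s in `[0, t]) (alpha^-1 * dC z s).
Proof. exact: limit_QE. Qed.

Let PE z t : 0 <= t ->
  P t z = 1 * \int[lebesgue_measure]_(s in `[0, t]) (1^-1 * dA z s).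
Proof.
move=> t0; rewrite limit_PE//; congr (_ * _); apply: eq_Rintegral => s _.
by rewrite invr1 mul1r.
Qed.

Let a0 : alpha != 0. Proof. by rewrite gt_eqF. Qed.

(** Second half of the bootstrap: the integral of a continuous, hence bounded, drift is Lipschitz,
    so the limits are tame for the modulus |s - t| alone. *)
Let lip_of_int (v F : R -> R) (a : R) : a != 0 -> {within `[0, T], continuous F} ->
  (forall t, 0 <= t -> v t = a * \int[lebesgue_measure]_(s in `[0, t]) (a^-1 * F s)) ->
  tame D lin v.
Proof.
move=> an0 cF vE.
have [L L0 Lb] := continuous_bounded_itv T0 cF.
have H s t : 0 <= s -> s <= t -> t <= T -> `|v t - v s| <= L * (t - s).
  move=> s0 st tT; have := limit_increment (c := 0) (B := L) an0 cF vE s0 st tT.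
  rewrite mulr0 subr0; apply => x /andP[sx xt]; rewrite subr0; apply: Lb.
  by rewrite (le_trans s0 sx) (le_trans xt tT).
have v00 : v 0 = 0 by rewrite vE// set_itv1 Rintegral_set1 mulr0.
exists (L * (T + 1)); first by rewrite mulr_ge0// addr_ge0.
split=> [s /andP[s0 sT]|s t /andP[s0 sT] /andP[t0 tT]].
  have := H 0 s (lexx _) s0 sT; rewrite v00 !subr0 => /le_trans; apply.
  by apply: ler_wpM2l => //; lra.
apply: (@le_trans _ _ (L * lin s t)); last first.
  apply: ler_wpM2r; first exact: lin0.
  by apply: ler_peMr => //; rewrite lerDr.
case: (leP s t) => st; rewrite /lin.
  by rewrite distrC (distrC s) (ger0_norm (_ : 0 <= t - s)) ?subr_ge0//; exact: H.
have ts := ltW st; rewrite (ger0_norm (_ : 0 <= s - t)) ?subr_ge0//; exact: H.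
Qed.

Lemma tame_limitQ z : tame D lin (fun s => Q s z).
Proof. exact: (lip_of_int a0 (cdC (z := z)) (QE z)). Qed.

Lemma tame_limitP z : tame D lin (fun s => P s z).
Proof. exact: (lip_of_int (oner_neq0 _) (cdA (z := z)) (PE z)). Qed.

Let wdl s t : `|s - t| <= lin s t. Proof. exact: lexx. Qed.

Lemma limit_facts_exist : exists Ld Bb hC hA,
  limit_facts alpha T Ld Bb Q P Bv Bu dC dA hC hA.
Proof.
have [erg _] := hM.
have tQ := tame_limitQ; have tP := tame_limitP.
have pg s : is_policy (limg P s) by have [] := limg_pos P s.
have hC z : exists h : R -> Z -> R, (forall z', tame D lin (fun s => h s z')) /\
   forall s z', D s -> dC z s = phiC alpha Q P Bv z s z' - h s z' +
      \sum_z'' chain (@trans _ _ _ M) (limg P s) z' z'' * h s z''.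
  have [|s|s|z1 z2|z1|z1|h th hP] := @poisson_tame R dx da M T T0
    (fun s => chain (@trans _ _ _ M) (limg P s)) (fun s => statd (limg P s))
    (fun s => phiC alpha Q P Bv z s).
  - by move=> s; exact: chain_trans_stochastic.
  - by have [[[]]] := erg _ (limg_pos P s).
  - by have [[]] := erg _ (limg_pos P s).
  - by apply: tame_chain.
  - by apply: (tame_statd hM).
  - by apply: tame_phiC.
  - by exists h.
have hA z : exists h : R -> Z -> R, (forall z', tame D lin (fun s => h s z')) /\
   forall s z', D s -> dA z s = phiA Q P Bu z s z' - h s z' +
      \sum_z'' chain (@trans_aux _ _ _ M) (limg P s) z' z'' * h s z''.
  have [|s|s|z1 z2|z1|z1|h th hP] := @poisson_tame R dx da M T T0
    (fun s => chain (@trans_aux _ _ _ M) (limg P s)) (fun s => statd_aux (limg P s))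
    (fun s => phiA Q P Bu z s).
  - by move=> s; exact: chain_aux_stochastic.
  - by have [_ [[]]] := erg _ (limg_pos P s).
  - by have [_ []] := erg _ (limg_pos P s).
  - by apply: tame_chain.
  - by apply: (tame_statd_aux hM).
  - by apply: tame_phiA.
  - by exists h.
have {hC} [hC HC] := choice hC; have {hA} [hA HA] := choice hA.
(* All functions to be controlled form one finite family, so that [tame_unif] returns a single
   constant. *)
pose all (i : (Z * Z + Z * Z) + (Z + Z) + (Z + Z)) (s : R) : R := match i with
  | inl (inl (inl (z, z'))) => hC z s z' | inl (inl (inr (z, z'))) => hA z s z'
  | inl (inr (inl z)) => Q s z | inl (inr (inr z)) => P s z
  | inr (inl z) => dC z s | inr (inr z) => dA z s end.
have tall i : tame D lin (all i).
  case: i => [[[[z z']|[z z']]|[z|z]]|[z|z]] /=.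
  - exact: (HC z).1.
  - exact: (HA z).1.
  - exact: tQ.
  - exact: tP.
  - by apply: (tame_driftC hM).
  - by apply: (tame_driftA hM).
have [L L0 HL] := tame_unif lin0 tall.
have Bb0 : 0 <= \sum_(z : Z) \sum_(z' : Z) (`|Bv z z'| + `|Bu z z'|).
  by apply: sumr_ge0 => z _; apply: sumr_ge0 => z' _; rewrite addr_ge0.
have Bb (z z' : Z) : `|Bv z z'| + `|Bu z z'| <= \sum_(z : Z) \sum_(z' : Z) (`|Bv z z'| + `|Bu z z'|).
  rewrite (bigD1 z)//= (bigD1 z')//= -addrA lerDl addr_ge0//.
    by apply: sumr_ge0 => *; rewrite addr_ge0.
  by apply: sumr_ge0 => *; apply: sumr_ge0 => *; rewrite addr_ge0.
have Lt s t : 0 <= s -> s <= t -> t <= T -> D s /\ D t.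
  by move=> s0 st tT; split; apply/andP; split => //; lra.
(* With c = F s and |F x - F s| <= L (t - s) on [s,t], the increment bound becomes quadratic in t -
   s. *)
have rie (v F : R -> R) (a : R) : a != 0 -> {within `[0, T], continuous F} ->
    (forall t, 0 <= t -> v t = a * \int[lebesgue_measure]_(s in `[0, t]) (a^-1 * F s)) ->
    (forall s t, D s -> D t -> `|F s - F t| <= L * lin s t) ->
    forall s t, 0 <= s -> s <= t -> t <= T ->
    `|v t - v s - (t - s) * F s| <= L * (t - s) ^+ 2.
  move=> an0 cF vE lF s t s0 st tT.
  have [Ds Dt] := Lt s t s0 st tT.
  rewrite expr2 mulrA; apply: (limit_increment an0 cF vE s0 st tT) => x /andP[sx xt].
  have Dx : D x by have [] := Lt s x s0 sx (le_trans xt tT).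
  apply: le_trans (lF x s Dx Ds) _; apply: ler_wpM2l => //.
  by rewrite /lin ger0_norm ?subr_ge0// lerD2r.
exists L, (\sum_(z : Z) \sum_(z' : Z) (`|Bv z z'| + `|Bu z z'|)), hC, hA; split => //.
- by move=> z z'; apply: le_trans (Bb z z'); rewrite lerDl.
- by move=> z z'; apply: le_trans (Bb z z'); rewrite lerDr.
- by move=> s z Ds; exact: (HL (inl (inr (inl z)))).1.
- by move=> z s z' Ds; exact: (HL (inl (inl (inl (z, z'))))).1.
- by move=> z s z' Ds; exact: (HL (inl (inl (inr (z, z'))))).1.
- by move=> z s t z' Ds Dt; exact: (HL (inl (inl (inl (z, z'))))).2.
- by move=> z s t z' Ds Dt; exact: (HL (inl (inl (inr (z, z'))))).2.
- by move=> z s z' Ds; exact: (HC z).2.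
- by move=> z s z' Ds; exact: (HA z).2.
- by move=> z; rewrite QE// set_itv1 Rintegral_set1 mulr0.
- by move=> z; rewrite PE// set_itv1 Rintegral_set1 mulr0.
- move=> z; apply: (rie _ _ _ a0 (cdC (z := z)) (QE z)).
  exact: (HL (inr (inl z))).2.
- move=> z; apply: (rie _ _ _ (oner_neq0 _) (cdA (z := z)) (PE z)).
  exact: (HL (inr (inr z))).2.
- move=> z s t s0 st tT; have [Ds Dt] := Lt s t s0 st tT.
  have := (HL (inl (inr (inl z)))).2 t s Dt Ds.
  by rewrite /lin (ger0_norm (_ : 0 <= t - s)) ?subr_ge0.
- move=> z s t s0 st tT; have [Ds Dt] := Lt s t s0 st tT.
  have := (HL (inl (inr (inr z)))).2 t s Dt Ds.
  by rewrite /lin (ger0_norm (_ : 0 <= t - s)) ?subr_ge0.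
Qed.

End limit_facts_existence.

(** * Pathwise error bound *)

Section gronwall.
Context (R : realType).

(** The inhomogeneity [A] may vary with j, and it survives only as its last value and its average.
    No maximum over time appears, so the martingales call for no maximal inequality. *)
Lemma discrete_gronwall (E A : nat -> R) (c W x T : R) (k : nat) :
  0 <= c -> 0 <= x -> 0 <= W -> (forall j, 0 <= A j) -> k%:R * x <= T ->
  (forall j, (j <= k)%N -> E j <= W + A j + c * x * \sum_(i < j) E i) ->
  E k <= (1 + c * T * expR (c * T)) * W + A k +
    c * expR (c * T) * (x * \sum_(j < k) A j).
Proof.
move=> c0 x0 W0 A0 kT HE.
have cx0 : 0 <= c * x by exact: mulr_ge0.
have S j : (j <= k)%N ->
    \sum_(i < j) E i <= (1 + c * x) ^+ j * \sum_(i < j) (W + A i).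
  elim: j => [|j IH] jk; first by rewrite !big_ord0 mulr0.
  have {}IH := IH (ltnW jk); rewrite !big_ord_recr/=.
  have Sj0 : 0 <= \sum_(i < j) (W + A i) by apply: sumr_ge0 => i _; exact: addr_ge0.
  have WA : 0 <= W + A j by exact: addr_ge0.
  have p1 : 1 <= (1 + c * x) ^+ j.+1 by rewrite exprn_ege1// lerDl.
  rewrite mulrDr; apply: (@le_trans _ _ ((1 + c * x) * \sum_(i < j) E i + (W + A j))).
    by have := HE j (ltnW jk); lra.
  apply: lerD; last by apply: ler_peMl.
  by rewrite exprS -mulrA; apply: ler_wpM2l; [rewrite addr_ge0|].
have T0 : 0 <= T by apply: le_trans kT; rewrite mulr_ge0.
have e0 : 0 <= expR (c * T) by exact: expR_ge0.
have SA : 0 <= \sum_(i < k) A i by apply: sumr_ge0.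
have Sk : \sum_(i < k) E i <= expR (c * T) * (k%:R * W + \sum_(i < k) A i).
  apply: le_trans (S k (leqnn k)) _.
  rewrite big_split/= sumr_const card_ord -[W *+ k]mulr_natl.
  by apply: ler_wpM2r; [rewrite addr_ge0// mulr_ge0|exact: expR_pow_le].
have h1 := ler_wpM2l cx0 Sk.
have h2 : c * expR (c * T) * (k%:R * x * W) <= c * expR (c * T) * (T * W).
  by apply: ler_wpM2l; [exact: mulr_ge0|exact: ler_wpM2r].
have := HE k (leqnn k); lra.
Qed.

End gronwall.

Section path_error.
Context (R : realType) (dx da : nat) (M : mdp R dx da).
Context (beta alpha : R) (sigma : R -> R).
Hypotheses (hbeta : 2^-1 < beta < 1) (halpha : 0 < alpha) (hsigma : activation sigma).
Local Notation Z := (stX M * acA M)%type.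
Local Notation sigma' := (derive1 sigma).

Definition path_c (K T KM Ld Bb : R) : R :=
  err_cstC M alpha K T KM Ld Bb + err_cstA M alpha K T KM Ld Bb.

(** Dominates the three coefficients delivered by Gronwall: those of the constant part, of the last
    fluctuation and of the averaged fluctuation. *)
Definition path_C (K T KM Ld Bb : R) : R :=
  let c := path_c K T KM Ld Bb in
  1 + c + c * T * expR (c * T) * c + c * expR (c * T).

Context (N : nat).
Hypothesis (N0 : (0 < N)%N).
Local Notation n := (N%:R : R).
Local Notation eps := (scl beta N).
Context (th : nat -> params R dx da N) (xi xit : nat -> Z).
Hypothesis (thS : forall k, th k.+1 =
  step beta alpha sigma k (th k) (xi k) (xi k.+1) (xit k)).
Context (K T KM q0 p0 kv ku : R) (Bv Bu : Z -> Z -> R).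
Hypotheses (K0 : 0 <= K) (T0 : 0 <= T) (KM0 : 0 <= KM)
  (C0K : forall i, `|prmC (th 0%N) i| <= K) (B0K : forall i, `|prmB (th 0%N) i| <= K)
  (hq0 : forall z : Z, `|criticQ beta sigma (th 0%N) z| <= q0) (eq0 : eps * q0 <= K)
  (hp0 : forall z : Z, `|actorP beta sigma (th 0%N) z| <= p0)
  (kvM : 0 <= kv <= KM) (kuM : 0 <= ku <= KM)
  (hkv : forall z z', `|mker sigma sigma' (@gram _ _ _ M)
     (prmC (th 0%N)) (yC th 0%N) z z' - Bv z z'| <= kv)
  (hku : forall z z', `|mker sigma sigma' (@gram _ _ _ M)
     (prmB (th 0%N)) (yA th 0%N) z z' - Bu z z'| <= ku).
Context (Ld Bb : R) (Q0 P0 : R -> Z -> R) (FQ FP : Z -> R -> R) (hC hA : Z -> R -> Z -> R).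
Hypothesis (lf : limit_facts alpha T Ld Bb Q0 P0 Bv Bu FQ FP hC hA).

Definition fluct (j : nat) : R := n^-1 * \sum_(z : Z)
  (`|martC beta alpha sigma th xi Bv Q0 hC z j| + `|martA beta sigma th xit hA z j|).

Let L0 : 0 <= Ld. Proof. exact: lfL lf. Qed.
Let B0 : 0 <= Bb. Proof. exact: lfB lf. Qed.
Let pc0 := path_cst_ge0 M halpha K0 T0 KM0.
Let q00 : 0 <= q0.
Proof. by have [z] := mdp_inhabited M; exact: le_trans (hq0 z). Qed.
Let p00 : 0 <= p0.
Proof. by have [z] := mdp_inhabited M; exact: le_trans (hp0 z). Qed.

Let err_cst_ge0 a1 a2 : 0 <= a1 -> 0 <= a2 -> 0 <= err_cst M alpha K T KM Ld a1 a2.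
Proof.
move=> a10 a20; rewrite /err_cst !addr_ge0//; first by rewrite mulr_ge0// addr_ge0// mulr_ge0.
by rewrite mulr_ge0// mulr_ge0.
Qed.

Let cC0 : 0 <= err_cstC M alpha K T KM Ld Bb.
Proof. by rewrite err_cst_ge0 ?mulr_ge0// ltW. Qed.

Let cA0 : 0 <= err_cstA M alpha K T KM Ld Bb.
Proof. by rewrite err_cst_ge0 ?mulr_ge0. Qed.

Lemma path_C_ge0 : 0 <= path_C K T KM Ld Bb.
Proof.
have c0 : 0 <= path_c K T KM Ld Bb by exact: addr_ge0.
have e0 : 0 <= expR (path_c K T KM Ld Bb * T) by exact: expR_ge0.
by rewrite /path_C; do !apply: addr_ge0 => //; rewrite !mulr_ge0.
Qed.

Lemma fluct_ge0 j : 0 <= fluct j.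
Proof. by rewrite mulr_ge0 ?invr_ge0//; apply: sumr_ge0 => *; exact: addr_ge0. Qed.

(** Neither error closes alone: the critic bound contains the actor error through the sampling
    policy, and the actor bound contains the critic error as its signal. Gronwall is applied to
    their sum. *)
Lemma path_error k : k%:R <= n * T ->
  eQ beta sigma th Q0 k + eP beta sigma th P0 k <=
  path_C K T KM Ld Bb * (eps + (q0 + p0 + kv + ku) + fluct k
     + n^-1 * \sum_(j < k) fluct j).
Proof.
move=> kT; set W := eps + (q0 + p0 + kv + ku).
have n0 : 0 < n by rewrite ltr0n.
have ni0 : 0 <= n^-1 by rewrite invr_ge0 ltW.
have /andP[kv0 _] := kvM; have /andP[ku0 _] := kuM.
have e0 : 0 < eps by case/andP: (scl01 hbeta N0).
have W0 : 0 <= W by rewrite /W !addr_ge0// ltW.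
pose c := path_c K T KM Ld Bb.
have c0 : 0 <= c by exact: addr_ge0.
pose E j := eQ beta sigma th Q0 j + eP beta sigma th P0 j.
have E0 j : 0 <= E j by rewrite addr_ge0// supdist_ge0.
have SE0 j : 0 <= \sum_(i < j) E i by apply: sumr_ge0.
have HE j : (j <= k)%N -> E j <= c * W + fluct j + c * n^-1 * \sum_(i < j) E i.
  move=> jk; have jT : j%:R <= n * T by apply: le_trans kT; rewrite ler_nat.
  pose mc := n^-1 * \sum_z `|martC beta alpha sigma th xi Bv Q0 hC z j|.
  pose ma := n^-1 * \sum_z `|martA beta sigma th xit hA z j|.
  have mc0 : 0 <= mc by rewrite mulr_ge0// sumr_ge0.
  have ma0 : 0 <= ma by rewrite mulr_ge0// sumr_ge0.
  have flE : fluct j = mc + ma by rewrite /fluct big_split/= mulrDr.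
  have eQle : eQ beta sigma th Q0 j <= err_cstC M alpha K T KM Ld Bb * W + mc +
      n^-1 * (err_cstC M alpha K T KM Ld Bb * \sum_(i < j) E i).
    apply: supdist_le => [|z].
      by apply: addr_ge0; [apply: addr_ge0 => //; exact: mulr_ge0
        |apply: mulr_ge0 => //; exact: mulr_ge0].
    apply: le_trans (critic_error hbeta halpha hsigma N0 thS K0 T0 KM0 C0K hq0 eq0
      kvM hkv lf z jT) _; rewrite lerD2r; apply: lerD.
      by apply: ler_wpM2l => //; rewrite /W; move: q00 p00 => *; lra.
    apply: ler_wpM2l => //; rewrite (bigD1 z)//= lerDl; exact: sumr_ge0.
  have ePle : eP beta sigma th P0 j <= err_cstA M alpha K T KM Ld Bb * W + ma +
      n^-1 * (err_cstA M alpha K T KM Ld Bb * \sum_(i < j) E i).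
    apply: supdist_le => [|z].
      by apply: addr_ge0; [apply: addr_ge0 => //; exact: mulr_ge0
        |apply: mulr_ge0 => //; exact: mulr_ge0].
    apply: le_trans (actor_error hbeta halpha hsigma N0 thS K0 T0 KM0 C0K B0K hq0 eq0
      hp0 kuM hku lf z jT) _; rewrite lerD2r; apply: lerD.
      by apply: ler_wpM2l => //; rewrite /W; move: q00 p00 => *; lra.
    apply: ler_wpM2l => //; rewrite (bigD1 z)//= lerDl; exact: sumr_ge0.
  rewrite {1}/E flE /c /path_c; lra.
have kT' : k%:R * n^-1 <= T by rewrite ler_pdivrMr// mulrC.
have := discrete_gronwall c0 ni0 (mulr_ge0 c0 W0) fluct_ge0 kT' HE.
rewrite -/(E k) => /le_trans; apply.
have S0 : 0 <= n^-1 * \sum_(j < k) fluct j.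
  by rewrite mulr_ge0//; apply: sumr_ge0 => i _; exact: fluct_ge0.
have ce0 : 0 <= c * expR (c * T) by rewrite mulr_ge0 ?expR_ge0.
have cte0 : 0 <= c * T * expR (c * T) * c by rewrite !mulr_ge0 ?expR_ge0.
have F0 := fluct_ge0 k.
set S := n^-1 * _ in S0 *; set F := fluct k in F0 *.
rewrite /path_C -/c -subr_ge0.
have -> : (1 + c + c * T * expR (c * T) * c + c * expR (c * T)) * (W + F + S) -
    ((1 + c * T * expR (c * T)) * (c * W) + F + c * expR (c * T) * S) =
  (1 + c * expR (c * T)) * W + (c + c * T * expR (c * T) * c + c * expR (c * T)) * F +
  (1 + c + c * T * expR (c * T) * c) * S by ring.
apply: addr_ge0; first apply: addr_ge0; apply: mulr_ge0 => //.
- exact: addr_ge0.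
- by apply: addr_ge0 => //; apply: addr_ge0.
- by apply: addr_ge0 => //; apply: addr_ge0.
Qed.

End path_error.

(** * Moments of the fluctuations *)

Section power_mean.
Context (R : realType) (J : finType).

Lemma chebyshev_pow (x y : R) (p : nat) : 0 <= x -> 0 <= y ->
  x * y ^+ p + y * x ^+ p <= x ^+ p.+1 + y ^+ p.+1.
Proof.
move=> x0 y0; rewrite !exprS -subr_ge0.
have -> : x * x ^+ p + y * y ^+ p - (x * y ^+ p + y * x ^+ p) =
  (x - y) * (x ^+ p - y ^+ p) by ring.
case: (leP x y) => xy.
  by rewrite mulr_le0// subr_le0// lerXn2r.
by have yx := ltW xy; rewrite mulr_ge0// subr_ge0// lerXn2r.
Qed.

(** Induction on p by Chebyshev's sum inequality, symmetrized over pairs. The cardinality stands as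
    a factor on the left, which avoids a division when J is empty. *)
Lemma power_mean (x : J -> R) (p : nat) : (forall j, 0 <= x j) ->
  (\sum_j x j) ^+ p * #|J|%:R <= #|J|%:R ^+ p * \sum_j x j ^+ p.
Proof.
move=> x0; elim: p => [|p IH].
  rewrite !expr0 !mul1r; under eq_bigr do rewrite expr0.
  by rewrite sumr_const.
have S0 : 0 <= \sum_j x j by apply: sumr_ge0.
rewrite exprS -mulrA; apply: le_trans (ler_wpM2l S0 IH) _.
rewrite mulrCA exprS (mulrC #|J|%:R) -mulrA; apply: ler_wpM2l; first exact: exprn_ge0.
rewrite -(ler_pM2l (ltr0n R 2)).
have -> : 2 * ((\sum_j x j) * \sum_j x j ^+ p) =
    \sum_i \sum_j (x i * x j ^+ p + x j * x i ^+ p).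
  under [RHS]eq_bigr do rewrite big_split/=.
  rewrite big_split/= [X in _ = _ + X]exchange_big/= mulrDl mul1r.
  by congr (_ + _); rewrite mulr_suml; apply: eq_bigr => i _; rewrite mulr_sumr.
have -> : 2 * (#|J|%:R * \sum_j x j ^+ p.+1) =
    \sum_i \sum_j (x i ^+ p.+1 + x j ^+ p.+1).
  under [RHS]eq_bigr do rewrite big_split/=.
  rewrite big_split/= mulrDl mul1r sumr_const mulr_natl; congr (_ + _).
  rewrite -sumrMnl; apply: eq_bigr => i _; by rewrite sumr_const.
by apply: ler_sum => i _; apply: ler_sum => j _; exact: chebyshev_pow.
Qed.

End power_mean.

Section moment_bounds.
Context d (T : measurableType d) (R : realType) (P : probability T R) (p : nat) (r : R).
Hypotheses (p0 : (0 < p)%N) (r0 : 0 <= r).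
Local Notation Ex f := (\int[P]_w f w).

(** Encodes a p-th moment of order r^p in a form stable under sums, multiples and averages; [C]
    collects everything that does not depend on N once [r] is the rate. *)
Definition momb (f : T -> R) (C : R) :=
  [/\ bmeas f, forall w, 0 <= f w & Ex (fun w => f w ^+ p) <= C * r ^+ p].

Lemma momb_ge0 f C : momb f C -> 0 <= C * r ^+ p.
Proof.
by move=> [_ f0]; apply: le_trans; apply: Rintegral_ge0 => w _; exact: exprn_ge0.
Qed.

Lemma momb_cst (a k : R) : 0 <= a <= k * r -> momb (fun=> a) (k ^+ p).
Proof.
move=> /andP[a0 akr]; split => //; first exact: bmeas_cst.
by rewrite Ex_cst -exprMn lerXn2r// nnegrE (le_trans a0).
Qed.

Lemma mombZ (a : R) f C : 0 <= a -> momb f C -> momb (fun w => a * f w) (a ^+ p * C).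
Proof.
move=> a0 [bf f0 fC]; split=> [|w|]; [|exact: mulr_ge0|].
  by apply: bmeasM => //; exact: bmeas_cst.
under eq_Rintegral do rewrite exprMn.
by rewrite ExZ; [rewrite -mulrA ler_wpM2l// exprn_ge0|exact: bmeas_exp].
Qed.

Lemma momb_sum (J : finType) (f : J -> T -> R) (C : J -> R) :
  (forall j, momb (f j) (C j)) ->
  momb (fun w => \sum_j f j w) (#|J|%:R ^+ p * \sum_j C j).
Proof.
move=> fC; have bf j : bmeas (f j) by have [] := fC j.
have f0 j w : 0 <= f j w by have [_ ] := fC j.
split=> [|w|]; [by apply: bmeas_sum|by apply: sumr_ge0|].
have key w : (\sum_j f j w) ^+ p <= #|J|%:R ^+ p * \sum_j f j w ^+ p.
  have := power_mean p (fun j => f0 j w).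
  have [J0|J0] := posnP #|J|.
    have -> : \sum_j f j w = 0.
      by apply: big1 => j _; have := fintype0 j J0.
    by rewrite expr0n (gtn_eqF p0) J0 !mul0r expr0n (gtn_eqF p0) mul0r.
  apply: le_trans; apply: ler_peMr; last by rewrite ler1n.
  by apply: exprn_ge0; apply: sumr_ge0.
have bfp : bmeas (fun w => \sum_j f j w ^+ p).
  by apply: bmeas_sum => j _; exact: bmeas_exp.
apply: le_trans (le_Ex P _ _ key) _.
- by apply: bmeas_exp; apply: bmeas_sum.
- by apply: bmeasM => //; exact: bmeas_cst.
rewrite ExZ// Ex_sum => [|j]; last exact: bmeas_exp.
rewrite -mulrA; apply: ler_wpM2l; first exact: exprn_ge0.
by rewrite mulr_suml; apply: ler_sum => j _; have [] := fC j.
Qed.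

Lemma mombD f g C C' : momb f C -> momb g C' ->
  momb (fun w => f w + g w) (2 ^+ p * (C + C')).
Proof.
move=> fC gC.
have H := @momb_sum bool (fun b => if b then f else g) (fun b => if b then C else C').
have {}H := H (fun b => match b with true => fC | false => gC end).
move: H; rewrite card_bool big_bool/=.
by congr momb; apply/funext => w; rewrite big_bool.
Qed.

(** By convexity the p-th moment of a mean of k terms is no larger than the common bound on the
    terms; dividing by n instead of k, with k <= n t, costs t^p. *)
Lemma momb_avg (k : nat) (f : nat -> T -> R) (C n t : R) : 0 <= C -> 0 < n -> 0 <= t ->
  k%:R <= n * t -> (forall j, (j < k)%N -> momb (f j) C) ->
  momb (fun w => n^-1 * \sum_(j < k) f j w) (t ^+ p * C).
Proof.
move=> C0 n0 t0 kn fC.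
have bf (j : 'I_k) : bmeas (f j) by have [] := fC j (ltn_ord j).
have f0 (j : 'I_k) w : 0 <= f j w by have [_ ] := fC j (ltn_ord j).
have ni0 : 0 <= n^-1 by rewrite invr_ge0 ltW.
have bS : bmeas (fun w => \sum_(j < k) f j w) by apply: bmeas_sum.
split=> [|w|].
- by apply: bmeasM => //; exact: bmeas_cst.
- by apply: mulr_ge0 => //; apply: sumr_ge0.
(* The power mean inequality leaves a factor k to be cancelled, so k = 0 is treated apart. *)
have [k0|k0] := posnP k.
  subst k; under eq_Rintegral do rewrite big_ord0 mulr0 expr0n (gtn_eqF p0).
  by rewrite Ex_cst !mulr_ge0 ?exprn_ge0.
under eq_Rintegral do rewrite exprMn.
rewrite ExZ; last exact: bmeas_exp.
have k0' : 0 < k%:R :> R by rewrite ltr0n.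
have h : Ex (fun w => (\sum_(j < k) f j w) ^+ p) <= k%:R ^+ p * (C * r ^+ p).
  rewrite -(ler_pM2r k0') mulrC -ExZ; last exact: bmeas_exp.
  apply: (@le_trans _ _ (Ex (fun w => k%:R ^+ p * \sum_(j < k) f j w ^+ p))).
    apply: le_Ex.
    - by apply: bmeasM; [exact: bmeas_cst|exact: bmeas_exp].
    - apply: bmeasM; first exact: bmeas_cst.
      by apply: bmeas_sum => j _; exact: bmeas_exp.
    move=> w; have := power_mean p (fun j : 'I_k => f0 j w).
    by rewrite card_ord mulrC.
  rewrite ExZ; last by apply: bmeas_sum => j _; exact: bmeas_exp.
  rewrite Ex_sum => [|j]; last exact: bmeas_exp.
  rewrite -mulrA; apply: ler_wpM2l; first exact: exprn_ge0.
  apply: (@le_trans _ _ (\sum_(j < k) C * r ^+ p)).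
    by apply: ler_sum => j _; have [] := fC j (ltn_ord j).
  by rewrite sumr_const card_ord mulr_natr.
apply: (@le_trans _ _ (n^-1 ^+ p * (k%:R ^+ p * (C * r ^+ p)))).
  by apply: ler_wpM2l => //; exact: exprn_ge0.
rewrite [leLHS]mulrA -(exprMn p n^-1) -mulrA; apply: ler_wpM2r.
  exact: momb_ge0 (fC 0%N k0).
rewrite lerXn2r ?nnegrE ?mulr_ge0//.
by rewrite ler_pdivrMl.
Qed.

End moment_bounds.

(** * Fluctuations at initialization *)

Section iid_sum.
Context d (T : measurableType d) (R : realType) (P : probability T R).
Context (I : finType) (F : I -> set (set T)).
Hypotheses (mF : forall i E, F i E -> measurable E) (FT : forall i, F i setT)
  (FI : forall i, setI_closed (F i)) (ind : mutually_independent P F).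
Context (N m : nat) (a : 'I_N -> T -> R) (b : 'I_N -> T -> 'rV[R]_m) (ia ib : 'I_N -> I).
Hypotheses (ia_inj : injective ia) (ib_inj : injective ib)
  (iab : forall i j, ia i != ib j)
  (Fa : forall i B, measurable B -> F (ia i) (a i @^-1` B))
  (Fb : forall i B, measurable B -> F (ib i) (b i @^-1` B)).
Context (u : R -> R) (v : 'rV[R]_m -> R) (U V : R).
Hypotheses (mu : measurable_fun [set: R] u) (mv : measurable_fun [set: 'rV[R]_m] v)
  (uU : forall x, `|u x| <= U) (vV : forall x, `|v x| <= V).
Local Notation Ex f := (\int[P]_w f w).

Let Fu i B : measurable B -> F (ia i) ((fun w => u (a i w)) @^-1` B).
Proof.
by move=> mB; apply: (@Fa i (u @^-1` B)); rewrite -[X in measurable X]setTI; exact: mu.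
Qed.

Let Fv i B : measurable B -> F (ib i) ((fun w => v (b i w)) @^-1` B).
Proof.
by move=> mB; apply: (@Fb i (v @^-1` B)); rewrite -[X in measurable X]setTI; exact: mv.
Qed.

Lemma iid_bmeas_u i : bmeas (fun w => u (a i w)).
Proof.
split; last by exists U.
by move=> _ B mB; rewrite setTI; exact: mF (Fu i mB).
Qed.

Lemma iid_bmeas_v i : bmeas (fun w => v (b i w)).
Proof.
split; last by exists V.
by move=> _ B mB; rewrite setTI; exact: mF (Fv i mB).
Qed.

(** Coordinates revealed before the n-th pair; they generate the filtration for which the centred
    products are orthogonal increments. *)
Let J (n : nat) : {set I} :=
  [set ia i | i : 'I_N & (i < n)%N] :|: [set ib i | i : 'I_N & (i < n)%N].

Let iaJ i : ia i \notin J i.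
Proof.
rewrite !inE negb_or; apply/andP; split.
  by apply/imsetP => -[j]; rewrite inE => ji /ia_inj ij; rewrite ij ltnn in ji.
by apply/imsetP => -[j _ /eqP]; rewrite (negbTE (iab _ _)).
Qed.

Let ibJ i : ib i \notin J i.
Proof.
rewrite !inE negb_or; apply/andP; split.
  by apply/imsetP => -[j _ /esym/eqP]; rewrite (negbTE (iab _ _)).
by apply/imsetP => -[j]; rewrite inE => ji /ib_inj ij; rewrite ij ltnn in ji.
Qed.

(** Extended by 0 past N, since the moment bound is about infinite sequences. *)
Let X (n : nat) (w : T) : R := if insub n is Some i then
  u (a i w) * v (b i w) - Ex (fun w => u (a i w) * v (b i w)) else 0.

Lemma iid_moment (p : nat) : (0 < N)%N ->
  Ex (fun w => `|\sum_i (u (a i w) * v (b i w) - Ex (fun w => u (a i w) * v (b i w)))| ^+ p)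
    <= 2 * p%:R ^+ p * (2 * (1 + 2 * (U * V))) ^+ p * expR 1 * Num.sqrt N%:R ^+ p.
Proof.
move=> N0; have U0 : 0 <= U by exact: le_trans (uU 0).
have V0 : 0 <= V by exact: le_trans (vV 0).
have buv i : bmeas (fun w => u (a i w) * v (b i w)).
  by apply: bmeasM; [exact: iid_bmeas_u|exact: iid_bmeas_v].
have uvUV i w : `|u (a i w) * v (b i w)| <= U * V by rewrite normrM ler_pM.
have := moment_gen (P := P) (H := fun n => \bigcup_(j in [set j | j \in J n]) F j)
  (X := X) (K := 1 + 2 * (U * V)) _ _ _ _ _ p (n := N) (s := Num.sqrt N%:R) (t := 1).
have -> : (fun w => `|\sum_(j < N) X j w| ^+ p) = (fun w => `|\sum_i
    (u (a i w) * v (b i w) - Ex (fun w => u (a i w) * v (b i w)))| ^+ p).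
  apply/funext => w; congr (`|_| ^+ p); apply: eq_bigr => i _.
  by rewrite /X valK.
apply.
- by rewrite ltr_pwDl// !mulr_ge0.
- move=> n; rewrite /X; case: insubP => [i _ _|_]; last exact: bmeas_cst.
  by apply: bmeasB => //; exact: bmeas_cst.
- move=> n w; rewrite /X; case: insubP => [i _ _|_]; last first.
    by rewrite normr0 addr_ge0// !mulr_ge0.
  apply: le_trans (ler_normB _ _) _.
  have := norm_Ex P (buv i) (uvUV i); have := uvUV i w; lra.
- move=> n j jn; rewrite /X; case: insubP => [i iN ij|_]; last exact: measurable_cst.
  apply: measurable_funB; last exact: measurable_cst.
  apply: measurable_funM; apply/gmeasP => B mB; apply: sub_sigma_algebra.
    exists (ia i); last exact: Fu.
    by rewrite /= !inE; apply/orP; left; apply: imset_f; rewrite inE ij.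
  exists (ib i); last exact: Fv.
  by rewrite /= !inE; apply/orP; right; apply: imset_f; rewrite inE ij.
- move=> n D HD; rewrite /X; case: insubP => [i iN ij|_]; last first.
    rewrite Rintegral_cst ?mul0r//.
    move: HD; apply: smallest_sub; first exact: sigma_algebra_measurable.
    by move=> E [j _]; exact: mF.
  have [_] := indep_orth mF FT FI ind (iaJ i) (ibJ i) (iab i i) (iid_bmeas_u i)
    (iid_bmeas_v i) (@Fu i) (@Fv i).
  by apply; rewrite ij.
- by rewrite -[leLHS]sqrtr1 ler_wsqrtr// ler1n.
- by rewrite sqr_sqrtr// mul1r.
Qed.

Lemma iid_mean i : Ex (fun w => u (a i w) * v (b i w)) =
  Ex (fun w => u (a i w)) * Ex (fun w => v (b i w)).
Proof.
have [] := indep_orth mF FT FI ind (iaJ i) (ibJ i) (iab i i) (iid_bmeas_u i)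
  (iid_bmeas_v i) (@Fu i) (@Fv i).
by [].
Qed.

End iid_sum.

Section matrix_measurability.
Context (R : realType) (m : nat).

Lemma measurable_coord (j : 'I_m) :
  measurable_fun [set: 'rV[R]_m] (fun x : 'rV[R]_m => x 0 j).
Proof.
move=> _ B mB; rewrite setTI; apply: sub_sigma_algebra.
by exists 0, j, B.
Qed.

Lemma measurable_dotv (e : 'rV[R]_m) :
  measurable_fun [set: 'rV[R]_m] (fun x : 'rV[R]_m => dotv x e).
Proof.
apply: measurable_sum => j; apply: measurable_funM; last exact: measurable_cst.
exact: measurable_coord.
Qed.

End matrix_measurability.

Section layer.
Context d (T : measurableType d) (R : realType) (P : probability T R).
Context (I : finType) (F : I -> set (set T)).
Hypotheses (mF : forall i E, F i E -> measurable E) (FT : forall i, F i setT)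
  (FI : forall i, setI_closed (F i)) (ind : mutually_independent P F).
Context (N m : nat) (a : 'I_N -> T -> R) (b : 'I_N -> T -> 'rV[R]_m) (ia ib : 'I_N -> I).
Hypotheses (N0 : (0 < N)%N) (ia_inj : injective ia) (ib_inj : injective ib)
  (iab : forall i j, ia i != ib j)
  (Fa : forall i B, measurable B -> F (ia i) (a i @^-1` B))
  (Fb : forall i B, measurable B -> F (ib i) (b i @^-1` B)).
Context (nu : probability (R * 'rV[R]_m)%type R) (K : R).
Hypotheses (K0 : 0 <= K) (nuK : nu [set y | `|y.1| <= K] = 1%E)
  (law : forall i E, measurable E -> P [set w | E (a i w, b i w)] = nu E)
  (mean0 : forall i, ('E_P[a i] = 0)%E).
Context (sigma : R -> R).
Hypothesis (hsigma : activation sigma).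
Local Notation Ex f := (\int[P]_w f w).
Local Notation sigma' := (derive1 sigma).

(* Zero outside [-K, K], so clip is the identity almost surely on the initial
   outer weights. *)
Definition clip (x : R) : R := x * \1_(`[- K, K]) x.

Lemma clip_id x : `|x| <= K -> clip x = x.
Proof.
by rewrite ler_norml => xK; rewrite /clip indicE mem_set ?mulr1//= in_itv.
Qed.

Lemma clip_le x : `|clip x| <= K.
Proof.
rewrite /clip indicE; case: (boolP (x \in _)).
  by rewrite inE /= in_itv /= mulr1 ler_norml.
by rewrite mulr0 normr0.
Qed.

Lemma measurable_clip : measurable_fun [set: R] clip.
Proof. by apply: measurable_funM => //; exact: measurable_indic. Qed.

Let mset : measurable [set y : R * 'rV[R]_m | `|y.1| <= K].
Proof.
rewrite (_ : mkset _ = (fun y : R * 'rV[R]_m => y.1) @^-1` `[- K, K]).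
  by rewrite -[X in measurable X]setTI; apply: measurable_fst.
by apply/seteqP; split=> y /=; rewrite in_itv/= ler_norml.
Qed.

Lemma layer_bounded_prob i : P [set w | `|a i w| <= K] = 1%E.
Proof. by rewrite -nuK -(law i mset). Qed.

Let ma i : measurable_fun [set: T] (a i).
Proof. by move=> _ B mB; rewrite setTI; exact: mF (Fa i mB). Qed.

Let mb i : measurable_fun [set: T] (b i).
Proof. by move=> _ B mB; rewrite setTI; exact: mF (Fb i mB). Qed.

Lemma layer_bounded_meas i : measurable [set w | `|a i w| <= K].
Proof.
rewrite (_ : mkset _ = a i @^-1` `[- K, K]).
  by rewrite -[X in measurable X]setTI; exact: ma.
by apply/seteqP; split=> w /=; rewrite in_itv/= ler_norml.
Qed.

Let clip_ae i : {ae P, forall w, a i w = clip (a i w)}.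
Proof.
exists (~` [set w | `|a i w| <= K]); split.
- by apply: measurableC; exact: layer_bounded_meas.
- by rewrite probability_setC ?layer_bounded_prob ?subee//; exact: layer_bounded_meas.
- by move=> w /= H aK; apply: H; rewrite clip_id.
Qed.

Lemma clip_mean0 i : Ex (fun w => clip (a i w)) = 0.
Proof.
rewrite /Rintegral (_ : integral _ _ _ = 0%E)//.
have := mean0 i; rewrite unlock => E0; rewrite -[RHS]E0.
apply: ae_eq_integral => //.
- by apply/measurable_EFinP; apply: measurableT_comp => //; exact: measurable_clip.
- exact/measurable_EFinP.
- by apply: filterS (clip_ae i) => w E _; rewrite -E.
Qed.

Let s1 := (let: And5 h _ _ _ _ := activation_lip hsigma in h).
Let s'1 := (let: And5 _ h _ _ _ := activation_lip hsigma in h).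
Let ms : measurable_fun [set: R] sigma.
Proof. by apply: continuous_measurable_fun; have [] := activation_continuous hsigma. Qed.
Let ms' : measurable_fun [set: R] sigma'.
Proof. by apply: continuous_measurable_fun; have [] := activation_continuous hsigma. Qed.

Let msd (f : R -> R) (e : 'rV[R]_m) : measurable_fun [set: R] f ->
  measurable_fun [set: 'rV[R]_m] (fun x : 'rV[R]_m => f (dotv x e)).
Proof. by move=> mf; apply: measurableT_comp => //; exact: measurable_dotv. Qed.

(** The outer weight is centred and independent of the inner one, so each product has mean zero and
    the sum of N of them is of order sqrt N. *)
Lemma layer_out_moment (p : nat) (e : 'rV[R]_m) : (0 < p)%N ->
  momb P p (Num.sqrt N%:R)
    (fun w => `|\sum_i clip (a i w) * sigma (dotv (b i w) e)|)
    (2 * p%:R ^+ p * (2 * (1 + 2 * K)) ^+ p * expR 1).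
Proof.
move=> p0.
have mv := msd e ms.
have vV x : `|sigma (dotv x e)| <= 1 by exact: s1.
have mc := measurable_clip.
split=> [|//|].
  apply: bmeas_norm; apply: bmeas_sum => i _; apply: bmeasM.
    exact: (iid_bmeas_u mF Fa mc clip_le).
  exact: (iid_bmeas_v mF Fb mv vV).
have := iid_moment mF FT FI ind ia_inj ib_inj iab Fa Fb mc mv clip_le vV p N0.
rewrite mulr1; apply: le_trans; rewrite le_eqVlt; apply/orP; left; apply/eqP.
apply: eq_Rintegral => w _; congr (`|_| ^+ p); apply: eq_bigr => i _.
rewrite (iid_mean mF FT FI ind ia_inj ib_inj iab Fa Fb mc mv clip_le vV i).
by rewrite clip_mean0 mul0r subr0.
Qed.

Section kernel.
Context (g : R) (e e' : 'rV[R]_m).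

Definition lker (x : R) (y : 'rV[R]_m) : R :=
  sigma (dotv y e) * sigma (dotv y e') +
  x ^+ 2 * sigma' (dotv y e) * sigma' (dotv y e') * g.

(** The kernel splits into two products of a function of the outer weight and a function of the
    inner weight, the shape that [iid_moment] treats. *)
Let u1 : R -> R := fun=> 1.
Let u2 (x : R) : R := clip x ^+ 2.
Let v1 (y : 'rV[R]_m) : R := sigma (dotv y e) * sigma (dotv y e').
Let v2 (y : 'rV[R]_m) : R := sigma' (dotv y e) * sigma' (dotv y e') * g.

Let mu1 : measurable_fun [set: R] u1. Proof. exact: measurable_cst. Qed.
Let mu2 : measurable_fun [set: R] u2.
Proof. by apply: measurable_funX; exact: measurable_clip. Qed.
Let mv1 : measurable_fun [set: 'rV[R]_m] v1.
Proof. by apply: measurable_funM; exact: msd. Qed.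
Let mv2 : measurable_fun [set: 'rV[R]_m] v2.
Proof.
by apply: measurable_funM => //; apply: measurable_funM; exact: msd.
Qed.
Let u1U x : `|u1 x| <= 1. Proof. by rewrite normr1. Qed.
Let u2U x : `|u2 x| <= K ^+ 2.
Proof. by rewrite normrX lerXn2r ?nnegrE//; exact: clip_le. Qed.
Let v1V x : `|v1 x| <= 1.
Proof. by rewrite normrM -[leRHS]mulr1 ler_pM. Qed.
Let v2V x : `|v2 x| <= `|g|.
Proof.
rewrite normrM -[leRHS]mul1r; apply: ler_pM => //.
by rewrite normrM -[leRHS]mulr1 ler_pM.
Qed.

Let bm1 i : bmeas (fun w => u1 (a i w) * v1 (b i w)).
Proof.
apply: bmeasM; first exact: (iid_bmeas_u mF Fa mu1 u1U).
exact: (iid_bmeas_v mF Fb mv1 v1V).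
Qed.

Let bm2 i : bmeas (fun w => u2 (a i w) * v2 (b i w)).
Proof.
apply: bmeasM; first exact: (iid_bmeas_u mF Fa mu2 u2U).
exact: (iid_bmeas_v mF Fb mv2 v2V).
Qed.

Let lkerE x y : lker (clip x) y = u1 x * v1 y + u2 x * v2 y.
Proof. by rewrite /lker /u1 /u2 /v1 /v2; ring. Qed.

Lemma lker_bmeas i : bmeas (fun w => lker (clip (a i w)) (b i w)).
Proof.
rewrite (_ : (fun w => _) = fun w => u1 (a i w) * v1 (b i w) + u2 (a i w) * v2 (b i w)).
  exact: bmeasD.
by apply/funext => w; rewrite lkerE.
Qed.

(** The joint law carries the integral over to [nu], and the truncation is the identity [nu]-almost
    everywhere. *)
Lemma lker_mean i : Ex (fun w => lker (clip (a i w)) (b i w)) =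
  \int[nu]_y lker y.1 y.2.
Proof.
have ml : measurable_fun [set: R * 'rV[R]_m] (fun y => lker y.1 y.2).
  apply: measurable_funD.
    by apply: (measurableT_comp mv1); exact: measurable_snd.
  rewrite (_ : (fun y : R * 'rV[R]_m => _) = fun y => y.1 ^+ 2 * v2 y.2); last first.
    by apply/funext => y; rewrite /v2; ring.
  apply: measurable_funM; first by apply: measurable_funX; exact: measurable_fst.
  by apply: (measurableT_comp mv2); exact: measurable_snd.
have mab : measurable_fun [set: T] (fun w => (a i w, b i w)).
  exact: measurable_fun_pair.
have bl : bmeas (fun w => lker (clip (a i w)) (b i w)) := lker_bmeas i.
pose h (y : R * 'rV[R]_m) := lker (clip y.1) y.2.
have mh : measurable_fun [set: R * 'rV[R]_m] h.
  rewrite (_ : h = fun y => u1 y.1 * v1 y.2 + u2 y.1 * v2 y.2); last first.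
    by apply/funext => y; rewrite /h lkerE.
  apply: measurable_funD; apply: measurable_funM.
  - by apply: (measurableT_comp mu1); exact: measurable_fst.
  - by apply: (measurableT_comp mv1); exact: measurable_snd.
  - by apply: (measurableT_comp mu2); exact: measurable_fst.
  - by apply: (measurableT_comp mv2); exact: measurable_snd.
rewrite /Rintegral; congr fine.
transitivity (\int[nu]_y (h y)%:E)%E.
  rewrite (eq_measure_integral (pushforward P (fun w => (a i w, b i w)))); last first.
    by move=> A mA _; symmetry; exact: law.
  rewrite integral_pushforward//.
  - exact/measurable_EFinP.
  - exact: (bmeas_int P measurableT bl).
apply: ae_eq_integral => //; [exact/measurable_EFinP|exact/measurable_EFinP|].
exists (~` [set y | `|y.1| <= K]); split; first exact: measurableC.
  transitivity (1 - nu [set y : R * 'rV[R]_m | (`|y.1| <= K)%R])%E; last by rewrite nuK subee.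
  exact: probability_setC.
by move=> y /= H yK; apply: H => _; rewrite /h clip_id.
Qed.

Lemma layer_ker_moment (p : nat) : (0 < p)%N ->
  momb P p (Num.sqrt N%:R)
    (fun w => `|\sum_i (lker (clip (a i w)) (b i w) - \int[nu]_y lker y.1 y.2)|)
    (2 ^+ p * (2 * p%:R ^+ p * (2 * (1 + 2 * 1)) ^+ p * expR 1 +
       2 * p%:R ^+ p * (2 * (1 + 2 * (K ^+ 2 * `|g|))) ^+ p * expR 1)).
Proof.
move=> p0.
pose S1 w := \sum_i (u1 (a i w) * v1 (b i w) - Ex (fun w => u1 (a i w) * v1 (b i w))).
pose S2 w := \sum_i (u2 (a i w) * v2 (b i w) - Ex (fun w => u2 (a i w) * v2 (b i w))).
have bc c : @bmeas _ T R (fun=> c) by exact: bmeas_cst.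
have bS1 : bmeas S1 by apply: bmeas_sum => i _; exact: bmeasB.
have bS2 : bmeas S2 by apply: bmeas_sum => i _; exact: bmeasB.
have m1 : momb P p (Num.sqrt N%:R) (fun w => `|S1 w|)
    (2 * p%:R ^+ p * (2 * (1 + 2 * 1)) ^+ p * expR 1).
  split=> [|//|]; first exact: bmeas_norm.
  have := iid_moment mF FT FI ind ia_inj ib_inj iab Fa Fb mu1 mv1 u1U v1V p N0.
  by rewrite [1 * 1]mulr1.
have m2 : momb P p (Num.sqrt N%:R) (fun w => `|S2 w|)
    (2 * p%:R ^+ p * (2 * (1 + 2 * (K ^+ 2 * `|g|))) ^+ p * expR 1).
  split=> [|//|]; first exact: bmeas_norm.
  exact: (iid_moment mF FT FI ind ia_inj ib_inj iab Fa Fb mu2 mv2 u2U v2V p N0).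
have [bD D0 DC] := mombD p0 m1 m2.
have SE w : \sum_i (lker (clip (a i w)) (b i w) - \int[nu]_y lker y.1 y.2) = S1 w + S2 w.
  rewrite /S1 /S2 -big_split/=; apply: eq_bigr => i _.
  rewrite -(lker_mean i) lkerE.
  have -> : Ex (fun w => lker (clip (a i w)) (b i w)) =
     Ex (fun w => u1 (a i w) * v1 (b i w)) + Ex (fun w => u2 (a i w) * v2 (b i w)).
    by rewrite -ExD//; apply: eq_Rintegral => w' _; rewrite lkerE.
  ring.
split=> [|//|].
  rewrite (_ : (fun w => _) = fun w => `|S1 w + S2 w|).
    by apply: bmeas_norm; exact: bmeasD.
  by apply/funext => w; rewrite SE.
apply: le_trans DC; apply: le_Ex.
- rewrite (_ : (fun w => _) = fun w => `|S1 w + S2 w| ^+ p).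
    by apply: bmeas_exp; apply: bmeas_norm; exact: bmeasD.
  by apply/funext => w; rewrite SE.
- exact: bmeas_exp.
- by move=> w; rewrite SE lerXn2r ?nnegrE// ler_normD.
Qed.

End kernel.
End layer.

Section rates.
Context (R : realType) (beta : R).
Hypothesis (hbeta : 2^-1 < beta < 1).

(** N^(beta-1) is the drift of the weights, N^(1/2-beta) the size of the initial outputs; the
    N^(-1/2) of the kernels and martingales is below the latter since beta < 1. *)
Definition rate (N : nat) : R := scl beta N + N%:R `^ (2^-1 - beta).

Lemma rate_ge0 N : 0 <= rate N.
Proof. by rewrite addr_ge0 ?powR_ge0. Qed.

Lemma scl_le_rate N : scl beta N <= rate N.
Proof. by rewrite lerDl powR_ge0. Qed.

Lemma sqrt_scl N : (0 < N)%N -> (N%:R * scl beta N)^-1 * Num.sqrt N%:R <= rate N.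
Proof.
move=> N0; have n0 : 0 < N%:R :> R by rewrite ltr0n.
rewrite -powR12_sqrt ?ler0n// -(powR_scl beta N0) -powRN -powRD; last first.
  by rewrite (gt_eqF n0) implybT.
by rewrite addrC lerDr powR_ge0.
Qed.

Lemma sqrt_div N : (0 < N)%N -> N%:R^-1 * Num.sqrt N%:R <= rate N.
Proof.
move=> N0; have n0 : 0 < N%:R :> R by rewrite ltr0n.
apply: le_trans (sqrt_scl N0); apply: ler_wpM2r; first exact: sqrtr_ge0.
have /andP[e0 e1] := scl01 hbeta N0.
by rewrite lef_pV2 ?posrE ?mulr_gt0// ler_piMr// ltW.
Qed.

End rates.

Section scaling.
Context d (T : measurableType d) (R : realType) (P : probability T R).

Lemma momb_scale (p : nat) (r r' : R) f (C a : R) : 0 <= C -> 0 <= r -> 0 <= a ->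
  a * r <= r' -> momb P p r f C -> momb P p r' (fun w => a * f w) C.
Proof.
move=> C0 r0 a0 ar [bf f0 fC]; split=> [|w|]; [|exact: mulr_ge0|].
  by apply: bmeasM => //; exact: bmeas_cst.
under eq_Rintegral do rewrite exprMn.
rewrite ExZ; last exact: bmeas_exp.
apply: (@le_trans _ _ (a ^+ p * (C * r ^+ p))).
  by apply: ler_wpM2l => //; exact: exprn_ge0.
rewrite mulrCA -exprMn; apply: ler_wpM2l => //.
have ar0 : 0 <= a * r by exact: mulr_ge0.
by rewrite lerXn2r// nnegrE (le_trans ar0).
Qed.

Lemma momb_eq (p : nat) (r : R) f g (C : R) : f =1 g -> momb P p r f C -> momb P p r g C.
Proof. by move=> /funext ->. Qed.

End scaling.

(** The family of sigma-algebras sits behind an existential, so that the critic and actor layers,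
    which live in one independent family, are treated alike. *)
Record iid_layer (R : realType) d (T : measurableType d) (P : probability T R)
  (m N : nat) (a : 'I_N -> T -> R) (b : 'I_N -> T -> 'rV[R]_m)
  (nu : probability (R * 'rV[R]_m)%type R) : Prop := IidLayer {
  il_law : forall i E, measurable E -> P [set w | E (a i w, b i w)] = nu E;
  il_mean : forall i, ('E_P[a i] = 0)%E;
  il_ind : exists (I : finType) (F : I -> set (set T)) (ia ib : 'I_N -> I),
    ((forall i E, F i E -> measurable E) /\ (forall i, F i setT) /\
     (forall i, setI_closed (F i)) /\ mutually_independent P F) /\
    (injective ia /\ injective ib /\ (forall i j, ia i != ib j)) /\
    (forall i B, measurable B -> F (ia i) (a i @^-1` B)) /\
    (forall i B, measurable B -> F (ib i) (b i @^-1` B))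
}.

Section layer_statistics.
Context (R : realType) (dx da : nat) (M : mdp R dx da) (beta : R) (sigma : R -> R).
Hypotheses (hbeta : 2^-1 < beta < 1) (hsigma : activation sigma).
Local Notation Z := (stX M * acA M)%type.
Context (nu : probability (R * 'rV[R]_(dx + da))%type R) (K : R).
Hypotheses (K0 : 0 <= K)
  (nuK : nu [set y | `|y.1| <= K] = 1%E).

Section fixed_layer.
Context d (T : measurableType d) (P : probability T R) (N : nat)
  (a : 'I_N -> T -> R) (b : 'I_N -> T -> 'rV[R]_(dx + da)).

(** Built on truncated weights, hence bounded at every sample point, and almost surely equal to the
    same expression in the true weights. *)
Definition outstat (w : T) : R := \sum_(z : Z)
  `|(N%:R * scl beta N)^-1 * \sum_i clip K (a i w) * sigma (dotv (b i w) (emb z))|.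

Definition kerstat (w : T) : R := \sum_(zz : Z * Z)
  `|N%:R^-1 * \sum_i (lker sigma (gram zz.1 zz.2) (emb zz.1) (emb zz.2)
      (clip K (a i w)) (b i w) - Bmean sigma nu zz.1 zz.2)|.

End fixed_layer.

Definition out_bound (p : nat) : R :=
  #|{: Z}|%:R ^+ p * \sum_(z : Z) (2 * p%:R ^+ p * (2 * (1 + 2 * K)) ^+ p * expR 1).

Definition ker_bound_cst (p : nat) : R :=
  #|{: Z * Z}|%:R ^+ p * \sum_(zz : Z * Z)
   (2 ^+ p * (2 * p%:R ^+ p * (2 * (1 + 2 * 1)) ^+ p * expR 1 +
       2 * p%:R ^+ p * (2 * (1 + 2 * (K ^+ 2 * `|gram zz.1 zz.2|))) ^+ p * expR 1)).

Let kb0 p (g : R) : 0 <= 2 ^+ p * (2 * p%:R ^+ p * (2 * (1 + 2 * 1)) ^+ p * expR 1 +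
       2 * p%:R ^+ p * (2 * (1 + 2 * (K ^+ 2 * `|g|))) ^+ p * expR 1).
Proof.
apply: mulr_ge0; first exact: exprn_ge0.
apply: addr_ge0; rewrite !mulr_ge0 ?expR_ge0 ?exprn_ge0// mulr_ge0// addr_ge0// !mulr_ge0//.
Qed.

Lemma outstat_moment p d (T : measurableType d) (P : probability T R) N a b :
  (0 < p)%N -> (0 < N)%N -> iid_layer P a b nu ->
  momb P p (rate beta N) (@outstat d T N a b) (out_bound p).
Proof.
move=> p0 N0 [law mean [I [F [ia [ib [[mF [FT [FI ind]]] [[iai [ibi iab]] [Fa Fb]]]]]]]].
apply: momb_sum => // z; have n0 : 0 < N%:R :> R by rewrite ltr0n.
have /andP[e0 _] := scl01 hbeta N0.
have ni : 0 <= (N%:R * scl beta N)^-1 by rewrite invr_ge0 mulr_ge0// ltW.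
have := layer_out_moment mF FT FI ind N0 iai ibi iab Fa Fb K0 nuK law mean hsigma (emb z) p0.
move/(momb_scale _ (sqrtr_ge0 _) ni (sqrt_scl beta N0)) => H.
apply: momb_eq (H _) => [w|]; first by rewrite normrM (ger0_norm ni).
by rewrite !mulr_ge0 ?expR_ge0 ?exprn_ge0// mulr_ge0// addr_ge0// mulr_ge0.
Qed.

Lemma kerstat_moment p d (T : measurableType d) (P : probability T R) N a b :
  (0 < p)%N -> (0 < N)%N -> iid_layer P a b nu ->
  momb P p (rate beta N) (@kerstat d T N a b) (ker_bound_cst p).
Proof.
move=> p0 N0 [law mean [I [F [ia [ib [[mF [FT [FI ind]]] [[iai [ibi iab]] [Fa Fb]]]]]]]].
apply: momb_sum => // zz; have n0 : 0 < N%:R :> R by rewrite ltr0n.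
have ni : 0 <= N%:R^-1 :> R by rewrite invr_ge0 ltW.
have := layer_ker_moment mF FT FI ind N0 iai ibi iab Fa Fb K0 nuK law hsigma
  (gram zz.1 zz.2) (emb zz.1) (emb zz.2) p0.
move/(momb_scale _ (sqrtr_ge0 _) ni (sqrt_div hbeta N0)) => H.
by apply: momb_eq (H _) => [w|]; [rewrite normrM (ger0_norm ni)|exact: kb0].
Qed.

Lemma layer_good d (T : measurableType d) (P : probability T R) N
    (a : 'I_N -> T -> R) (b : 'I_N -> T -> 'rV[R]_(dx + da)) i :
  iid_layer P a b nu ->
  measurable [set w | `|a i w| <= K] /\ P [set w | `|a i w| <= K] = 1%E.
Proof.
move=> [law mean [I [F [ia [ib [[mF [FT [FI ind]]] [[iai [ibi iab]] [Fa Fb]]]]]]]].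
split; first exact: (layer_bounded_meas mF Fa).
exact: (layer_bounded_prob nuK law).
Qed.

End layer_statistics.

(** * Conditional laws along a run *)

Section run_layers.
Context (R : realType) (dx da : nat) (M : mdp R dx da).
Context (beta alpha : R) (sigma : R -> R).
Context (v0 mu0 : probability (R * 'rV[R]_(dx + da))%type R).
Context (N : nat) (d : measure_display) (T : measurableType d) (P : probability T R).
Local Notation Z := (stX M * acA M)%type.
Context (th : nat -> T -> params R dx da N) (xi xit : nat -> T -> Z).
Hypothesis (run : actor_critic_run beta alpha sigma v0 mu0 P th xi xit).

Lemma init_sigma_measurable j E : init_sigma th j E -> measurable E.
Proof.
case: j => [[i|i]|[i|i]] /= [B mB <-]; have [mC mW mB' mU] := init_meas run i.
- exact: mC.
- exact: mW.
- exact: mB'.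
- exact: mU.
Qed.

Lemma init_sigma_preimage j : init_sigma th j setT /\ setI_closed (init_sigma th j).
Proof.
case: j => [[i|i]|[i|i]] /=; split; try by exists setT; rewrite ?setTI.
all: by move=> _ _ [B mB <-] [C mC <-]; exists (B `&` C);
  [exact: measurableI|rewrite preimage_setI setIIr].
Qed.

Lemma critic_layer : iid_layer P (C0 th) (W0 th) v0.
Proof.
split; [exact: (init_lawCW run)|exact: (init_meanC run)|].
exists _, (init_sigma th), (fun i => inl (inl i)), (fun i => inl (inr i)).
split; last split; last split.
- split; first exact: init_sigma_measurable.
  split; first by move=> j; have [] := init_sigma_preimage j.
  split; first by move=> j; have [] := init_sigma_preimage j.
  exact: (init_indep run).
- by split; [move=> i j [] | split; [move=> i j []|]].
- by move=> i B mB; exists B => //; rewrite setTI.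
- by move=> i B mB; exists B => //; rewrite setTI.
Qed.

Lemma actor_layer : iid_layer P (B0 th) (U0 th) mu0.
Proof.
split; [exact: (init_lawBU run)|exact: (init_meanB run)|].
exists _, (init_sigma th), (fun i => inr (inl i)), (fun i => inr (inr i)).
split; last split; last split.
- split; first exact: init_sigma_measurable.
  split; first by move=> j; have [] := init_sigma_preimage j.
  split; first by move=> j; have [] := init_sigma_preimage j.
  exact: (init_indep run).
- by split; [move=> i j [] | split; [move=> i j []|]].
- by move=> i B mB; exists B => //; rewrite setTI.
- by move=> i B mB; exists B => //; rewrite setTI.
Qed.

Definition past_gen (k : nat) : set (set T) :=
  [set E | (exists j, init_sigma th j E) \/
        exists2 j, (j < k)%N &
          exists z, E = xi j @^-1` [set z] \/ E = xit j @^-1` [set z]].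

Lemma past_gen_measurable k D : past_gen k D -> measurable D.
Proof.
move=> [[j]|[j _ [z [->|->]]]]; first exact: init_sigma_measurable.
- exact: (xi_meas run).
- exact: (xit_meas run).
Qed.

Lemma past_gen_mono k l : (k <= l)%N -> past_gen k `<=` past_gen l.
Proof.
move=> kl D [[j jD]|[j jk H]]; [by left; exists j|right; exists j => //].
exact: leq_trans jk kl.
Qed.

Definition critic_law j z (w : T) : R :=
  trans (xi j w) z.1 * polg beta sigma j (th j w) z.
Definition actor_law j z (w : T) : R :=
  trans_aux (xit j w) z.1 * polg beta sigma j (th j w) z.

Let polg01 j (t : params R dx da N) (z : Z) : 0 <= polg beta sigma j t z <= 1.
Proof.
have [[H _] _] := explore_pos (M := M) (actorP beta sigma t) (eta01 (j%:R / N%:R)).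
exact: H.
Qed.

Lemma critic_law01 j z w : 0 <= critic_law j z w <= 1.
Proof.
have /andP[t0 t1] := trans01 (xi j w) z.1; have /andP[g0 g1] := polg01 j (th j w) z.
by rewrite mulr_ge0//= -[leRHS]mulr1 ler_pM.
Qed.

Lemma actor_law01 j z w : 0 <= actor_law j z w <= 1.
Proof.
have /andP[t0 t1] := trans_aux01 (xit j w) z.1; have /andP[g0 g1] := polg01 j (th j w) z.
by rewrite mulr_ge0//= -[leRHS]mulr1 ler_pM.
Qed.

(** Contains the states up to time n inclusive: the law of state n+1 is conditional on this
    family. *)
Let H n := past_gen n.+1.
Let mH n D : H n D -> measurable D. Proof. exact: past_gen_measurable. Qed.
Let Hmono n m : (n <= m)%N -> H n `<=` H m. Proof. by move=> nm; exact: past_gen_mono. Qed.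

Definition mart_bound (p : nat) (K t : R) : R :=
  2 * p%:R ^+ p * (2 * (K + #|{: Z}|%:R * K)) ^+ p * expR t.

(* The weights v are bounded only up to step N t, so set them to 0 afterwards. *)
Let trunc_mom (x : nat -> T -> Z) (Y : nat -> Z -> T -> R)
    (v : nat -> Z -> Z -> R) (p : nat) (K t : R) (k : nat) :
  (forall n z, H n (x n @^-1` [set z])) ->
  (forall n z w, 0 <= Y n z w <= 1) ->
  (forall n z, is_cond_prob P <<s H n >> (x n.+1 @^-1` [set z]) (Y n z)) ->
  (0 < N)%N -> 0 < K ->
  (forall j, j%:R <= N%:R * t -> forall z z', `|v j z z'| <= K) ->
  k%:R <= N%:R * t ->
  momb P p (Num.sqrt N%:R) (fun w => `|\sum_(j < k) (v j (x j w) (x j.+1 w)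
     - \sum_z Y j z w * v j (x j w) z)|) (mart_bound p K t).
Proof.
move=> xH Y01 law N0 K0 vK kt.
pose v' j z z' : R := if j%:R <= N%:R * t then v j z z' else 0.
have v'K n z z' : `|v' n z z'| <= K.
  by rewrite /v'; case: ifP => [nt|_]; [exact: vK|rewrite normr0 ltW].
have := chain_moment mH Hmono xH Y01 law K0 v'K p (n := k) (s := Num.sqrt N%:R) (t := t).
have E : (fun w => `|\sum_(j < k) chain_incr x Y v' j w|) = (fun w =>
   `|\sum_(j < k) (v j (x j w) (x j.+1 w) - \sum_z Y j z w * v j (x j w) z)|).
  apply/funext => w; congr (`|_|); apply: eq_bigr => j _.
  have jt : j%:R <= N%:R * t by apply: le_trans kt; rewrite ler_nat ltnW.
  by rewrite /chain_incr /v' jt.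
move=> mom; rewrite -E; split=> [|//|].
  by apply: bmeas_norm; apply: bmeas_sum => j _; exact: (chain_incr_bmeas mH Hmono xH Y01 law).
apply: mom; last by rewrite sqr_sqrtr// mulrC.
by rewrite -[leLHS]sqrtr1 ler_wsqrtr// ler1n.
Qed.

Lemma critic_mart_moment (v : nat -> Z -> Z -> R) (p : nat) (K t : R) (k : nat) :
  (0 < N)%N -> 0 < K ->
  (forall j, j%:R <= N%:R * t -> forall z z', `|v j z z'| <= K) ->
  k%:R <= N%:R * t ->
  momb P p (Num.sqrt N%:R) (fun w => `|\sum_(j < k) (v j (xi j w) (xi j.+1 w)
     - \sum_z critic_law j z w * v j (xi j w) z)|) (mart_bound p K t).
Proof.
apply: trunc_mom => [n z|n z w|n z].
- by right; exists n => //; exists z; left.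
- exact: critic_law01.
- exact: (xi_step run).
Qed.

Lemma actor_mart_moment (v : nat -> Z -> Z -> R) (p : nat) (K t : R) (k : nat) :
  (0 < N)%N -> 0 < K ->
  (forall j, j%:R <= N%:R * t -> forall z z', `|v j z z'| <= K) ->
  k%:R <= N%:R * t ->
  momb P p (Num.sqrt N%:R) (fun w => `|\sum_(j < k) (v j (xit j w) (xit j.+1 w)
     - \sum_z actor_law j z w * v j (xit j w) z)|) (mart_bound p K t).
Proof.
apply: trunc_mom => [n z|n z w|n z].
- by right; exists n => //; exists z; right.
- exact: actor_law01.
- exact: (xit_step run).
Qed.

End run_layers.

(** * Moment bounds for the error *)

Section good_event.
Context (R : realType).

(** Covers all larger K as well, so that the sum of two thresholds serves both layers. *)
Lemma bounded_support_prob m (nu : probability (R * 'rV[R]_m)%type R) :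
  bounded_support nu ->
  exists2 K0 : R, 0 <= K0 & forall K, K0 <= K -> nu [set y | `|y.1| <= K] = 1%E.
Proof.
move=> [K1 K1E]; exists `|K1| => // K hK.
have mI (c : R) (f : R * 'rV[R]_m -> R) : measurable_fun [set: R * 'rV[R]_m] f ->
    measurable [set y | `|f y| <= c].
  move=> mf; rewrite (_ : mkset _ = f @^-1` `[- c, c]).
    by rewrite -[X in measurable X]setTI; exact: mf.
  by apply/seteqP; split=> y /=; rewrite in_itv/= ler_norml.
have mK := mI K _ measurable_fst.
have mS : measurable [set y : R * 'rV[R]_m | `|y.1| <= K1 /\ forall j, `|y.2 0 j| <= K1].
  rewrite (_ : mkset _ = [set y | `|y.1| <= K1] `&`
     \bigcap_(j in [set: 'I_m]) [set y : R * 'rV[R]_m | `|y.2 0 j| <= K1]); last first.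
    apply/seteqP; split=> y /= [y1 y2]; split => // j; first by move=> _; exact: y2.
    exact: y2 I.
  apply: measurableI; first exact: mI measurable_fst.
  apply: fin_bigcap_measurable => // j _; apply: mI.
  by apply: (measurableT_comp (measurable_coord j)); exact: measurable_snd.
apply/eqP; rewrite eq_le probability_le1//= -[leLHS]K1E.
apply: le_measure; rewrite ?inE//.
move=> y [/= y1 _]; apply: le_trans y1 _; exact: le_trans (ler_norm _) hK.
Qed.

Context d (T : measurableType d) (P : probability T R).

Lemma prob1_ae (E : set T) : measurable E -> P E = 1%E -> {ae P, forall w, E w}.
Proof.
move=> mE PE; exists (~` E); split=> //; first exact: measurableC.
by rewrite probability_setC// PE subee.
Qed.

(** [f] is not assumed measurable, so its p-th moment is bounded as an extended-real integral,
    through a measurable majorant. *)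
Lemma moment_ae_le (p : nat) (r C : R) (f g : T -> R) : momb P p r g C ->
  (forall w, 0 <= f w) -> {ae P, forall w, f w <= g w} ->
  (\int[P]_w (f w ^+ p)%:E <= (C * r ^+ p)%:E)%E.
Proof.
move=> [bg g0 gC] f0 fg.
have bgp : bmeas (fun w => g w ^+ p) by exact: bmeas_exp.
apply: (@le_trans _ _ (\int[P]_w (g w ^+ p)%:E)%E).
  apply: ge0_ae_le_integral_nomeas => [w|w||].
  - by rewrite lee_fin exprn_ge0.
  - by rewrite lee_fin exprn_ge0.
  - by apply/measurable_EFinP; case: bgp.
  - by apply: filterS fg => w fgw; rewrite lee_fin lerXn2r ?nnegrE.
rewrite -[leLHS]fineK ?lee_fin//.
exact: integrable_fin_num (bmeas_int P measurableT bgp).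
Qed.

End good_event.

Section run_moment.
Context (R : realType) (dx da : nat) (M : mdp R dx da) (beta alpha : R) (sigma : R -> R).
Hypotheses (hbeta : 2^-1 < beta < 1) (halpha : 0 < alpha) (hsigma : activation sigma).
Local Notation Z := (stX M * acA M)%type.
Context (v0 mu0 : probability (R * 'rV[R]_(dx + da))%type R) (K : R).
Hypotheses (K0 : 0 <= K) (v0K : v0 [set y | `|y.1| <= K] = 1%E)
  (mu0K : mu0 [set y | `|y.1| <= K] = 1%E).
Context (T Ld Bb : R) (Q0 P0 : R -> Z -> R) (FQ FP : Z -> R -> R) (hC hA : Z -> R -> Z -> R).
Hypotheses (T0 : 0 <= T)
  (lf : limit_facts alpha T Ld Bb Q0 P0 (Bmean sigma v0) (Bmean sigma mu0) FQ FP hC hA).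

(* Bounds the initial outer weights and N^(beta-1) times the initial critic. *)
Definition start_K : R := (#|{: Z}|%:R + 1) * K.
Definition ker_K : R := \sum_(zz : Z * Z) (1 + K ^+ 2 * `|gram zz.1 zz.2| + Bb).
Definition drift_K : R := alpha * Bb * Ld + Ld + 1.
Definition fluct_C (p : nat) : R :=
  #|{: Z}|%:R ^+ p * \sum_(z : Z)
    (2 ^+ p * (mart_bound M p drift_K T + mart_bound M p drift_K T)).
(** The nested powers 2^p follow the bracketing of the sum in [run_bound], one for each use of
    [mombD]. *)
Definition run_C (p : nat) : R :=
  path_C M alpha start_K T ker_K Ld Bb ^+ p * (2 ^+ p * (2 ^+ p * (2 ^+ p * (1 ^+ p +
    2 ^+ p * (2 ^+ p * (2 ^+ p * (out_bound M K p + out_bound M K p) + ker_bound_cst M K p)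
      + ker_bound_cst M K p)) + fluct_C p) + T ^+ p * fluct_C p)).
Definition time_C (p : nat) : R := 2 ^+ p * (run_C p + Ld ^+ p).

Let Ld0 : 0 <= Ld. Proof. exact: lfL lf. Qed.
Let Bb0 : 0 <= Bb. Proof. exact: lfB lf. Qed.

Let start_K0 : 0 <= start_K. Proof. by rewrite mulr_ge0// addr_ge0. Qed.
Let ker_K0 : 0 <= ker_K.
Proof.
by apply: sumr_ge0 => zz _; rewrite !addr_ge0// mulr_ge0// exprn_ge0.
Qed.
Let drift_K0 : 0 < drift_K.
Proof. by rewrite ltr_wpDl// addr_ge0// !mulr_ge0// ltW. Qed.

Lemma fluct_C_ge0 p : 0 <= fluct_C p.
Proof.
have mb0 : 0 <= mart_bound M p drift_K T.
  have d0 := ltW drift_K0.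
  by rewrite !mulr_ge0 ?expR_ge0 ?exprn_ge0// mulr_ge0// addr_ge0// mulr_ge0.
rewrite mulr_ge0 ?exprn_ge0//; apply: sumr_ge0 => z _.
by rewrite mulr_ge0 ?exprn_ge0// addr_ge0.
Qed.

Context (N : nat) (d : measure_display) (Om : measurableType d) (P : probability Om R).
Context (th : nat -> Om -> params R dx da N) (xi xit : nat -> Om -> Z).
Hypotheses (N0 : (0 < N)%N)
  (run : actor_critic_run beta alpha sigma v0 mu0 P th xi xit).
Local Notation n := (N%:R : R).
Local Notation q0 := (outstat M beta sigma K (C0 th) (W0 th)).
Local Notation p0 := (outstat M beta sigma K (B0 th) (U0 th)).
Local Notation kv := (kerstat M sigma v0 K (C0 th) (W0 th)).
Local Notation ku := (kerstat M sigma mu0 K (B0 th) (U0 th)).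
Local Notation thw w := (fun k => th k w).
Local Notation xiw w := (fun k => xi k w).
Local Notation xitw w := (fun k => xit k w).

Definition run_fluct j w : R := fluct beta alpha sigma (thw w) (xiw w) (xitw w)
  (Bmean sigma v0) Q0 hC hA j.

(** Measurable majorant of the total error at step k; its randomness sits in statistics whose
    moments are of the required order. *)
Definition run_bound k w : R := path_C M alpha start_K T ker_K Ld Bb *
  (scl beta N + (q0 w + p0 w + kv w + ku w) + run_fluct k w
     + n^-1 * \sum_(j < k) run_fluct j w).

Let n0 : 0 < n. Proof. by rewrite ltr0n. Qed.
Let r0 : 0 <= rate beta N. Proof. exact: rate_ge0. Qed.

Let tm_itv j : j%:R <= n * T -> 0 <= j%:R / n <= T.
Proof. by move=> jT; rewrite divr_ge0 ?ler0n//= ler_pdivrMr// mulrC. Qed.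

Let vC_le z j z1 z2 : j%:R <= n * T ->
  `|vC alpha N (Bmean sigma v0) Q0 hC z j z1 z2| <= drift_K.
Proof.
move=> /tm_itv jT; have /andP[g0 g1] := gam_bound M.
apply: le_trans (ler_normD _ _) _; rewrite /drift_K.
have h1 := lfC lf z z2 jT.
suff : `|alpha * gam M * Bmean sigma v0 z z1 * Q0 (j%:R / n) z2| <= alpha * Bb * Ld by lra.
rewrite !normrM (gtr0_norm halpha) (gtr0_norm g0); apply: ler_pM => //.
- by rewrite !mulr_ge0// ltW.
- apply: ler_pM => //; first by rewrite mulr_ge0// ltW.
  + by rewrite ler_piMr// ltW.
  + exact: lfBv lf _ _.
- exact: (lfQ lf _ jT).
Qed.

Let vA_le z j z1 z2 : j%:R <= n * T -> `|vA N hA z j z1 z2| <= drift_K.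
Proof.
move=> /tm_itv jT; apply: le_trans (lfA lf z z2 jT) _; rewrite /drift_K.
by rewrite -addrA addrCA lerDl addr_ge0// !mulr_ge0// ltW.
Qed.

Lemma run_fluct_moment p j : (0 < p)%N -> j%:R <= n * T ->
  momb P p (rate beta N) (run_fluct j) (fluct_C p).
Proof.
move=> p0 jT; apply: (momb_scale (r := Num.sqrt n)).
- exact: fluct_C_ge0.
- exact: sqrtr_ge0.
- by rewrite invr_ge0 ltW.
- exact: sqrt_div.
apply: momb_sum => // z; apply: mombD => //.
- apply: (critic_mart_moment run p N0 drift_K0 _ jT) => i iT z1 z2.
  exact: vC_le.
- apply: (actor_mart_moment run p N0 drift_K0 _ jT) => i iT z1 z2.
  exact: vA_le.
Qed.

Lemma run_bound_moment p k : (0 < p)%N -> k%:R <= n * T ->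
  momb P p (rate beta N) (run_bound k) (run_C p).
Proof.
move=> p_gt0 kT; have [cl al] := (critic_layer run, actor_layer run).
apply: mombZ; first exact: (path_C_ge0 halpha start_K0 T0 ker_K0 lf).
apply: mombD => //; last first.
  apply: momb_avg => // [|j jk]; first exact: fluct_C_ge0.
  apply: run_fluct_moment => //; apply: le_trans kT; rewrite ler_nat; exact: ltnW.
apply: mombD => //; last exact: run_fluct_moment.
apply: mombD => //.
  apply: momb_cst; rewrite mul1r scl_le_rate andbT.
  by have /andP[/ltW] := scl01 hbeta N0.
apply: mombD => //; last exact: kerstat_moment.
apply: mombD => //; last exact: kerstat_moment.
apply: mombD => //; first exact: (outstat_moment M hbeta hsigma K0 v0K p_gt0 N0 cl).
exact: (outstat_moment M hbeta hsigma K0 mu0K p_gt0 N0 al).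
Qed.

Let good_critic : {ae P, forall w, forall i, `|C0 th i w| <= K}.
Proof.
apply: filter_forall => i.
by have [m1 m2] := layer_good v0K i (critic_layer run); exact: prob1_ae m2.
Qed.

Let good_actor : {ae P, forall w, forall i, `|B0 th i w| <= K}.
Proof.
apply: filter_forall => i.
by have [m1 m2] := layer_good mu0K i (actor_layer run); exact: prob1_ae m2.
Qed.

Let outstat_ge (a : 'I_N -> Om -> R) (b : 'I_N -> Om -> 'rV[R]_(dx + da)) w (z : Z) :
  (forall i, `|a i w| <= K) ->
  `|net beta sigma (a^~ w) (b^~ w) z| <= outstat M beta sigma K a b w.
Proof.
move=> aK; rewrite /outstat (bigD1 z)//= -[leLHS]addr0; apply: lerD; last exact: sumr_ge0.
rewrite /net powR_scl// le_eqVlt; apply/orP; left; apply/eqP; congr (`|_ * _|).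
by apply: eq_bigr => i _; rewrite clip_id.
Qed.

Let kerstat_ge (nu : probability (R * 'rV[R]_(dx + da))%type R)
    (a : 'I_N -> Om -> R) (b : 'I_N -> Om -> 'rV[R]_(dx + da)) w (z z' : Z) :
  (forall i, `|a i w| <= K) ->
  `|mker sigma (derive1 sigma) (@gram _ _ _ M) (a^~ w)
      (fun i z => dotv (b i w) (emb z)) z z' - Bmean sigma nu z z'|
  <= kerstat M sigma nu K a b w.
Proof.
move=> aK; rewrite /kerstat (bigD1 (z, z'))//= -[leLHS]addr0.
apply: lerD; last exact: sumr_ge0.
have -> : \sum_i (lker sigma (gram z z') (emb z) (emb z') (clip K (a i w)) (b i w)
      - Bmean sigma nu z z') =
    \sum_i (lker sigma (gram z z') (emb z) (emb z') (a i w) (b i w) - Bmean sigma nu z z').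
  by apply: eq_bigr => i _; rewrite clip_id.
rewrite sumrB sumr_const card_ord mulrBr /mker -[Bmean sigma nu z z' *+ N]mulr_natl.
by rewrite [n^-1 * (n * _)]mulrA mulVf ?mul1r// gt_eqF.
Qed.

Let kerstat_le (nu : probability (R * 'rV[R]_(dx + da))%type R)
    (a : 'I_N -> Om -> R) (b : 'I_N -> Om -> 'rV[R]_(dx + da)) w :
  (forall z z' : Z, `|Bmean sigma nu z z'| <= Bb) ->
  0 <= kerstat M sigma nu K a b w <= ker_K.
Proof.
move=> BB; apply/andP; split; first exact: sumr_ge0.
apply: ler_sum => -[z z'] _ /=; have [s1 s'1 _ _ _] := activation_lip hsigma.
have ni0 : 0 <= n^-1 by rewrite invr_ge0 ltW.
rewrite normrM (ger0_norm ni0) ler_pdivrMl//.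
apply: le_trans (ler_norm_sum _ _ _) _.
rewrite mulr_natl -[X in _ *+ X]card_ord -sumr_const; apply: ler_sum => i _.
apply: le_trans (ler_normB _ _) _; apply: lerD; last exact: BB.
apply: le_trans (ler_normD _ _) _; apply: lerD.
  by rewrite normrM -[leRHS]mulr1 ler_pM.
rewrite normrM; apply: ler_wpM2r => //.
rewrite -mulrA normrM -[leRHS]mulr1; apply: ler_pM => //.
  by rewrite normrX lerXn2r ?nnegrE//; exact: clip_le.
by rewrite normrM -[leRHS]mulr1 ler_pM.
Qed.

(** Holds at every sample point thanks to the truncation; it supplies the hypothesis eps q0 <= K
    that makes the error linear. *)
Let outstat_le (a : 'I_N -> Om -> R) (b : 'I_N -> Om -> 'rV[R]_(dx + da)) w :
  scl beta N * outstat M beta sigma K a b w <= start_K.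
Proof.
have [s1 _ _ _ _] := activation_lip hsigma.
have /andP[e0 _] := scl01 hbeta N0.
apply: (@le_trans _ _ (#|{: Z}|%:R * K)); last first.
  by apply: ler_wpM2r => //; rewrite lerDl.
rewrite mulr_natl -sumr_const mulr_sumr; apply: ler_sum => z _.
have ni0 : 0 <= (n * scl beta N)^-1 by rewrite invr_ge0 mulr_ge0// ltW.
rewrite normrM (ger0_norm ni0) mulrA invfM [scl beta N * _]mulrCA mulfV ?gt_eqF// mulr1.
rewrite ler_pdivrMl//; apply: le_trans (ler_norm_sum _ _ _) _.
rewrite mulr_natl -[X in _ *+ X]card_ord -sumr_const; apply: ler_sum => i _.
by rewrite normrM -[leRHS]mulr1 ler_pM//; exact: clip_le.
Qed.

Lemma run_bound_ge k : k%:R <= n * T ->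
  {ae P, forall w, eQ beta sigma (thw w) Q0 k + eP beta sigma (thw w) P0 k
     <= run_bound k w}.
Proof.
move=> kT; apply: filterS2 good_critic good_actor => w Cw Bw.
have KK : K <= start_K by rewrite ler_peMl// lerDr.
apply: (path_error (K := start_K) (T := T) (KM := ker_K) (q0 := q0 w) (p0 := p0 w)
  (kv := kv w) (ku := ku w) hbeta halpha hsigma N0 _ _ _ _ _ _ _ _ _ _ _ _ _ lf kT) => //.
- by move=> j; exact: th_step run j w.
- by move=> i; exact: le_trans (Cw i) KK.
- by move=> i; exact: le_trans (Bw i) KK.
- by move=> z; exact: outstat_ge.
- by move=> z; exact: outstat_ge.
- by apply: kerstat_le => z z'; exact: lfBv lf z z'.
- by apply: kerstat_le => z z'; exact: lfBu lf z z'.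
- by move=> z z'; exact: kerstat_ge.
- by move=> z z'; exact: kerstat_ge.
Qed.

(** The grid point below t is at distance at most 1/N <= N^(beta-1), which the Lipschitz continuity
    of the limits absorbs. *)
Lemma time_moment p (t : R) : (0 < p)%N -> 0 <= t <= T ->
  (\int[P]_w (supdist (actor_at beta sigma th t w) (P0 t) ^+ p)%:E
     <= (time_C p * rate beta N ^+ p)%:E)%E /\
  (\int[P]_w (supdist (critic_at beta sigma th t w) (Q0 t) ^+ p)%:E
     <= (time_C p * rate beta N ^+ p)%:E)%E.
Proof.
move=> p_gt0 /andP[t0 tT].
pose k := Num.truncn (n * t).
have nt0 : 0 <= n * t by rewrite mulr_ge0// ltW.
have /andP[k1 k2] : k%:R <= n * t < k.+1%:R by exact: truncn_itv.
have kT : k%:R <= n * T by apply: le_trans k1 _; rewrite ler_pM2l.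
have kt : k%:R / n <= t by rewrite ler_pdivrMr// mulrC.
have tk : t - k%:R / n <= scl beta N.
  apply: (@le_trans _ _ n^-1).
    rewrite lerBlDl (_ : k%:R / n + n^-1 = k.+1%:R / n); last by rewrite -natr1 mulrDl mul1r.
    by rewrite ler_pdivlMr// mulrC ltW.
  rewrite -powR_inv1 ?ler0n// /scl ler_powR ?ler1n//.
  by case/andP: hbeta => b1 b2; lra.
have e0 : 0 <= scl beta N by rewrite powR_ge0.
have k0 : 0 <= k%:R / n by rewrite divr_ge0 ?ler0n// ltW.
have mb : momb P p (rate beta N) (fun w => run_bound k w + Ld * scl beta N) (time_C p).
  apply: mombD => //; first exact: run_bound_moment.
  apply: momb_cst; rewrite mulr_ge0//=; apply: ler_wpM2l => //; exact: scl_le_rate.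
have shift (u v v' : Z -> R) : (forall z, `|v' z - v z| <= Ld * (t - k%:R / n)) ->
    supdist u v' <= supdist u v + Ld * scl beta N.
  move=> vv; apply: supdist_le => [|z].
    by rewrite addr_ge0 ?supdist_ge0// mulr_ge0.
  rewrite -[u z - v' z](subrKA (v z)); apply: le_trans (ler_normD _ _) _.
  apply: lerD; first exact: supdist_ge.
  rewrite distrC; apply: le_trans (vv z) _; exact: ler_wpM2l.
split; apply: moment_ae_le mb _ _ => [w|]; try exact: supdist_ge0.
- apply: filterS (run_bound_ge kT) => w h.
  apply: le_trans (shift _ (P0 (k%:R / n)) _ _) _.
    by move=> z; exact: (lfP_lip lf).
  by rewrite lerD2r (le_trans _ h)// lerDr supdist_ge0.
- apply: filterS (run_bound_ge kT) => w h.
  apply: le_trans (shift _ (Q0 (k%:R / n)) _ _) _.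
    by move=> z; exact: (lfQ_lip lf).
  by rewrite lerD2r (le_trans _ h)// lerDl supdist_ge0.
Qed.

End run_moment.

(** * Convergence of the rate and of the norms *)

Section rate_asymptotics.
Context (R : realType).

Lemma powR_nat_cvg0 (a : R) : 0 < a -> N%:R `^ (- a) @[N --> \oo] --> 0.
Proof.
move=> a0; apply/cvgr0Pnorm_lt => e e0.
have := powR_cvg0 a0; move/cvgr0Pnorm_lt => /(_ _ e0) [dl /= dl0 H].
near=> N.
have N0 : 0 < N%:R :> R by rewrite ltr0n; near: N; exists 1%N.
have -> : N%:R `^ (- a) = N%:R^-1 `^ a :> R.
  by rewrite -powR_inv1 ?ltW// -powRrM mulN1r.
apply: H; last by rewrite invr_gt0.
rewrite /ball /= sub0r normrN gtr0_norm ?invr_gt0//.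
rewrite invf_plt ?posrE//; near: N; exact: nbhs_infty_gtr.
Unshelve. all: by end_near. Qed.

Context (beta : R).
Hypothesis hbeta : 2^-1 < beta < 1.

Lemma rate_cvg0 : rate beta N @[N --> \oo] --> 0.
Proof.
have /andP[b1 b2] := hbeta; rewrite -[X in _ --> X]addr0; apply: cvgD.
  by rewrite /scl -[beta - 1]opprB; apply: powR_nat_cvg0; rewrite subr_gt0.
by rewrite -[2^-1 - beta]opprB; apply: powR_nat_cvg0; rewrite subr_gt0.
Qed.

Lemma rate_pow_le (N p : nat) : rate beta N ^+ p <=
  2 ^+ p * (N%:R `^ (p%:R * (beta - 1)) + N%:R `^ (p%:R * (2^-1 - beta))).
Proof.
have E (x : R) : N%:R `^ (p%:R * x) = (N%:R `^ x) ^+ p.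
  by rewrite mulrC powRrM powR_mulrn// powR_ge0.
rewrite !E -/(scl beta N).
have := @power_mean R bool (fun b => if b then scl beta N else N%:R `^ (2^-1 - beta)) p.
rewrite !big_bool card_bool /= => H.
apply: le_trans (H _); last by case; exact: powR_ge0.
rewrite ler_peMr ?exprn_ge0 ?rate_ge0//; lra.
Qed.

End rate_asymptotics.

Section error_norms.
Context (R : realType).

Lemma Lnorm_moment_le d (T : measurableType d) (P : probability T R) (p : nat)
    (f : T -> R) (C r : R) : (0 < p)%N -> (forall w, 0 <= f w) -> 0 <= C -> 0 <= r ->
  (\int[P]_w (f w ^+ p)%:E <= (C * r ^+ p)%:E)%E ->
  ('N[P]_(p%:R%:E)[(fun w => (f w)%:E)] <= (C `^ p%:R^-1 * r)%:E)%E.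
Proof.
move=> p0 f0 C0 r0 fC; rewrite unlock.
have pn0 : p%:R != 0 :> R by rewrite pnatr_eq0 -lt0n.
under eq_integral => w _.
  rewrite abse_EFin ger0_norm// poweR_EFin powR_mulrn//; over.
have -> : (C `^ p%:R^-1 * r)%:E = ((C * r ^+ p)%:E `^ p%:R^-1)%E.
  rewrite poweR_EFin powRM ?exprn_ge0// -powR_mulrn// -powRrM mulfV// powRr1//.
apply: gt0_ler_poweR fC; rewrite ?invr_ge0// in_itv/= leey andbT.
- by apply: integral_ge0 => w _; rewrite lee_fin exprn_ge0.
- by rewrite lee_fin mulr_ge0// exprn_ge0.
Qed.

(** Squeezed between 0 and C^(1/p) times the rate; the point t = 0 keeps the supremum from being
    taken over an empty set. *)
Lemma sup_Lnorm_cvg0 (disp : nat -> measure_display) (Om : forall N, measurableType (disp N))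
    (P : forall N, probability (Om N) R) (f : forall N, R -> Om N -> R)
    (T C beta : R) (p : nat) : (0 < p)%N -> 0 <= T -> 0 <= C -> 2^-1 < beta < 1 ->
  (forall N t w, 0 <= f N t w) ->
  (forall N t, (0 < N)%N -> 0 <= t <= T ->
     (\int[P N]_w (f N t w ^+ p)%:E <= (C * rate beta N ^+ p)%:E)%E) ->
  (fun N => ereal_sup
    [set 'N[P N]_(p%:R%:E)[(fun w => (f N t w)%:E)]%E | t in `[0, T]]) @ \oo --> 0%E.
Proof.
move=> p0 T0 C0 hbeta f0 fC.
apply: (@squeeze_cvge _ _ _ _ (fun=> 0%E) _ (fun N => (C `^ p%:R^-1 * rate beta N)%:E)).
- near=> N; have N0 : (0 < N)%N by near: N; exists 1%N.
  apply/andP; split.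
    apply: (@le_trans _ _ 'N[P N]_(p%:R%:E)[(fun w => (f N 0 w)%:E)]%E).
      exact: Lnorm_ge0.
    by apply: ereal_sup_ubound; exists 0 => //=; rewrite in_itv/= lexx.
  apply: ge_ereal_sup => _ [t /= tT <-]; move: tT; rewrite in_itv/= => tT.
  by apply: Lnorm_moment_le => //; [exact: rate_ge0|exact: fC].
- exact: cvg_cst.
- apply: cvg_EFin; first by near=> N.
  rewrite -[X in _ --> X](mulr0 (C `^ p%:R^-1)).
  by apply: cvgM; [exact: cvg_cst|exact: rate_cvg0].
Unshelve. all: by end_near. Qed.

End error_norms.

Theorem theorem3p7 (R : realType) (dx da : nat) (M : mdp R dx da)
    (statd statd_aux : (stX M * acA M -> R) -> stX M * acA M -> R)
    (hM : standing_assumption statd statd_aux)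
    (beta alpha : R) (hbeta : 2^-1 < beta < 1) (halpha : 0 < alpha)
    (sigma : R -> R) (hsigma : activation sigma)
    (v0 mu0 : probability (R * 'rV[R]_(dx + da))%type R)
    (hv0 : bounded_support v0) (hmu0 : bounded_support mu0)
    (d : nat -> measure_display) (Omega : forall N : nat, measurableType (d N))
    (Pr : forall N : nat, probability (Omega N) R)
    (th : forall N : nat, nat -> Omega N -> params R dx da N)
    (xi xit : forall N : nat, nat -> Omega N -> stX M * acA M)
    (hrun : forall N : nat, (0 < N)%N ->
      actor_critic_run beta alpha sigma v0 mu0 (Pr N) (th N) (xi N) (xit N))
    (Q0 P0 : R -> stX M * acA M -> R)
    (hlim : limit_system statd statd_aux alpha sigma v0 mu0 Q0 P0)
    (T : R) (hT : 0 <= T) (p : nat) :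
  let errP (N : nat) (t : R) (w : Omega N) : R :=
    \big[Num.max/0]_(z : stX M * acA M)
      `|actor_at beta sigma (th N) t w z - P0 t z| in
  let errQ (N : nat) (t : R) (w : Omega N) : R :=
    \big[Num.max/0]_(z : stX M * acA M)
      `|critic_at beta sigma (th N) t w z - Q0 t z| in
  (exists (C : R) (N0 : nat), forall N : nat, (N0 < N)%N ->
    let bound := C * (N%:R `^ (p%:R * (beta - 1))
                      + N%:R `^ (p%:R * (2^-1 - beta))) in
    (ereal_sup [set 'E_(Pr N)[fun w => (errP N t w ^+ p)%R] | t in `[0%R, T]]
       <= bound%:E)%E /\
    (ereal_sup [set 'E_(Pr N)[fun w => (errQ N t w ^+ p)%R] | t in `[0%R, T]]
       <= bound%:E)%E) /\
  ((0 < p)%N ->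
    (fun N : nat => ereal_sup
       [set 'N[Pr N]_(p%:R%:E)[(fun w => (errP N t w)%:E)]%E | t in `[0, T]])
      @ \oo --> 0%E /\
    (fun N : nat => ereal_sup
       [set 'N[Pr N]_(p%:R%:E)[(fun w => (errQ N t w)%:E)]%E | t in `[0, T]])
      @ \oo --> 0%E).
Proof.
move=> errP errQ.
have [Kv Kv0 hKv] := bounded_support_prob hv0.
have [Ku Ku0 hKu] := bounded_support_prob hmu0.
have K0 : 0 <= Kv + Ku by exact: addr_ge0.
have vK : v0 [set y | `|y.1| <= Kv + Ku] = 1%E by apply: hKv; rewrite lerDl.
have uK : mu0 [set y | `|y.1| <= Kv + Ku] = 1%E by apply: hKu; rewrite lerDr.
have [Ld [Bb [hC [hA lf]]]] := limit_facts_exist hM halpha hlim hT.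
(* For p = 0 the moment is at most 1 and the bound is 1 + 1; the moment calculus needs p > 0. *)
have [->|p_gt0] := posnP p.
  split=> //; exists 1, 0%N => N N0 bound.
  have bE : bound = 1 + 1 by rewrite /bound !mul0r !powRr0 mul1r.
  have E1 (f : Omega N -> R) : ('E_(Pr N)[fun w => (f w ^+ 0)%R] <= bound%:E)%E.
    rewrite unlock; under eq_integral do rewrite expr0.
    rewrite integral_cst// mul1e (le_trans (probability_le1 _ measurableT))//.
    by rewrite lee_fin bE lerDl.
  by split; apply: ge_ereal_sup => _ [t _ <-].
(* The absolute value makes the constant nonnegative at once, as the p-th root requires. *)
pose C := `|time_C M alpha (Kv + Ku) T Ld Bb p|.
have C0 : 0 <= C by exact: normr_ge0.
have mom N t : (0 < N)%N -> 0 <= t <= T ->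
    (\int[Pr N]_w (errP N t w ^+ p)%:E <= (C * rate beta N ^+ p)%:E)%E /\
    (\int[Pr N]_w (errQ N t w ^+ p)%:E <= (C * rate beta N ^+ p)%:E)%E.
  move=> N0 tT.
  have [HP HQ] := time_moment hbeta halpha hsigma K0 vK uK hT lf N0 (hrun N N0) p_gt0 tT.
  have CC : (time_C M alpha (Kv + Ku) T Ld Bb p * rate beta N ^+ p <= C * rate beta N ^+ p)%R.
    by apply: ler_wpM2r; [exact/exprn_ge0/rate_ge0|exact: ler_norm].
  by split; [apply: le_trans HP _|apply: le_trans HQ _]; rewrite lee_fin.
have errP0 N t w : 0 <= errP N t w by exact: bigmax_ge_id.
have errQ0 N t w : 0 <= errQ N t w by exact: bigmax_ge_id.
split; last first.
  by move=> _; split; apply: (@sup_Lnorm_cvg0 _ _ _ _ _ T C beta p) => // N t N0 tT;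
    have [] := mom N t N0 tT.
(* The factor 2^p is the price of splitting the p-th power of the rate by [rate_pow_le]; every N >=
   1 is admissible. *)
exists (C * 2 ^+ p), 0%N => N N0 bound.
have bd : ((C * rate beta N ^+ p)%:E <= bound%:E)%E.
  rewrite lee_fin /bound -mulrA; apply: ler_wpM2l => //; exact: rate_pow_le.
by split; apply: ge_ereal_sup => _ [t /= tT <-]; move: tT; rewrite in_itv/= => tT;
  rewrite unlock; apply: le_trans bd; have [] := mom N t N0 tT.
Qed.
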